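(* Let $N\ge2$ be an integer, $m\in\mathbb{Z}$ and $t=\lfloor m/(N+1)\rfloor$. Then $\langle W_m\rangle^{{\rm SU}(N)_{-N-1}}(x;q)$ equals \[ \frac{1}{(q;q)_\infty}x^{-m}q^{(m-N)t+m/2}\frac{1-q^{Nt}}{1-q^t}\sum_{k\in\mathbb{Z}}(-1)^{Nk}x^{Nk}q^{Nk^2/2-mk}\quad\text{if } m\equiv0\pmod{N+1}, \] and \[ -\frac{1}{(q;q)_\infty}x^{-m}q^{mt+m/2}\sum_{k\in\mathbb{Z}}(-1)^{Nk}x^{Nk}q^{Nk^2/2-mk}\quad\text{if } m\not\equiv0\pmod{N+1}, \] where for $t=0$ the quotient $\frac{1-q^{Nt}}{1-q^t}$ is understood as $1+q^t+\dots+q^{(N-1)t}=N$.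
   Context: Let $|q|<1$, $x$ a nonzero parameter, $(a;q)_\infty=\prod_{k\ge0}(1-aq^k)$. Let $s_1,\dots,s_{N-1}$ be variables and $s_N:=(s_1\cdots s_{N-1})^{-1}$. For $m\in\mathbb{Z}$ define \[ \langle W_m\rangle^{{\rm SU}(N)_{-N-1}}(x;q):=\frac{(q;q)_\infty^{N-1}}{N!}\oint\prod_{i=1}^{N-1}\frac{ds_i}{2\pi i s_i}\prod_{\substack{i,j=1\\ i\ne j}}^N(s_is_j^{-1};q)_\infty\prod_{i=1}^N(q^{1/2}s_ix;q)_\infty(q^{1/2}s_i^{-1}x^{-1};q)_\infty\sum_{i=1}^N s_i^m, \] where the integral denotes the constant term in $s_1,\dots,s_{N-1}$ of the integrand expanded as a formal Laurent series in the $s_i$ (equivalently the contour integral over unit circles). *)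

(* Defs.v *)
From Stdlib Require Import Reals ZArith List.
From Coquelicot Require Import Coquelicot.
Open Scope R_scope.

Definition Cexpi (th : R) : C := (cos th, sin th).

Definition Cpowz (z : C) (k : Z) : C :=
  match k with
  | Z0 => 1%C
  | Zpos p => Cpow z (Pos.to_nat p)
  | Zneg p => Cinv (Cpow z (Pos.to_nat p))
  end.

Definition Clim (u : nat -> C) : C :=
  lim (T := C_CompleteNormedModule) (filtermap u eventually).

Definition cprod (l : list nat) (f : nat -> C) : C :=
  fold_right (fun i acc => Cmult (f i) acc) 1%C l.
Definition csum (l : list nat) (f : nat -> C) : C :=
  fold_right (fun i acc => Cplus (f i) acc) 0%C l.

Definition qpoch (a q : C) : C :=
  Clim (fun n => cprod (seq 0 n) (fun k => Cminus 1%C (Cmult a (Cpow q k)))).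

Definition zsum (f : Z -> C) : C :=
  Clim (fun n => csum (seq 0 (2 * n + 1))
                      (fun j => f (Z.of_nat j - Z.of_nat n)%Z)).

(* Normalised torus integral over (S^1)^n :
   (1/(2 pi))^n  int_{[0,2pi]^n} g(e^{i th_1}, ..., e^{i th_n}) dth,
   i.e. \oint prod ds_i/(2 pi i s_i) g(s), computed as an iterated integral. *)
Fixpoint torus_int (n : nat) (g : list C -> C) : C :=
  match n with
  | O => g nil
  | S n' => scal (/ (2 * PI))
              (RInt (V := C_R_CompleteNormedModule)
                 (fun th => torus_int n' (fun l => g (Cexpi th :: l))) 0 (2 * PI))
  end.

(* s_1..s_{N-1} are the entries of the list s (0-indexed: s_(i+1) = nth i s),
   s_N = (s_1 ... s_{N-1})^{-1}. *)
Definition sfull (N : nat) (s : list C) (i : nat) : C :=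
  if Nat.ltb i (N - 1) then nth i s 0%C
  else Cinv (fold_right Cmult 1%C s).

Definition integrand (N : nat) (m : Z) (x r : C) (s : list C) : C :=
  let q := Cmult r r in
  let S := sfull N s in
  Cmult (cprod (seq 0 N) (fun i => cprod (seq 0 N) (fun j =>
          if Nat.eqb i j then 1%C else qpoch (Cmult (S i) (Cinv (S j))) q)))
  (Cmult (cprod (seq 0 N) (fun i =>
          Cmult (qpoch (Cmult r (Cmult (S i) x)) q)
                (qpoch (Cmult r (Cinv (Cmult (S i) x))) q)))
         (csum (seq 0 N) (fun i => Cpowz (S i) m))).

Definition Wilson (N : nat) (m : Z) (x r : C) : C :=
  let q := Cmult r r in
  Cmult (Cmult (Cpow (qpoch q q) (N - 1)) (Cinv (RtoC (INR (fact N)))))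
        (torus_int (N - 1) (integrand N m x r)).

(* theta-type sum  sum_{k in Z} (-1)^{Nk} x^{Nk} q^{Nk^2/2 - mk},  with q^{1/2} = r *)
Definition theta_sum (N : nat) (m : Z) (x r : C) : C :=
  zsum (fun k =>
    let n := Z.of_nat N in
    Cmult (Cpowz (RtoC (-1)) (n * k)%Z)
      (Cmult (Cpowz x (n * k)%Z) (Cpowz r (n * k * k - 2 * m * k)%Z))).

(* Main.v *)
(** Write [u = x s]. By homogeneity the integral over SU(N) extracts from a symmetric function [G(u)]
    of [N] independent variables the coefficients [g_c] of [(u_1 ... u_N)^c], and the substitution
    [u -> q u] relates [g_(c+1)] to [g_c]; this produces the theta series, and only [g_0] remains.

    Write [theta(z) = (z;q)_oo (q/z;q)_oo] and [<h> = CT(h Phi)] with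
    [Phi = prod_(i<j) theta(u_i/u_j) prod_i theta(u_i)]. Since [(z;q)_oo (1/z;q)_oo = theta(z) (1 - 1/z)],
    [g_0] is a bracket with an additional Vandermonde factor, and antisymmetry of [Phi] replaces this
    factor by [N!]. Two relations then determine all brackets: exchanging [u_i] and [u_(i+1)] multiplies
    [Phi] by [- u_(i+1)/u_i], and the rotation [u -> (q u_N, u_1, ..., u_(N-1))] multiplies it by [- 1/u_N].
    They give [<u_j^m> = q^(2m-j) <u_j^(m-N-1)>], and [<u_j^m>], [1 <= m <= N], vanishes unless [j = m],
    when it is [- q^m <1>].

    The value [<1> = (q;q)_oo^(-N)] follows by induction on [N]: with [(u_i;q)_a (q/u_i;q)_oo] in place of
    [theta(u_i)], the same two relations show that the constant term is divided by [1 - q^(a+1)] when [a]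
    increases by one; for [a = 0] it is the constant term of [prod_(i<j) theta(u_i/u_j)], and for
    [a -> oo] it is that of the same product in [N + 1] variables. *)

Require Import Defs.
From Stdlib Require Import Reals ZArith List Lra Lia.
From Stdlib Require Import FunctionalExtensionality ClassicalEpsilon.
From Coquelicot Require Import Coquelicot.
Open Scope R_scope.
Local Open Scope C_scope.

(** The substitution [u -> q u] and the rotation leave the unit torus. Instead of shifting contours,
    the proof works with functions that are limits of Laurent polynomials uniformly on every
    annulus; on this class a monomial substitution preserves the integral as soon as it preserves
    the constant terms of monomials. A transposition turns [Phi] into [- (u_(i+1)/u_i) Phi], so the
    bracket of [u_(i+1) g] vanishes for every [g] symmetric in [u_i, u_(i+1)], and a power of
    [u_(i+1)] can be moved to [u_i] at the price of one unit of exponent, which stays behind as a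
    factor [u_(i+1)]. A power carried once round the cycle leaves the product of all variables
    behind, and [u -> q u] removes it. The period [N + 1] counts [N - 1] moves, one unit for the
    factor [1/u_N] of the rotation and one unit that completes the product. Convergence of the theta
    series is not derived from its terms: the partial sums, multiplied by [g_0], converge to the
    SU(N) integral, and [g_0] is nonzero. In the code variables are numbered from 0. *)

(** * Convergence of complex sequences *)

Definition Ccv (u : nat -> C) (l : C) : Prop :=
  forall eps : R, 0 < eps ->
  exists K, forall k, (K <= k)%nat -> Cmod (u k - l) < eps.

Lemma nonzero_inv (z : C) : z <> 0 -> / z <> 0.
Proof.
  intros Hz H. apply C1_nz. rewrite <- (Cinv_r z Hz), H. ring.
Qed.

Lemma Cmult_eq_reg_l (c a b : C) : c * a = c * b -> c <> 0 -> a = b.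
Proof.
  intros H Hc. replace a with (/ c * (c * a)) by (field; auto). rewrite H. field. auto.
Qed.

Lemma Cball_of_mod (x y : C) (eps : posreal) :
  Cmod (y - x) < eps -> ball (M := C_UniformSpace) x eps y.
Proof. apply C_NormedModule_mixin_compat1. Qed.

(** Balls of [C_UniformSpace] are squares, so passing to the modulus costs a factor sqrt 2, rounded
    up to 2. *)
Lemma Cmod_of_ball (x y : C) (eps : posreal) :
  ball (M := C_UniformSpace) x eps y -> Cmod (y - x) <= 2 * eps.
Proof.
  intros H. apply Rlt_le, Rlt_le_trans with (1 := C_NormedModule_mixin_compat2 x y eps H).
  apply Rmult_le_compat_r; [apply Rlt_le, cond_pos|].
  apply Rsqr_incr_0_var; [rewrite Rsqr_sqrt; unfold Rsqr; lra | lra].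
Qed.

Lemma filterlim_Ccv (u : nat -> C) (l : C) :
  filterlim u eventually (locally (T := C_UniformSpace) l) -> Ccv u l.
Proof.
  intros H eps Heps.
  assert (Hd : 0 < eps / 4) by lra.
  destruct (H (ball (M := C_UniformSpace) l (mkposreal _ Hd))) as [K HK].
  { exists (mkposreal _ Hd). auto. }
  exists K. intros k Hk. specialize (HK k Hk).
  apply Cmod_of_ball in HK. simpl in HK. lra.
Qed.

Lemma Cmod_small_eq (a b : C) : (forall eps, 0 < eps -> Cmod (a - b) <= eps) -> a = b.
Proof.
  intros H. assert (Hz : Cmod (a - b) = 0%R).
  { destruct (Rle_lt_or_eq_dec 0 (Cmod (a - b)) (Cmod_ge_0 _)) as [Hl|He]; [|auto].
    specialize (H (Cmod (a - b) / 2)%R). lra. }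
  apply Cmod_eq_0 in Hz. replace a with (a - b + b) by ring. rewrite Hz. ring.
Qed.

Definition Ccauchy (u : nat -> C) : Prop :=
  forall eps : R, 0 < eps ->
  exists K, forall k, (K <= k)%nat -> Cmod (u k - u K) < eps.

(** [lim] is a total function that means something only on Cauchy filters, hence every value of
    [Clim] has to be reached through this property. *)
Lemma Clim_cauchy (u : nat -> C) : Ccauchy u -> Ccv u (Clim u).
Proof.
  intros H. apply filterlim_Ccv.
  assert (Hc : cauchy (T := C_CompleteNormedModule) (filtermap u eventually)).
  { intros eps. destruct (H eps (cond_pos eps)) as [K HK].
    exists (u K). exists K. intros k Hk. apply Cball_of_mod, HK, Hk. }
  intros P [eps HP].
  assert (Hl := complete_cauchy (T := C_CompleteNormedModule) (filtermap u eventually) _ Hc eps).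
  unfold filtermap in *. revert Hl. apply filter_imp. intros k Hk. apply HP, Hk.
Qed.

Lemma Ccv_cauchy (u : nat -> C) (l : C) : Ccv u l -> Ccauchy u.
Proof.
  intros H eps Heps. destruct (H (eps / 2)%R ltac:(lra)) as [K HK].
  exists K. intros k Hk.
  replace (u k - u K) with ((u k - l) + - (u K - l)) by ring.
  eapply Rle_lt_trans; [apply Cmod_triangle|]. rewrite Cmod_opp.
  pose proof (HK k Hk). pose proof (HK K (le_n _)). lra.
Qed.

Lemma Ccv_unique (u : nat -> C) (l l' : C) : Ccv u l -> Ccv u l' -> l = l'.
Proof.
  intros H H'. apply Cmod_small_eq. intros eps Heps.
  destruct (H (eps / 2)%R ltac:(lra)) as [K HK].
  destruct (H' (eps / 2)%R ltac:(lra)) as [K' HK'].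
  replace (l - l') with ((u (K + K')%nat - l') + - (u (K + K')%nat - l)) by ring.
  eapply Rle_trans; [apply Cmod_triangle|]. rewrite Cmod_opp.
  pose proof (HK (K + K')%nat ltac:(lia)). pose proof (HK' (K + K')%nat ltac:(lia)). lra.
Qed.

Lemma Clim_eq (u : nat -> C) (l : C) : Ccv u l -> Clim u = l.
Proof.
  intros H. apply (Ccv_unique u); [|exact H]. apply Clim_cauchy, (Ccv_cauchy _ _ H).
Qed.

Lemma Ccv_ext (u v : nat -> C) (l : C) : (forall n, u n = v n) -> Ccv u l -> Ccv v l.
Proof.
  intros He H eps Heps. destruct (H eps Heps) as [K HK].
  exists K. intros k Hk. rewrite <- He. auto.
Qed.

Lemma Ccv_scal (c : C) (u : nat -> C) (l : C) : Ccv u l -> Ccv (fun n => c * u n) (c * l).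
Proof.
  intros H eps Heps.
  assert (Hc : 0 < Cmod c + 1) by (pose proof (Cmod_ge_0 c); lra).
  destruct (H (eps / (Cmod c + 1))%R) as [K HK].
  { apply Rdiv_lt_0_compat; lra. }
  exists K. intros k Hk. replace (c * u k - c * l) with (c * (u k - l)) by ring.
  rewrite Cmod_mult. specialize (HK k Hk).
  apply Rle_lt_trans with ((Cmod c + 1) * Cmod (u k - l))%R.
  - pose proof (Cmod_ge_0 (u k - l)). nra.
  - replace eps with ((Cmod c + 1) * (eps / (Cmod c + 1)))%R at 1 by (field; lra).
    apply Rmult_lt_compat_l; auto.
Qed.

Lemma Ccv_shift (u : nat -> C) (l : C) : Ccv u l -> Ccv (fun n => u (S n)) l.
Proof.
  intros H eps Heps. destruct (H eps Heps) as [K HK].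
  exists K. intros k Hk. apply HK. lia.
Qed.

Lemma pow_small (rho K eps : R) : 0 <= rho < 1 -> 0 <= K -> 0 < eps ->
  exists n0, forall n, (n0 <= n)%nat -> (K * rho ^ n < eps)%R.
Proof.
  intros Hr HK Heps.
  destruct (pow_lt_1_zero rho ltac:(rewrite Rabs_pos_eq; lra) (eps / (K + 1))%R) as [n0 Hn0].
  { apply Rdiv_lt_0_compat; lra. }
  exists n0. intros n Hn. specialize (Hn0 n Hn).
  assert (Hp : 0 <= rho ^ n) by (apply pow_le; lra).
  rewrite Rabs_pos_eq in Hn0 by auto.
  apply Rle_lt_trans with ((K + 1) * rho ^ n)%R; [nra|].
  replace eps with ((K + 1) * (eps / (K + 1)))%R by (field; lra).
  apply Rmult_lt_compat_l; lra.
Qed.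

(** * Finite sums and products, integer powers *)

Fixpoint prodn (n : nat) (f : nat -> C) : C :=
  match n with O => 1 | S k => prodn k f * f k end.
Fixpoint sumn (n : nat) (f : nat -> C) : C :=
  match n with O => 0 | S k => sumn k f + f k end.

Lemma cprod_app (l1 l2 : list nat) (f : nat -> C) :
  cprod (l1 ++ l2) f = cprod l1 f * cprod l2 f.
Proof.
  unfold cprod. induction l1 as [|a l1 IH]; simpl; [ring|]. rewrite IH. ring.
Qed.

Lemma csum_app (l1 l2 : list nat) (f : nat -> C) :
  csum (l1 ++ l2) f = csum l1 f + csum l2 f.
Proof.
  unfold csum. induction l1 as [|a l1 IH]; simpl; [ring|]. rewrite IH. ring.
Qed.

Lemma cprod_seq (n : nat) (f : nat -> C) : cprod (seq 0 n) f = prodn n f.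
Proof.
  induction n as [|n IH]; [reflexivity|].
  rewrite seq_S, cprod_app, IH. unfold cprod; simpl. ring.
Qed.

Lemma csum_seq (n : nat) (f : nat -> C) : csum (seq 0 n) f = sumn n f.
Proof.
  induction n as [|n IH]; [reflexivity|].
  rewrite seq_S, csum_app, IH. unfold csum; simpl. ring.
Qed.

Lemma prodn_ext (n : nat) (f g : nat -> C) :
  (forall i, (i < n)%nat -> f i = g i) -> prodn n f = prodn n g.
Proof. induction n as [|n IH]; intros H; simpl; [auto|]. rewrite IH, H; auto. Qed.

Lemma sumn_ext (n : nat) (f g : nat -> C) :
  (forall i, (i < n)%nat -> f i = g i) -> sumn n f = sumn n g.
Proof. induction n as [|n IH]; intros H; simpl; [auto|]. rewrite IH, H; auto. Qed.

Lemma prodn_mult (n : nat) (f g : nat -> C) :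
  prodn n (fun i => f i * g i) = prodn n f * prodn n g.
Proof. induction n as [|n IH]; simpl; [ring|]. rewrite IH. ring. Qed.

Lemma prodn_const (n : nat) (c : C) : prodn n (fun _ => c) = Cpow c n.
Proof. induction n as [|n IH]; simpl; [auto|]. rewrite IH. ring. Qed.

Lemma prodn_head (n : nat) (f : nat -> C) :
  prodn (S n) f = f O * prodn n (fun i => f (S i)).
Proof.
  induction n as [|n IH]; [simpl; ring|].
  change (prodn (S (S n)) f) with (prodn (S n) f * f (S n)). rewrite IH. simpl. ring.
Qed.

Lemma prodn_nz (n : nat) (f : nat -> C) :
  (forall i, (i < n)%nat -> f i <> 0) -> prodn n f <> 0.
Proof.
  induction n as [|n IH]; intros H; simpl.
  - apply C1_nz.
  - apply Cmult_neq_0; auto.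
Qed.

Lemma prodn_inv (n : nat) (f : nat -> C) :
  (forall i, (i < n)%nat -> f i <> 0) -> prodn n (fun i => / f i) = / prodn n f.
Proof.
  induction n as [|n IH]; intros H; simpl.
  - field.
  - rewrite IH by auto. field. split; auto. apply prodn_nz; auto.
Qed.

Lemma sumn_scal (n : nat) (c : C) (f : nat -> C) :
  sumn n (fun i => c * f i) = c * sumn n f.
Proof. induction n as [|n IH]; simpl; [ring|]. rewrite IH. ring. Qed.

Lemma sumn_plus (n : nat) (f g : nat -> C) :
  sumn n (fun i => f i + g i) = sumn n f + sumn n g.
Proof. induction n as [|n IH]; simpl; [ring|]. rewrite IH. ring. Qed.

Lemma sumn_zero (n : nat) (f : nat -> C) :
  (forall i, (i < n)%nat -> f i = 0) -> sumn n f = 0.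
Proof. induction n as [|n IH]; intros H; simpl; [auto|]. rewrite IH, H; auto. ring. Qed.

Lemma sumn_single (n k : nat) (f : nat -> C) : (k < n)%nat ->
  (forall i, (i < n)%nat -> i <> k -> f i = 0) -> sumn n f = f k.
Proof.
  induction n as [|n IH]; intros Hk H; [lia|]. simpl.
  destruct (Nat.eq_dec k n) as [->|Hne].
  - rewrite sumn_zero; [ring|]. intros i Hi. apply H; lia.
  - rewrite IH by (auto with zarith). rewrite (H n) by lia. ring.
Qed.

Lemma sumn_const (n : nat) (c : C) : sumn n (fun _ => c) = INR n * c.
Proof.
  induction n as [|n IH]; [simpl; ring|].
  rewrite S_INR, RtoC_plus. simpl. rewrite IH. ring.
Qed.

Lemma Cpowz_0 (z : C) : Cpowz z 0 = 1.
Proof. reflexivity. Qed.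

Lemma Cpowz_nat (z : C) (n : nat) : Cpowz z (Z.of_nat n) = Cpow z n.
Proof.
  destruct n as [|n]; [reflexivity|]. simpl Z.of_nat. unfold Cpowz.
  rewrite SuccNat2Pos.id_succ. reflexivity.
Qed.

Lemma Cpowz_opp (z : C) (k : Z) : z <> 0 -> Cpowz z (- k) = / Cpowz z k.
Proof.
  intros Hz. destruct k as [|p|p]; simpl; auto.
  - field.
  - field. apply Cpow_nz; auto.
Qed.

Lemma Cpowz_nz (z : C) (k : Z) : z <> 0 -> Cpowz z k <> 0.
Proof.
  intros Hz. destruct k as [|p|p]; simpl.
  - apply C1_nz.
  - apply Cpow_nz; auto.
  - apply nonzero_inv, Cpow_nz; auto.
Qed.

Lemma Cpowz_succ (z : C) (k : Z) : z <> 0 -> Cpowz z (k + 1) = z * Cpowz z k.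
Proof.
  intros Hz. destruct (Z_le_gt_dec 0 k) as [Hk|Hk].
  - rewrite <- (Z2Nat.id k) by auto.
    replace (Z.of_nat (Z.to_nat k) + 1)%Z with (Z.of_nat (S (Z.to_nat k))) by lia.
    rewrite !Cpowz_nat. reflexivity.
  - replace k with (- Z.of_nat (S (Z.to_nat (- k - 1))))%Z by lia.
    replace (- Z.of_nat (S (Z.to_nat (- k - 1))) + 1)%Z
      with (- Z.of_nat (Z.to_nat (- k - 1)))%Z by lia.
    rewrite !Cpowz_opp, !Cpowz_nat by auto. rewrite Cpow_S. field.
    split; auto. apply Cpow_nz; auto.
Qed.

Lemma Cpowz_1 (z : C) : Cpowz z 1 = z.
Proof. apply Cpow_1_r. Qed.

(** The equivalence covers both directions of Z at once; in its uses the backward half amounts to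
    cancelling a nonzero factor. *)
Lemma Zind_succ (P : Z -> Prop) :
  P 0%Z -> (forall k, P k <-> P (k + 1)%Z) -> forall k, P k.
Proof.
  intros H0 H. apply Z.bi_induction; auto. intros x y ->. reflexivity.
Qed.

Lemma Cpowz_add (z : C) (j k : Z) : z <> 0 -> Cpowz z (j + k) = Cpowz z j * Cpowz z k.
Proof.
  intros Hz. revert k. apply Zind_succ.
  - rewrite Z.add_0_r, Cpowz_0. ring.
  - intros k. rewrite Z.add_assoc, !Cpowz_succ by auto. split; intros H.
    + rewrite H. ring.
    + apply (Cmult_eq_reg_l z); [|auto]. rewrite H. ring.
Qed.

Lemma Cpowz_mul_l (a b : C) (k : Z) : a <> 0 -> b <> 0 ->
  Cpowz (a * b) k = Cpowz a k * Cpowz b k.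
Proof.
  intros Ha Hb. assert (a * b <> 0) by (apply Cmult_neq_0; auto).
  revert k. apply Zind_succ.
  - rewrite !Cpowz_0. ring.
  - intros k. rewrite !Cpowz_succ by auto. split; intros H'.
    + rewrite H'. ring.
    + apply (Cmult_eq_reg_l (a * b)); [|auto]. rewrite H'. ring.
Qed.

Lemma Cpowz_1_l (k : Z) : Cpowz 1 k = 1.
Proof.
  revert k. apply Zind_succ; [reflexivity|]. intros k.
  rewrite Cpowz_succ by apply C1_nz. split; intros H.
  - rewrite H. ring.
  - rewrite Cmult_1_l in H. exact H.
Qed.

Lemma Cpowz_inv (a : C) (k : Z) : a <> 0 -> Cpowz (/ a) k = / Cpowz a k.
Proof.
  intros Ha. assert (/ a <> 0) by (apply nonzero_inv; auto).
  assert (Cpowz a k <> 0) by (apply Cpowz_nz; auto).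
  apply (Cmult_eq_reg_l (Cpowz a k)); [|auto]. rewrite <- Cpowz_mul_l by auto.
  rewrite Cinv_r by auto. rewrite Cpowz_1_l. field. auto.
Qed.

Lemma Cpowz_mul_r (a : C) (j k : Z) : a <> 0 -> Cpowz a (j * k) = Cpowz (Cpowz a j) k.
Proof.
  intros Ha. assert (Cpowz a j <> 0) by (apply Cpowz_nz; auto).
  revert k. apply Zind_succ.
  - rewrite Z.mul_0_r. reflexivity.
  - intros k. rewrite Z.mul_add_distr_l, Z.mul_1_r, Cpowz_add, Cpowz_succ by auto. split; intros H'.
    + rewrite H'. ring.
    + apply (Cmult_eq_reg_l (Cpowz a j)); [|auto]. rewrite <- H'. ring.
Qed.

Lemma Cmod_powz_1 (z : C) (k : Z) : Cmod z = 1%R -> Cmod (Cpowz z k) = 1%R.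
Proof.
  intros Hz.
  assert (Hn : z <> 0) by (intros ->; rewrite Cmod_0 in Hz; lra).
  destruct k as [|p|p]; simpl.
  - apply Cmod_1.
  - rewrite Cmod_pow, Hz, pow1. auto.
  - rewrite Cmod_inv, Cmod_pow, Hz, pow1 by (apply Cpow_nz; auto). lra.
Qed.

(** * Infinite q-Pochhammer symbols and the theta function *)

Fixpoint poch (n : nat) (a q : C) : C :=
  match n with O => 1 | S k => poch k a q * (1 - a * Cpow q k) end.

Lemma poch_cprod (n : nat) (a q : C) :
  cprod (seq 0 n) (fun k => 1 - a * Cpow q k) = poch n a q.
Proof.
  rewrite cprod_seq. induction n as [|n IH]; simpl; [auto|]. rewrite IH. auto.
Qed.

Lemma poch_head (n : nat) (a q : C) : poch (S n) a q = (1 - a) * poch n (a * q) q.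
Proof.
  induction n as [|n IH]; [simpl; ring|].
  change (poch (S (S n)) a q) with (poch (S n) a q * (1 - a * Cpow q (S n))).
  rewrite IH. simpl. ring.
Qed.

(** Bounds every partial product with [|a| <= Rd], by [1 + s <= exp s] and the geometric series in
    [rho = |q|]. *)
Definition pbound (Rd rho : R) : R := exp (Rd / (1 - rho)).

Section PochBound.
Variables (a q : C) (Rd : R).
Hypotheses (Ha : Cmod a <= Rd) (Hq : Cmod q < 1).
Let rho := Cmod q.

Lemma rho_ge_0 : 0 <= rho.
Proof. apply Cmod_ge_0. Qed.

Lemma Rd_ge_0 : 0 <= Rd.
Proof. pose proof (Cmod_ge_0 a). lra. Qed.

Lemma Cmod_poch_exp (n : nat) :
  Cmod (poch n a q) <= exp (Rd * (1 - rho ^ n) / (1 - rho)).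
Proof.
  pose proof rho_ge_0. pose proof Rd_ge_0. assert (rho < 1) by exact Hq.
  induction n as [|n IH].
  - simpl. rewrite Cmod_1. replace (Rd * (1 - 1) / (1 - rho))%R with 0%R by (field; lra).
    rewrite exp_0. lra.
  - simpl poch. rewrite Cmod_mult.
    replace (Rd * (1 - rho ^ S n) / (1 - rho))%R
      with (Rd * (1 - rho ^ n) / (1 - rho) + Rd * rho ^ n)%R by (simpl; field; lra).
    rewrite exp_plus. apply Rmult_le_compat; auto using Cmod_ge_0.
    eapply Rle_trans; [|apply exp_ineq1_le].
    eapply Rle_trans; [apply Cmod_triangle|].
    rewrite Cmod_1, Cmod_opp, Cmod_mult, Cmod_pow. fold rho.
    assert (0 <= rho ^ n) by (apply pow_le; auto). nra.
Qed.

Lemma Cmod_poch (n : nat) : Cmod (poch n a q) <= pbound Rd rho.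
Proof.
  pose proof rho_ge_0. pose proof Rd_ge_0. assert (rho < 1) by exact Hq.
  eapply Rle_trans; [apply Cmod_poch_exp|]. unfold pbound.
  assert (Hp : 0 <= rho ^ n) by (apply pow_le; auto).
  destruct (Req_dec (Rd * (1 - rho ^ n) / (1 - rho)) (Rd / (1 - rho))) as [->|Hne]; [lra|].
  left. apply exp_increasing.
  assert (Hle : (Rd * (1 - rho ^ n) / (1 - rho) <= Rd / (1 - rho))%R).
  { apply Rmult_le_compat_r; [left; apply Rinv_0_lt_compat; lra|]. nra. }
  lra.
Qed.

(** The step from [n + j] to [n + j + 1] factors changes the product by at most
    [pbound Rd rho * Rd * rho^(n+j)]; these bounds are summed. *)
Lemma Cmod_poch_diff (n k : nat) :
  Cmod (poch (n + k) a q - poch n a q) <= pbound Rd rho * Rd * rho ^ n * (1 - rho ^ k) / (1 - rho).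
Proof.
  pose proof rho_ge_0. pose proof Rd_ge_0. assert (rho < 1) by exact Hq.
  induction k as [|k IH].
  - rewrite Nat.add_0_r. replace (poch n a q - poch n a q) with (RtoC 0) by ring.
    rewrite Cmod_0. right. simpl. field. lra.
  - rewrite Nat.add_succ_r. simpl poch.
    replace (poch (n + k) a q * (1 - a * q ^ (n + k)) - poch n a q)
      with ((poch (n + k) a q - poch n a q) + - (poch (n + k) a q * (a * q ^ (n + k)))) by ring.
    eapply Rle_trans; [apply Cmod_triangle|]. rewrite Cmod_opp, !Cmod_mult, Cmod_pow. fold rho.
    replace (pbound Rd rho * Rd * rho ^ n * (1 - rho ^ S k) / (1 - rho))%R
      with (pbound Rd rho * Rd * rho ^ n * (1 - rho ^ k) / (1 - rho) + pbound Rd rho * (Rd * rho ^ (n + k)))%R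
      by (rewrite pow_add; simpl; field; lra).
    apply Rplus_le_compat; auto.
    assert (0 <= rho ^ (n + k)) by (apply pow_le; auto).
    apply Rmult_le_compat; auto using Cmod_ge_0, Cmod_poch.
    + apply Rmult_le_pos; auto using Cmod_ge_0.
    + apply Rmult_le_compat_r; auto.
Qed.

Lemma Cmod_poch_tail (n k : nat) : (n <= k)%nat ->
  Cmod (poch k a q - poch n a q) <= pbound Rd rho * Rd / (1 - rho) * rho ^ n.
Proof.
  pose proof rho_ge_0. pose proof Rd_ge_0. assert (rho < 1) by exact Hq.
  intros Hk. replace k with (n + (k - n))%nat by lia.
  eapply Rle_trans; [apply Cmod_poch_diff|].
  assert (0 <= rho ^ (k - n)) by (apply pow_le; auto).
  assert (0 <= rho ^ n) by (apply pow_le; auto).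
  assert (0 < pbound Rd rho) by apply exp_pos.
  assert (0 < / (1 - rho)) by (apply Rinv_0_lt_compat; lra).
  unfold Rdiv.
  replace (pbound Rd rho * Rd * / (1 - rho) * rho ^ n)%R
    with (pbound Rd rho * Rd * rho ^ n * 1 * / (1 - rho))%R by ring.
  apply Rmult_le_compat_r; [lra|]. apply Rmult_le_compat_l; [|lra].
  repeat apply Rmult_le_pos; lra.
Qed.

Lemma poch_cv : Ccv (fun n => poch n a q) (qpoch a q).
Proof.
  pose proof rho_ge_0. pose proof Rd_ge_0. assert (rho < 1) by exact Hq.
  assert (He : qpoch a q = Clim (fun n => poch n a q)).
  { unfold qpoch. f_equal. apply functional_extensionality. intros n. apply poch_cprod. }
  rewrite He. apply Clim_cauchy. intros eps Heps.
  destruct (pow_small rho (pbound Rd rho * Rd / (1 - rho)) eps) as [n0 Hn0]; auto.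
  { assert (0 < pbound Rd rho) by apply exp_pos.
    apply Rmult_le_pos; [nra|]. left. apply Rinv_0_lt_compat; lra. }
  exists n0. intros k Hk. eapply Rle_lt_trans; [apply Cmod_poch_tail; auto|]. apply Hn0; auto.
Qed.

Lemma Cmod_le_lim (u : nat -> C) (l c : C) (M : R) (n : nat) :
  Ccv u l -> (forall k, (n <= k)%nat -> Cmod (u k - c) <= M) -> Cmod (l - c) <= M.
Proof.
  intros Hu HM. apply Rnot_lt_le. intros Hlt.
  destruct (Hu (Cmod (l - c) - M)%R ltac:(lra)) as [K HK].
  specialize (HK (n + K)%nat ltac:(lia)). specialize (HM (n + K)%nat ltac:(lia)).
  assert (Ht : Cmod (l - c) <= Cmod (u (n + K)%nat - c) + Cmod (u (n + K)%nat - l)).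
  { replace (l - c) with ((u (n + K)%nat - c) + - (u (n + K)%nat - l)) by ring.
    eapply Rle_trans; [apply Cmod_triangle|]. rewrite Cmod_opp. lra. }
  lra.
Qed.

(** The bound sees [a] only through [Rd]. This uniformity lets [qpoch (p u) q] be approximated by
    Laurent polynomials on a whole annulus. *)
Lemma Cmod_qpoch_tail (n : nat) :
  Cmod (qpoch a q - poch n a q) <= pbound Rd rho * Rd / (1 - rho) * rho ^ n.
Proof.
  apply (Cmod_le_lim _ _ _ _ n poch_cv). intros k Hk. apply Cmod_poch_tail; auto.
Qed.

End PochBound.

Lemma qpoch_cv (a q : C) : Cmod q < 1 -> Ccv (fun n => poch n a q) (qpoch a q).
Proof. intros Hq. apply (poch_cv a q (Cmod a)); auto. lra. Qed.

Lemma qpoch_step (a q : C) : Cmod q < 1 -> qpoch a q = (1 - a) * qpoch (a * q) q.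
Proof.
  intros Hq. apply (Ccv_unique (fun n => poch (S n) a q)).
  - apply (Ccv_shift (fun n => poch n a q)), qpoch_cv; auto.
  - apply (Ccv_ext (fun n => (1 - a) * poch n (a * q) q)).
    + intros n. symmetry. apply poch_head.
    + apply Ccv_scal, qpoch_cv; auto.
Qed.

Definition theta (q z : C) : C := qpoch z q * qpoch (q * / z) q.

Lemma theta_inv (q z : C) : Cmod q < 1 -> z <> 0 -> theta q (/ z) = - / z * theta q z.
Proof.
  intros Hq Hz. unfold theta. rewrite (qpoch_step (/ z)), (qpoch_step z) by auto.
  replace (/ / z) with z by (field; auto; apply C1_nz).
  replace (/ z * q) with (q * / z) by ring. replace (z * q) with (q * z) by ring.
  field. auto.
Qed.

Lemma theta_q_inv (q z : C) : q <> 0 -> z <> 0 -> theta q (q * / z) = theta q z.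
Proof.
  intros Hq Hz. unfold theta. replace (q * / (q * / z)) with z by (field; auto). ring.
Qed.

Lemma theta_shift (q z : C) : Cmod q < 1 -> q <> 0 -> z <> 0 ->
  theta q (q * z) = - / z * theta q z.
Proof.
  intros Hq Hq0 Hz. unfold theta.
  replace (q * / (q * z)) with (/ z) by (field; auto).
  rewrite (qpoch_step (/ z)), (qpoch_step z) by auto.
  replace (/ z * q) with (q * / z) by ring. replace (z * q) with (q * z) by ring.
  field. auto.
Qed.

(** * The iterated torus integral *)

Definition scons (z : C) (u : nat -> C) (i : nat) : C :=
  match i with O => z | S k => u k end.

Definition on_torus (u : nat -> C) : Prop := forall i, Cmod (u i) = 1%R.

Definition is_circ (f : R -> C) (c : C) : Prop :=
  is_RInt (V := C_R_CompleteNormedModule) f 0 (2 * PI)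
    (scal (V := C_R_CompleteNormedModule) (2 * PI)%R c).

(** A relation instead of the function [torus_int], because [RInt] has a value even for functions
    that are not integrable; here integrability is asserted at every level. The variables that are
    not integrated are set to 1. *)
Fixpoint is_tint (n : nat) (g : (nat -> C) -> C) (c : C) : Prop :=
  match n with
  | O => g (fun _ => 1) = c
  | S k => exists F : R -> C,
      (forall th, is_tint k (fun u => g (scons (Cexpi th) u)) (F th)) /\ is_circ F c
  end.

Lemma scalR (a : R) (z : C) : scal (V := C_R_CompleteNormedModule) a z = RtoC a * z.
Proof.
  destruct z as [x y]. unfold scal; simpl. unfold prod_scal, Cmult, RtoC; simpl.
  unfold scal; simpl. unfold mult; simpl. f_equal; ring.
Qed.

Lemma normC (z : C) : norm (V := C_R_CompleteNormedModule) z = Cmod z.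
Proof. symmetry. apply Cmod_norm. Qed.

Lemma twoPI_pos : 0 < 2 * PI.
Proof. pose proof PI_RGT_0. lra. Qed.

Lemma twoPI_nz : RtoC (2 * PI) <> 0.
Proof. intros H. apply RtoC_inj in H. pose proof twoPI_pos. lra. Qed.

Lemma is_circ_pair (f : R -> C) (c : C) :
  is_circ f c <->
  is_RInt (fun t => fst (f t)) 0 (2 * PI) (2 * PI * fst c)%R /\
  is_RInt (fun t => snd (f t)) 0 (2 * PI) (2 * PI * snd c)%R.
Proof.
  unfold is_circ. split.
  - intros H. split.
    + apply (is_RInt_fct_extend_fst (U := R_NormedModule) (V := R_NormedModule)) in H. exact H.
    + apply (is_RInt_fct_extend_snd (U := R_NormedModule) (V := R_NormedModule)) in H. exact H.
  - intros [H1 H2].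
    exact (is_RInt_fct_extend_pair (U := R_NormedModule) (V := R_NormedModule) f 0 (2 * PI) _ _ H1 H2).
Qed.

Lemma is_circ_plus (f g : R -> C) (a b : C) :
  is_circ f a -> is_circ g b -> is_circ (fun t => f t + g t) (a + b).
Proof.
  intros Ha Hb. unfold is_circ.
  replace (scal (V := C_R_CompleteNormedModule) (2 * PI)%R (a + b))
    with (plus (G := C_R_CompleteNormedModule) (scal (V := C_R_CompleteNormedModule) (2 * PI)%R a) (scal
        (V := C_R_CompleteNormedModule) (2 * PI)%R b)).
  - apply (is_RInt_plus (V := C_R_CompleteNormedModule)); auto.
  - rewrite !scalR. change (RtoC (2 * PI) * a + RtoC (2 * PI) * b = RtoC (2 * PI) * (a + b)). ring.
Qed.

(** The integral takes values in a real module, so linearity over complex scalars is checked on real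
    and imaginary parts. *)
Lemma is_circ_scal (k : C) (f : R -> C) (a : C) :
  is_circ f a -> is_circ (fun t => k * f t) (k * a).
Proof.
  rewrite !is_circ_pair. intros [H1 H2]. destruct k as [x y]. simpl. split.
  - replace (2 * PI * (x * fst a - y * snd a))%R
      with (minus (G := R_NormedModule) (scal (V := R_NormedModule) x (2 * PI * fst a)%R)
              (scal (V := R_NormedModule) y (2 * PI * snd a)%R))
      by (unfold minus, scal, plus, opp; simpl; unfold mult; simpl; ring).
    apply (is_RInt_minus (V := R_NormedModule)); apply (is_RInt_scal (V := R_NormedModule)); auto.
  - replace (2 * PI * (x * snd a + y * fst a))%R
      with (plus (G := R_NormedModule) (scal (V := R_NormedModule) x (2 * PI * snd a)%R)
              (scal (V := R_NormedModule) y (2 * PI * fst a)%R))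
      by (unfold scal, plus; simpl; unfold mult; simpl; ring).
    apply (is_RInt_plus (V := R_NormedModule)); apply (is_RInt_scal (V := R_NormedModule)); auto.
Qed.

Lemma is_circ_ext (f g : R -> C) (a : C) :
  (forall t, f t = g t) -> is_circ f a -> is_circ g a.
Proof. intros H. apply is_RInt_ext. intros; apply H. Qed.

Lemma is_circ_const (k : C) : is_circ (fun _ => k) k.
Proof.
  unfold is_circ. replace (2 * PI)%R with (2 * PI - 0)%R at 2 by ring.
  apply (is_RInt_const (V := C_R_CompleteNormedModule)).
Qed.

Lemma is_circ_bound (f : R -> C) (a : C) (M : R) :
  is_circ f a -> (forall t, Cmod (f t) <= M) -> Cmod a <= M.
Proof.
  intros H HM. pose proof twoPI_pos as Hp.
  assert (Hn := norm_RInt_le_const (V := C_R_CompleteNormedModule) f 0 (2 * PI) _ M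
    ltac:(lra) ltac:(intros; rewrite normC; apply HM) H).
  rewrite normC, scalR, Cmod_mult, Cmod_R, Rabs_pos_eq in Hn by lra.
  apply Rmult_le_reg_l with (2 * PI)%R; lra.
Qed.

Lemma twoPI_cancel (z : C) : / RtoC (2 * PI) * (RtoC (2 * PI) * z) = z.
Proof. field. apply twoPI_nz. Qed.

Lemma is_circ_lim (f : nat -> R -> C) (a : nat -> C) (g : R -> C) :
  (forall k, is_circ (f k) (a k)) ->
  (forall eps, 0 < eps -> exists K, forall k t, (K <= k)%nat -> Cmod (f k t - g t) <= eps) ->
  exists c, is_circ g c /\ Ccv a c.
Proof.
  intros Hf Hu.
  destruct (filterlim_RInt (V := C_R_CompleteNormedModule) f 0 (2 * PI) eventually
    _ g (fun k => scal (V := C_R_CompleteNormedModule) (2 * PI)%R (a k))) as [If [H1 H2]].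
  - intros k. apply Hf.
  - intros P [eps HP]. destruct (Hu (eps / 2)%R) as [K HK]; [destruct eps; simpl; lra|].
    exists K. intros k Hk. apply HP. intros t. apply Cball_of_mod.
    specialize (HK k t Hk). destruct eps; simpl in *; lra.
  - exists (/ RtoC (2 * PI) * If). split.
    + unfold is_circ. rewrite scalR.
      replace (RtoC (2 * PI) * (/ RtoC (2 * PI) * If)) with If; [exact H2|].
      rewrite Cmult_assoc, Cinv_r, Cmult_1_l by apply twoPI_nz. reflexivity.
    + apply filterlim_Ccv in H1.
      apply (Ccv_scal (/ RtoC (2 * PI))) in H1. revert H1. apply Ccv_ext.
      intros k. rewrite scalR. apply twoPI_cancel.
Qed.

Lemma Cexpi_powz (t : R) (k : Z) : Cpowz (Cexpi t) k = Cexpi (IZR k * t).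
Proof.
  assert (Hadd : forall a b, Cexpi (a + b) = Cexpi a * Cexpi b).
  { intros a b. unfold Cexpi, Cmult. simpl. rewrite cos_plus, sin_plus. f_equal; ring. }
  assert (Hnz : forall a, Cexpi a <> 0).
  { intros a H. apply C1_nz. transitivity (Cexpi (a + - a)).
    - rewrite Rplus_opp_r. unfold Cexpi. rewrite cos_0, sin_0. reflexivity.
    - rewrite Hadd, H. ring. }
  revert k. apply Zind_succ.
  - rewrite Cpowz_0, Rmult_0_l. unfold Cexpi. rewrite cos_0, sin_0. reflexivity.
  - intros k. rewrite Cpowz_succ, plus_IZR, Rmult_plus_distr_r, Rmult_1_l, Hadd by auto.
    split; intros H.
    + rewrite H. ring.
    + apply (Cmult_eq_reg_l (Cexpi t)); auto. rewrite H. ring.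
Qed.

Lemma Cmod_expi (t : R) : Cmod (Cexpi t) = 1%R.
Proof.
  unfold Cexpi, Cmod. simpl. rewrite !Rmult_1_r.
  replace (cos t * cos t + sin t * sin t)%R with 1%R; [apply sqrt_1|].
  pose proof (sin2_cos2 t). unfold Rsqr in *. lra.
Qed.

Lemma Cmod1_nz (z : C) : Cmod z = 1%R -> z <> 0.
Proof. intros H ->. rewrite Cmod_0 in H. lra. Qed.

Lemma is_circ_powz (k : Z) :
  is_circ (fun t => Cpowz (Cexpi t) k) (if Z.eqb k 0 then 1 else 0).
Proof.
  destruct (Z.eqb_spec k 0) as [->|Hk].
  - apply (is_circ_ext (fun _ => 1)); [reflexivity | apply is_circ_const].
  - apply (is_circ_ext (fun t => Cexpi (IZR k * t))).
    { intros t. symmetry. apply Cexpi_powz. }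
    assert (Hz : IZR k <> 0%R) by (apply not_0_IZR; auto).
    assert (Hs : sin (IZR k * (2 * PI)) = 0%R).
    { apply sin_eq_0_1. exists (2 * k)%Z. rewrite mult_IZR. ring. }
    assert (Hc : cos (IZR k * (2 * PI)) = 1%R).
    { replace (IZR k * (2 * PI))%R with (2 * (IZR k * PI))%R by ring.
      rewrite cos_2a_sin.
      replace (sin (IZR k * PI)) with 0%R by (symmetry; apply sin_eq_0_1; exists k; ring). ring. }
    apply is_circ_pair. simpl. split.
    + replace (2 * PI * 0)%R
        with (minus (G := R_NormedModule) (sin (IZR k * (2 * PI)) / IZR k)%R (sin (IZR k * 0) / IZR k)%R).
      * apply (is_RInt_derive (V := R_CompleteNormedModule) (fun t => sin (IZR k * t) / IZR k)%R).
        -- intros t _. auto_derive; auto. field. auto.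
        -- intros t _. apply continuous_comp with (f := fun t => (IZR k * t)%R).
           ++ apply (continuous_scal_r (V := R_NormedModule)). apply continuous_id.
           ++ apply continuous_cos.
      * rewrite Hs, Rmult_0_r, sin_0. unfold minus, plus, opp; simpl. field. auto.
    + replace (2 * PI * 0)%R
        with (minus (G := R_NormedModule) (- cos (IZR k * (2 * PI)) / IZR k)%R (- cos (IZR k * 0) / IZR k)%R).
      * apply (is_RInt_derive (V := R_CompleteNormedModule) (fun t => - cos (IZR k * t) / IZR k)%R).
        -- intros t _. auto_derive; auto. field. auto.
        -- intros t _. apply continuous_comp with (f := fun t => (IZR k * t)%R).
           ++ apply (continuous_scal_r (V := R_NormedModule)). apply continuous_id.
           ++ apply continuous_sin.
      * rewrite Hc, Rmult_0_r, cos_0. unfold minus, plus, opp; simpl. field. auto.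
Qed.

Lemma on_torus_scons (t : R) (u : nat -> C) : on_torus u -> on_torus (scons (Cexpi t) u).
Proof. intros H [|i]; simpl; [apply Cmod_expi | apply H]. Qed.

Lemma tint_ext (n : nat) : forall (g h : (nat -> C) -> C) (c : C),
  (forall u, on_torus u -> g u = h u) -> is_tint n g c -> is_tint n h c.
Proof.
  induction n as [|n IH]; intros g h c He; simpl.
  - intros <-. symmetry. apply He. intros i. apply Cmod_1.
  - intros [F [HF Hc]]. exists F. split; auto.
    intros th. apply (IH (fun u => g (scons (Cexpi th) u))); auto.
    intros u Hu. apply He, on_torus_scons, Hu.
Qed.

Lemma tint_plus (n : nat) : forall (g h : (nat -> C) -> C) (c d : C),
  is_tint n g c -> is_tint n h d -> is_tint n (fun u => g u + h u) (c + d).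
Proof.
  induction n as [|n IH]; intros g h c d; simpl.
  - intros <- <-. reflexivity.
  - intros [F [HF Hc]] [G [HG Hd]]. exists (fun t => F t + G t). split.
    + intros th. apply (IH (fun u => g (scons (Cexpi th) u)) (fun u => h (scons (Cexpi th) u))); auto.
    + apply is_circ_plus; auto.
Qed.

Lemma tint_scal (n : nat) (k : C) : forall (g : (nat -> C) -> C) (c : C),
  is_tint n g c -> is_tint n (fun u => k * g u) (k * c).
Proof.
  induction n as [|n IH]; intros g c; simpl.
  - intros <-. reflexivity.
  - intros [F [HF Hc]]. exists (fun t => k * F t). split.
    + intros th. apply (IH (fun u => g (scons (Cexpi th) u))); auto.
    + apply is_circ_scal; auto.
Qed.

Lemma tint_bound (n : nat) : forall (g : (nat -> C) -> C) (c : C) (M : R),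
  is_tint n g c -> (forall u, on_torus u -> Cmod (g u) <= M) -> Cmod c <= M.
Proof.
  induction n as [|n IH]; intros g c M; simpl.
  - intros <- H. apply H. intros i. apply Cmod_1.
  - intros [F [HF Hc]] H. apply (is_circ_bound F); auto.
    intros t. apply (IH _ _ _ (HF t)). intros u Hu. apply H, on_torus_scons, Hu.
Qed.

Lemma tint_diff_bound (n : nat) (g h : (nat -> C) -> C) (c d : C) (M : R) :
  is_tint n g c -> is_tint n h d ->
  (forall u, on_torus u -> Cmod (g u - h u) <= M) -> Cmod (c - d) <= M.
Proof.
  intros Hg Hh HM. replace (c - d) with (c + (- 1) * d) by ring.
  apply (tint_bound n (fun u => g u + (- 1) * h u)).
  - apply tint_plus; auto. apply tint_scal; auto.
  - intros u Hu. replace (g u + - 1 * h u) with (g u - h u) by ring. auto.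
Qed.

(** By [tint_diff_bound] the inner integrals converge uniformly in the outer angle, so the
    one-dimensional theorem on uniform limits applies at each level. It also supplies the
    integrability of the limit. *)
Lemma tint_lim (n : nat) : forall (g : nat -> (nat -> C) -> C) (c : nat -> C) (h : (nat -> C) -> C),
  (forall k, is_tint n (g k) (c k)) ->
  (forall eps, 0 < eps -> exists K, forall k u, (K <= k)%nat -> on_torus u ->
     Cmod (g k u - h u) <= eps) ->
  exists d, is_tint n h d /\ Ccv c d.
Proof.
  induction n as [|n IH]; intros g c h Hg Hu.
  - exists (h (fun _ => 1)). split; [reflexivity|].
    intros eps Heps. destruct (Hu (eps / 2)%R ltac:(lra)) as [K HK].
    exists K. intros k Hk. rewrite <- (Hg k).
    apply Rle_lt_trans with (eps / 2)%R; [|lra]. apply HK; auto. intros i. apply Cmod_1.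
  - assert (HF : forall k, exists F, (forall th, is_tint n (fun u => g k (scons (Cexpi th) u)) (F th))
      /\ is_circ F (c k)) by (intros k; apply (Hg k)).
    (* Each approximant only comes with the existence of its inner integral; choice collects these
       into a sequence of functions of the outer angle. *)
    pose (F := fun k => proj1_sig (constructive_indefinite_description _ (HF k))).
    assert (HF' : forall k, (forall th, is_tint n (fun u => g k (scons (Cexpi th) u)) (F k th))
      /\ is_circ (F k) (c k)).
    { intros k. unfold F. apply (proj2_sig (constructive_indefinite_description _ (HF k))). }
    clearbody F. clear HF.
    assert (HG : forall th, exists d, is_tint n (fun u => h (scons (Cexpi th) u)) d).
    { intros th. destruct (IH (fun k u => g k (scons (Cexpi th) u)) (fun k => F k th)
        (fun u => h (scons (Cexpi th) u))) as [d [Hd _]].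
      - intros k. apply HF'.
      - intros eps Heps. destruct (Hu eps Heps) as [K HK]. exists K.
        intros k u Hk Hu'. apply HK; auto. apply on_torus_scons; auto.
      - exists d; auto. }
    pose (G := fun th => proj1_sig (constructive_indefinite_description _ (HG th))).
    assert (HG' : forall th, is_tint n (fun u => h (scons (Cexpi th) u)) (G th)).
    { intros th. apply (proj2_sig (constructive_indefinite_description _ (HG th))). }
    clearbody G.
    destruct (is_circ_lim F c G) as [d [Hd1 Hd2]].
    + intros k. apply HF'.
    + intros eps Heps. destruct (Hu eps Heps) as [K HK]. exists K. intros k t Hk.
      apply (tint_diff_bound n (fun u => g k (scons (Cexpi t) u)) (fun u => h (scons (Cexpi t) u))); auto.
      * apply HF'.
      * intros u Hu'. apply HK; auto. apply on_torus_scons; auto.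
    + exists d. split; auto. exists G. split; auto.
Qed.

(** The default 1 agrees with the base case of [is_tint]. *)
Definition list_point (l : list C) (i : nat) : C := nth i l 1.

Definition CT (n : nat) (g : (nat -> C) -> C) : C := torus_int n (fun l => g (list_point l)).

Lemma CT_eq (n : nat) : forall (g : (nat -> C) -> C) (c : C), is_tint n g c -> CT n g = c.
Proof.
  unfold CT. induction n as [|n IH]; intros g c; simpl.
  - intros <-. f_equal. apply functional_extensionality. intros [|i]; reflexivity.
  - intros [F [HF Hc]].
    rewrite (RInt_ext (V := C_R_CompleteNormedModule) _ F).
    + unfold is_circ in Hc. apply is_RInt_unique in Hc. rewrite Hc.
      change (scal (V := C_R_CompleteNormedModule) (/ (2 * PI))%R
        (scal (V := C_R_CompleteNormedModule) (2 * PI)%R c) = c).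
      rewrite !scalR, RtoC_inv by (pose proof twoPI_pos; lra).
      apply twoPI_cancel.
    + intros t _. rewrite <- (IH _ _ (HF t)). f_equal.
Qed.

(** * Uniform limits of Laurent polynomials *)

Fixpoint mono (n : nat) (lam : nat -> Z) (u : nat -> C) : C :=
  match n with
  | O => 1
  | S k => Cpowz (u O) (lam O) * mono k (fun i => lam (S i)) (fun i => u (S i))
  end.

(** The constant term of [mono n lam], a product of Kronecker deltas. *)
Fixpoint mct (n : nat) (lam : nat -> Z) : C :=
  match n with
  | O => 1
  | S k => (if Z.eqb (lam O) 0 then 1 else 0) * mct k (fun i => lam (S i))
  end.

Definition nonzero_point (u : nat -> C) : Prop := forall i, u i <> 0.

Definition in_annulus (Rd : R) (u : nat -> C) : Prop :=
  forall i, / Rd <= Cmod (u i) /\ Cmod (u i) <= Rd.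

(** Induction on this predicate reduces a linear statement to monomials. Closure under equality at
    nonzero points absorbs identities that need division. *)
Inductive laurent (n : nat) : ((nat -> C) -> C) -> Prop :=
| laurent_mono (lam : nat -> Z) : laurent n (mono n lam)
| laurent_plus (f g : (nat -> C) -> C) : laurent n f -> laurent n g -> laurent n (fun u => f u + g u)
| laurent_scal (k : C) (f : (nat -> C) -> C) : laurent n f -> laurent n (fun u => k * f u)
| laurent_ext (f g : (nat -> C) -> C) : laurent n f -> (forall u, nonzero_point u -> f u = g u) ->
    laurent n g.

(** Stands for holomorphic functions of nonzero variables. All radii are required, since
    substitutions such as [u -> q u] carry the torus into other annuli. *)
Definition unif_laurent (n : nat) (g : (nat -> C) -> C) : Prop :=
  forall Rd eps, 1 <= Rd -> 0 < eps ->
  exists p, laurent n p /\ forall u, in_annulus Rd u -> Cmod (g u - p u) <= eps.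

Lemma nonzero_point_torus (u : nat -> C) : on_torus u -> nonzero_point u.
Proof. intros H i. apply Cmod1_nz, H. Qed.

Lemma in_annulus_torus (Rd : R) (u : nat -> C) : 1 <= Rd -> on_torus u -> in_annulus Rd u.
Proof.
  intros HR H i. rewrite (H i). split; auto.
  rewrite <- Rinv_1. apply Rinv_le_contravar; lra.
Qed.

Lemma in_annulus_nonzero_point (Rd : R) (u : nat -> C) : 1 <= Rd -> in_annulus Rd u -> nonzero_point u.
Proof.
  intros HR H i Hz. destruct (H i) as [H1 _]. rewrite Hz, Cmod_0 in H1.
  assert (0 < / Rd) by (apply Rinv_0_lt_compat; lra). lra.
Qed.

Lemma in_annulus_mono (R1 R2 : R) (u : nat -> C) : 1 <= R1 -> R1 <= R2 -> in_annulus R1 u -> in_annulus R2 u.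
Proof.
  intros H1 H2 H i. destruct (H i) as [Ha Hb]. split; [|lra].
  eapply Rle_trans; [|exact Ha]. apply Rinv_le_contravar; lra.
Qed.

Lemma mono_ext (n : nat) : forall (lam mu : nat -> Z) (u v : nat -> C),
  (forall i, (i < n)%nat -> lam i = mu i) -> (forall i, (i < n)%nat -> u i = v i) ->
  mono n lam u = mono n mu v.
Proof.
  induction n as [|n IH]; intros lam mu u v Hl Hu; simpl; auto.
  rewrite Hl, Hu by lia. f_equal. apply IH; intros; [apply Hl | apply Hu]; lia.
Qed.

Lemma mono_add (n : nat) : forall (lam mu : nat -> Z) (u : nat -> C), nonzero_point u ->
  mono n (fun i => (lam i + mu i)%Z) u = mono n lam u * mono n mu u.
Proof.
  induction n as [|n IH]; intros lam mu u Hu; simpl; [ring|].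
  rewrite Cpowz_add by apply Hu.
  rewrite (IH (fun i => lam (S i)) (fun i => mu (S i)) (fun i => u (S i))) by (intros i; apply Hu).
  ring.
Qed.

Lemma mono_prodn (n : nat) : forall (lam : nat -> Z) (u : nat -> C),
  mono n lam u = prodn n (fun i => Cpowz (u i) (lam i)).
Proof.
  induction n as [|n IH]; intros lam u; [reflexivity|].
  rewrite prodn_head. simpl. rewrite IH. reflexivity.
Qed.

Lemma mono_single (n i : nat) (k : Z) (u : nat -> C) : (i < n)%nat ->
  mono n (fun j => if Nat.eqb j i then k else 0%Z) u = Cpowz (u i) k.
Proof.
  rewrite mono_prodn. induction n as [|n IH]; intros Hi; [lia|]. simpl.
  destruct (Nat.eqb_spec n i) as [->|Hne].
  - rewrite (prodn_ext i _ (fun _ => 1)).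
    + rewrite prodn_const, Cpow_1_l. ring.
    + intros j Hj. destruct (Nat.eqb_spec j i); [lia|]. reflexivity.
  - rewrite IH by lia. rewrite Cpowz_0. ring.
Qed.

Lemma tint_mono (n : nat) : forall lam, is_tint n (mono n lam) (mct n lam).
Proof.
  induction n as [|n IH]; intros lam; simpl; [reflexivity|].
  exists (fun th => mct n (fun i => lam (S i)) * Cpowz (Cexpi th) (lam O)). split.
  - intros th. apply (tint_ext n (fun u => Cpowz (Cexpi th) (lam O) * mono n (fun i => lam (S i)) u)).
    + intros u _. reflexivity.
    + rewrite Cmult_comm. apply tint_scal, IH.
  - rewrite (Cmult_comm _ (mct n _)). apply is_circ_scal, is_circ_powz.
Qed.

Lemma Cpowz_bound (Rd : R) (z : C) (k : Z) : 1 <= Rd -> / Rd <= Cmod z -> Cmod z <= Rd ->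
  Cmod (Cpowz z k) <= Rd ^ Z.abs_nat k.
Proof.
  intros HR H1 H2.
  assert (Hi : 0 < / Rd) by (apply Rinv_0_lt_compat; lra).
  assert (Hz : z <> 0) by (apply Cmod_gt_0; lra).
  destruct k as [|p|p]; simpl.
  - rewrite Cmod_1. lra.
  - rewrite Cmod_pow. apply pow_incr. split; auto using Cmod_ge_0.
  - rewrite Cmod_inv, Cmod_pow by (apply Cpow_nz; auto). rewrite <- pow_inv.
    apply pow_incr. split.
    + left. apply Rinv_0_lt_compat. lra.
    + rewrite <- (Rinv_inv Rd). apply Rinv_le_contravar; auto.
Qed.

Lemma mono_bound (n : nat) (Rd : R) (HR : 1 <= Rd) : forall lam,
  exists B, 0 <= B /\ forall u, in_annulus Rd u -> Cmod (mono n lam u) <= B.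
Proof.
  induction n as [|n IH]; intros lam; simpl.
  - exists 1%R. split; [lra|]. intros u _. rewrite Cmod_1. lra.
  - destruct (IH (fun i => lam (S i))) as [B [HB H]].
    exists (Rd ^ Z.abs_nat (lam O) * B)%R. split.
    + apply Rmult_le_pos; auto. apply pow_le. lra.
    + intros u Hu. rewrite Cmod_mult. apply Rmult_le_compat; auto using Cmod_ge_0.
      * apply Cpowz_bound; auto; apply Hu.
      * apply H. intros i. apply Hu.
Qed.

Lemma laurent_bound (n : nat) (Rd : R) (p : (nat -> C) -> C) : 1 <= Rd -> laurent n p ->
  exists B, 0 <= B /\ forall u, in_annulus Rd u -> Cmod (p u) <= B.
Proof.
  intros HR H. induction H as [lam|f g _ [A [HA Hf]] _ [B [HB Hg]]|k f _ [A [HA Hf]]|f g _ [A [HA Hf]] He].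
  - apply mono_bound; auto.
  - exists (A + B)%R. split; [lra|]. intros u Hu. eapply Rle_trans; [apply Cmod_triangle|].
    specialize (Hf u Hu). specialize (Hg u Hu). lra.
  - exists (Cmod k * A)%R. split; [apply Rmult_le_pos; auto using Cmod_ge_0|].
    intros u Hu. rewrite Cmod_mult. apply Rmult_le_compat_l; auto using Cmod_ge_0.
  - exists A. split; auto. intros u Hu. rewrite <- He; auto. eapply in_annulus_nonzero_point; eauto.
Qed.

Lemma laurent_mult (n : nat) (p r : (nat -> C) -> C) : laurent n p -> laurent n r -> laurent n (fun u =>
    p u * r u).
Proof.
  intros Hp Hr. induction Hp as [lam|f g _ IHf _ IHg|k f _ IHf|f g _ IHf He].
  - induction Hr as [mu|f g _ IHf _ IHg|k f _ IHf|f g _ IHf He].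
    + eapply laurent_ext; [apply (laurent_mono n (fun i => (lam i + mu i)%Z))|].
      intros u Hu. simpl. apply mono_add; auto.
    + eapply laurent_ext; [apply (laurent_plus n _ _ IHf IHg)|]. intros u _. simpl. ring.
    + eapply laurent_ext; [apply (laurent_scal n k _ IHf)|]. intros u _. simpl. ring.
    + eapply laurent_ext; [apply IHf|]. intros u Hu. simpl. rewrite He; auto.
  - eapply laurent_ext; [apply (laurent_plus n _ _ IHf IHg)|]. intros u _. simpl. ring.
  - eapply laurent_ext; [apply (laurent_scal n k _ IHf)|]. intros u _. simpl. ring.
  - eapply laurent_ext; [apply IHf|]. intros u Hu. simpl. rewrite He; auto.
Qed.

Lemma laurent_const (n : nat) (c : C) : laurent n (fun _ => c).
Proof.
  eapply laurent_ext; [apply (laurent_scal n c), (laurent_mono n (fun _ => 0%Z))|]. intros u _. simpl.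
  rewrite mono_prodn, (prodn_ext n _ (fun _ => 1)) by reflexivity.
  rewrite prodn_const, Cpow_1_l. ring.
Qed.

Lemma laurent_powz (n i : nat) (k : Z) : (i < n)%nat -> laurent n (fun u => Cpowz (u i) k).
Proof.
  intros Hi. eapply laurent_ext; [apply (laurent_mono n (fun j => if Nat.eqb j i then k else 0%Z))|].
  intros u _. apply mono_single; auto.
Qed.

Lemma laurent_var (n i : nat) : (i < n)%nat -> laurent n (fun u => u i).
Proof.
  intros Hi. eapply laurent_ext; [apply (laurent_powz n i 1 Hi)|]. intros u _. apply Cpowz_1.
Qed.

Lemma laurent_inv (n i : nat) : (i < n)%nat -> laurent n (fun u => / u i).
Proof.
  intros Hi. eapply laurent_ext; [apply (laurent_powz n i (-1) Hi)|]. intros u Hu.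
  change (/ Cpow (u i) 1 = / u i). rewrite Cpow_1_r. reflexivity.
Qed.

Lemma laurent_poch (n k : nat) (p : (nat -> C) -> C) (q : C) :
  laurent n p -> laurent n (fun u => poch k (p u) q).
Proof.
  intros Hp. induction k as [|k IH]; simpl; [apply laurent_const|].
  apply laurent_mult; auto.
  eapply laurent_ext; [apply (laurent_plus n _ _ (laurent_const n 1) (laurent_scal n (- Cpow q k) _ Hp))|].
  intros u _. simpl. ring.
Qed.

Lemma laurent_tint (n : nat) (p : (nat -> C) -> C) : laurent n p -> is_tint n p (CT n p).
Proof.
  intros H. assert (Hc : exists c, is_tint n p c).
  { induction H as [lam|f g _ [a Ha] _ [b Hb]|k f _ [a Ha]|f g _ [a Ha] He].
    - eexists. apply tint_mono.
    - eexists. apply tint_plus; eauto.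
    - eexists. apply tint_scal; eauto.
    - eexists. eapply tint_ext; [|eauto]. intros u Hu. apply He, nonzero_point_torus, Hu. }
  destruct Hc as [c Hc]. rewrite (CT_eq n p c Hc). exact Hc.
Qed.

(** The torus integral only sees the values on the unit torus, so a uniform limit there suffices. *)
Definition torus_laurent (n : nat) (g : (nat -> C) -> C) : Prop :=
  forall eps, 0 < eps -> exists p, laurent n p /\ forall u, on_torus u -> Cmod (g u - p u) <= eps.

Lemma unif_laurent_torus_laurent (n : nat) (g : (nat -> C) -> C) : unif_laurent n g -> torus_laurent n g.
Proof.
  intros H eps Heps. destruct (H 1%R eps ltac:(lra) Heps) as [p [Hp Hg]].
  exists p. split; auto. intros u Hu. apply Hg, in_annulus_torus; auto. lra.
Qed.

Lemma torus_laurent_tint (n : nat) (g : (nat -> C) -> C) : torus_laurent n g -> is_tint n g (CT n g).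
Proof.
  intros H.
  assert (Hp : forall k, exists p, laurent n p /\ forall u, on_torus u -> Cmod (g u - p u) <= (/ 2) ^ k).
  { intros k. apply H. apply pow_lt. lra. }
  pose (p := fun k => proj1_sig (constructive_indefinite_description _ (Hp k))).
  assert (Hp' : forall k, laurent n (p k) /\ forall u, on_torus u -> Cmod (g u - p k u) <= (/ 2) ^ k).
  { intros k. apply (proj2_sig (constructive_indefinite_description _ (Hp k))). }
  clearbody p.
  destruct (tint_lim n p (fun k => CT n (p k)) g) as [d [Hd _]].
  - intros k. apply laurent_tint, Hp'.
  - intros eps Heps. destruct (pow_small (/ 2) 1 eps) as [K HK]; try lra.
    exists K. intros k u Hk Hu. specialize (HK k Hk).
    replace (p k u - g u) with (- (g u - p k u)) by ring. rewrite Cmod_opp.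
    destruct (Hp' k) as [_ Hk']. specialize (Hk' u Hu). lra.
  - rewrite (CT_eq n g d Hd). exact Hd.
Qed.

Lemma unif_laurent_tint (n : nat) (g : (nat -> C) -> C) : unif_laurent n g -> is_tint n g (CT n g).
Proof. intros H. apply torus_laurent_tint, unif_laurent_torus_laurent, H. Qed.

Lemma unif_laurent_laurent (n : nat) (g : (nat -> C) -> C) : laurent n g -> unif_laurent n g.
Proof.
  intros H Rd eps HR Heps. exists g. split; auto. intros u _.
  replace (g u - g u) with (RtoC 0) by ring. rewrite Cmod_0. lra.
Qed.

Lemma unif_laurent_ext (n : nat) (g h : (nat -> C) -> C) :
  unif_laurent n g -> (forall u, nonzero_point u -> g u = h u) -> unif_laurent n h.
Proof.
  intros H He Rd eps HR Heps. destruct (H Rd eps HR Heps) as [p [Hp Hg]].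
  exists p. split; auto. intros u Hu. rewrite <- He; auto. eapply in_annulus_nonzero_point; eauto.
Qed.

Lemma unif_laurent_bound (n : nat) (Rd : R) (g : (nat -> C) -> C) : 1 <= Rd -> unif_laurent n g ->
  exists B, 0 <= B /\ forall u, in_annulus Rd u -> Cmod (g u) <= B.
Proof.
  intros HR H. destruct (H Rd 1%R HR ltac:(lra)) as [p [Hp Hg]].
  destruct (laurent_bound n Rd p HR Hp) as [B [HB Hb]].
  exists (B + 1)%R. split; [lra|]. intros u Hu. specialize (Hg u Hu). specialize (Hb u Hu).
  replace (g u) with ((g u - p u) + p u) by ring.
  eapply Rle_trans; [apply Cmod_triangle|]. lra.
Qed.

Lemma unif_laurent_plus (n : nat) (g h : (nat -> C) -> C) : unif_laurent n g -> unif_laurent n h ->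
    unif_laurent n (fun u => g u + h u).
Proof.
  intros Hg Hh Rd eps HR Heps.
  destruct (Hg Rd (eps / 2)%R HR ltac:(lra)) as [p [Hp Hgp]].
  destruct (Hh Rd (eps / 2)%R HR ltac:(lra)) as [r [Hr Hhr]].
  exists (fun u => p u + r u). split; [apply laurent_plus; auto|]. intros u Hu.
  specialize (Hgp u Hu). specialize (Hhr u Hu).
  replace (g u + h u - (p u + r u)) with ((g u - p u) + (h u - r u)) by ring.
  eapply Rle_trans; [apply Cmod_triangle|]. lra.
Qed.

Lemma unif_laurent_mult (n : nat) (g h : (nat -> C) -> C) : unif_laurent n g -> unif_laurent n h ->
    unif_laurent n (fun u => g u * h u).
Proof.
  intros Hg Hh Rd eps HR Heps.
  destruct (unif_laurent_bound n Rd h HR Hh) as [B [HB Hb]].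
  destruct (Hg Rd (eps / (2 * (B + 1)))%R HR) as [p [Hp Hgp]].
  { apply Rdiv_lt_0_compat; lra. }
  (* The accuracy required for [h] depends on a bound for [p], so [g] is approximated before [h]. *)
  destruct (laurent_bound n Rd p HR Hp) as [A [HA Ha]].
  destruct (Hh Rd (eps / (2 * (A + 1)))%R HR) as [r [Hr Hhr]].
  { apply Rdiv_lt_0_compat; lra. }
  exists (fun u => p u * r u). split; [apply laurent_mult; auto|]. intros u Hu.
  specialize (Hgp u Hu). specialize (Hhr u Hu). specialize (Ha u Hu). specialize (Hb u Hu).
  replace (g u * h u - p u * r u) with ((g u - p u) * h u + p u * (h u - r u)) by ring.
  eapply Rle_trans; [apply Cmod_triangle|]. rewrite !Cmod_mult.
  assert (H1 : Cmod (g u - p u) * Cmod (h u) <= eps / (2 * (B + 1)) * (B + 1)).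
  { apply Rmult_le_compat; auto using Cmod_ge_0. lra. }
  assert (H2 : Cmod (p u) * Cmod (h u - r u) <= (A + 1) * (eps / (2 * (A + 1)))).
  { apply Rmult_le_compat; auto using Cmod_ge_0. lra. }
  replace (eps / (2 * (B + 1)) * (B + 1))%R with (eps / 2)%R in H1 by (field; lra).
  replace ((A + 1) * (eps / (2 * (A + 1))))%R with (eps / 2)%R in H2 by (field; lra). lra.
Qed.

Lemma unif_laurent_const (n : nat) (c : C) : unif_laurent n (fun _ => c).
Proof. apply unif_laurent_laurent, laurent_const. Qed.

Lemma unif_laurent_scal (n : nat) (c : C) (g : (nat -> C) -> C) : unif_laurent n g -> unif_laurent n
    (fun u => c * g u).
Proof. apply unif_laurent_mult, unif_laurent_const. Qed.

Lemma unif_laurent_prodn (n k : nat) (f : nat -> (nat -> C) -> C) :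
  (forall i, (i < k)%nat -> unif_laurent n (f i)) -> unif_laurent n (fun u => prodn k (fun i => f i u)).
Proof.
  induction k as [|k IH]; intros H; simpl; [apply unif_laurent_const|]. apply unif_laurent_mult; auto.
Qed.

Lemma unif_laurent_sumn (n k : nat) (f : nat -> (nat -> C) -> C) :
  (forall i, (i < k)%nat -> unif_laurent n (f i)) -> unif_laurent n (fun u => sumn k (fun i => f i u)).
Proof.
  induction k as [|k IH]; intros H; simpl; [apply unif_laurent_const|]. apply unif_laurent_plus; auto.
Qed.

Lemma unif_laurent_qpoch (n : nat) (p : (nat -> C) -> C) (q : C) : Cmod q < 1 ->
  laurent n p -> unif_laurent n (fun u => qpoch (p u) q).
Proof.
  intros Hq Hp Rd eps HR Heps.
  destruct (laurent_bound n Rd p HR Hp) as [B [HB Hb]].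
  destruct (pow_small (Cmod q) (pbound B (Cmod q) * B / (1 - Cmod q)) eps) as [k Hk]; auto.
  { split; auto using Cmod_ge_0. }
  { apply Rmult_le_pos.
    - apply Rmult_le_pos; auto. left. apply exp_pos.
    - left. apply Rinv_0_lt_compat. lra. }
  exists (fun u => poch k (p u) q). split; [apply laurent_poch; auto|]. intros u Hu.
  eapply Rle_trans; [apply Cmod_qpoch_tail; [apply Hb, Hu|auto]|]. left. apply Hk. lia.
Qed.

Lemma CT_ext (n : nat) (g h : (nat -> C) -> C) : unif_laurent n g ->
  (forall u, nonzero_point u -> g u = h u) -> CT n g = CT n h.
Proof.
  intros Hg He. symmetry. apply CT_eq. apply (tint_ext n g); [|apply unif_laurent_tint; auto].
  intros u Hu. apply He, nonzero_point_torus, Hu.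
Qed.

Lemma CT_plus (n : nat) (g h : (nat -> C) -> C) : unif_laurent n g -> unif_laurent n h ->
  CT n (fun u => g u + h u) = CT n g + CT n h.
Proof. intros Hg Hh. apply CT_eq, tint_plus; apply unif_laurent_tint; auto. Qed.

Lemma CT_scal (n : nat) (c : C) (g : (nat -> C) -> C) : unif_laurent n g ->
  CT n (fun u => c * g u) = c * CT n g.
Proof. intros Hg. apply CT_eq, tint_scal, unif_laurent_tint; auto. Qed.

Lemma CT_sumn (n k : nat) (f : nat -> (nat -> C) -> C) :
  (forall i, (i < k)%nat -> unif_laurent n (f i)) ->
  CT n (fun u => sumn k (fun i => f i u)) = sumn k (fun i => CT n (f i)).
Proof.
  induction k as [|k IH]; intros H; simpl.
  - transitivity (0 * CT n (fun _ => 1)); [|ring].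
    rewrite <- CT_scal by apply unif_laurent_const. f_equal.
    apply functional_extensionality. intros; ring.
  - rewrite CT_plus; auto.
    + rewrite IH; auto.
    + apply unif_laurent_sumn; auto.
Qed.

Lemma CT_diff_bound (n : nat) (g h : (nat -> C) -> C) (M : R) : torus_laurent n g -> torus_laurent n h ->
  (forall u, on_torus u -> Cmod (g u - h u) <= M) -> Cmod (CT n g - CT n h) <= M.
Proof. intros Hg Hh. apply (tint_diff_bound n); apply torus_laurent_tint; auto. Qed.

Lemma CT_lim (n : nat) (g : nat -> (nat -> C) -> C) (h : (nat -> C) -> C) :
  (forall k, unif_laurent n (g k)) ->
  (forall eps, 0 < eps -> exists K, forall k u, (K <= k)%nat -> on_torus u ->
     Cmod (g k u - h u) <= eps) ->
  Ccv (fun k => CT n (g k)) (CT n h).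
Proof.
  intros Hg Hu. destruct (tint_lim n g (fun k => CT n (g k)) h) as [d [Hd Hc]]; auto.
  - intros k. apply unif_laurent_tint; auto.
  - rewrite (CT_eq n h d Hd). exact Hc.
Qed.

(** * Substitutions preserving the constant term *)

Definition dom_map (phi : (nat -> C) -> nat -> C) : Prop :=
  (forall u, nonzero_point u -> nonzero_point (phi u)) /\
  (forall Rd, 1 <= Rd -> exists Rd', 1 <= Rd' /\ forall u, in_annulus Rd u -> in_annulus Rd' (phi u)).

Lemma laurent_comp (n k : nat) (phi : (nat -> C) -> nat -> C) (p : (nat -> C) -> C) :
  (forall u, nonzero_point u -> nonzero_point (phi u)) -> (forall lam, laurent k (fun u => mono n lam
      (phi u))) ->
  laurent n p -> laurent k (fun u => p (phi u)).
Proof.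
  intros Hn Hm H. induction H as [lam|f g _ IHf _ IHg|c f _ IHf|f g _ IHf He].
  - apply Hm.
  - apply (laurent_plus k (fun u => f (phi u)) (fun u => g (phi u))); auto.
  - apply (laurent_scal k c (fun u => f (phi u))); auto.
  - eapply laurent_ext; [apply IHf|]. intros u Hu. apply He, Hn, Hu.
Qed.

Lemma unif_laurent_comp (n k : nat) (phi : (nat -> C) -> nat -> C) (g : (nat -> C) -> C) :
  dom_map phi -> (forall lam, laurent k (fun u => mono n lam (phi u))) ->
  unif_laurent n g -> unif_laurent k (fun u => g (phi u)).
Proof.
  intros [Hn Ha] Hm H Rd eps HR Heps. destruct (Ha Rd HR) as [Rd' [HR' Hr]].
  destruct (H Rd' eps HR' Heps) as [p [Hp Hg]].
  exists (fun u => p (phi u)). split; [apply (laurent_comp n); auto|].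
  intros u Hu. apply Hg, Hr, Hu.
Qed.

(** A substitution sending each monomial to a multiple of a monomial with the same constant term.
    The condition is linear and [dom_map] controls the annuli, so it extends to all of
    [unif_laurent]. *)
Definition ct_map (n : nat) (phi : (nat -> C) -> nat -> C) : Prop :=
  dom_map phi /\
  forall lam, exists k mu, (forall u, nonzero_point u -> mono n lam (phi u) = k * mono n mu u) /\
    k * mct n mu = mct n lam.

Lemma ct_map_unif_laurent (n : nat) (phi : (nat -> C) -> nat -> C) (g : (nat -> C) -> C) :
  ct_map n phi -> unif_laurent n g -> unif_laurent n (fun u => g (phi u)).
Proof.
  intros [Hd Hm]. apply unif_laurent_comp; auto. intros lam. destruct (Hm lam) as [k [mu [He _]]].
  eapply laurent_ext; [apply (laurent_scal n k), (laurent_mono n mu)|]. intros u Hu. symmetry. apply He, Hu.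
Qed.

Lemma ct_map_laurent (n : nat) (phi : (nat -> C) -> nat -> C) (p : (nat -> C) -> C) :
  ct_map n phi -> laurent n p -> CT n (fun u => p (phi u)) = CT n p.
Proof.
  intros [[Hn Hd] Hm] H.
  assert (Hl : forall lam, laurent n (fun u => mono n lam (phi u))).
  { intros lam. destruct (Hm lam) as [k [mu [He _]]].
    eapply laurent_ext; [apply (laurent_scal n k), (laurent_mono n mu)|]. intros u Hu. symmetry. apply
        He, Hu. }
  induction H as [lam|f g Hf IHf Hg IHg|c f Hf IHf|f g Hf IHf He].
  - destruct (Hm lam) as [k [mu [He Hk]]].
    rewrite <- (CT_ext n (fun u => k * mono n mu u)).
    + rewrite CT_scal by apply unif_laurent_laurent, laurent_mono.
      rewrite !(CT_eq _ _ _ (tint_mono n _)). exact Hk.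
    + apply unif_laurent_scal, unif_laurent_laurent, laurent_mono.
    + intros u Hu. symmetry. apply He, Hu.
  - rewrite (CT_plus n (fun u => f (phi u)) (fun u => g (phi u))), CT_plus;
      try (apply unif_laurent_laurent; auto; apply (laurent_comp n); auto).
    rewrite IHf, IHg. reflexivity.
  - rewrite (CT_scal n c (fun u => f (phi u))), CT_scal;
      try (apply unif_laurent_laurent; auto; apply (laurent_comp n); auto).
    rewrite IHf. reflexivity.
  - rewrite <- (CT_ext n f g), <- IHf; auto using unif_laurent_laurent. symmetry. apply CT_ext.
    + apply unif_laurent_laurent, (laurent_comp n); auto.
    + intros u Hu. apply He, Hn, Hu.
Qed.

(** One Laurent polynomial serves both sides: the annulus chosen to contain the image of the torus
    also contains the torus. *)
Lemma ct_map_CT (n : nat) (phi : (nat -> C) -> nat -> C) (g : (nat -> C) -> C) :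
  ct_map n phi -> unif_laurent n g -> CT n (fun u => g (phi u)) = CT n g.
Proof.
  intros Hphi Hg. apply Cmod_small_eq. intros eps Heps.
  assert (Hphi' := Hphi). destruct Hphi' as [[Hn Hd] _].
  destruct (Hd 1%R ltac:(lra)) as [Rd [HR Ha]].
  destruct (Hg Rd (eps / 2)%R HR ltac:(lra)) as [p [Hp Hgp]].
  replace (CT n (fun u => g (phi u)) - CT n g)
    with ((CT n (fun u => g (phi u)) - CT n (fun u => p (phi u))) + (CT n p - CT n g))
    by (rewrite (ct_map_laurent n phi p); auto; ring).
  eapply Rle_trans; [apply Cmod_triangle|].
  replace eps with (eps / 2 + eps / 2)%R by field. apply Rplus_le_compat.
  - apply CT_diff_bound.
    + apply unif_laurent_torus_laurent, (ct_map_unif_laurent n phi); auto.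
    + apply unif_laurent_torus_laurent, (ct_map_unif_laurent n phi); auto. apply unif_laurent_laurent; auto.
    + intros u Hu. apply Hgp, Ha, in_annulus_torus; auto. lra.
  - apply CT_diff_bound; auto using unif_laurent_torus_laurent, unif_laurent_laurent.
    intros u Hu. replace (p u - g u) with (- (g u - p u)) by ring. rewrite Cmod_opp.
    apply Hgp, in_annulus_torus; auto.
Qed.

Lemma ct_map_comp (n : nat) (phi psi : (nat -> C) -> nat -> C) :
  ct_map n phi -> ct_map n psi -> ct_map n (fun u => phi (psi u)).
Proof.
  intros [[Hn Hd] Hm] [[Hn' Hd'] Hm']. split; [split|].
  - intros u Hu. apply Hn, Hn', Hu.
  - intros Rd HR. destruct (Hd' Rd HR) as [R1 [HR1 H1]]. destruct (Hd R1 HR1) as [R2 [HR2 H2]].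
    exists R2. split; auto.
  - intros lam. destruct (Hm lam) as [k [mu [He Hk]]]. destruct (Hm' mu) as [k' [mu' [He' Hk']]].
    exists (k * k'), mu'. split.
    + intros u Hu. rewrite He, He' by auto. ring.
    + rewrite <- Cmult_assoc, Hk', Hk. reflexivity.
Qed.

Definition swap {A : Type} (i : nat) (u : nat -> A) (j : nat) : A :=
  if Nat.eqb j i then u (S i) else if Nat.eqb j (S i) then u i else u j.

Lemma swap_l {A : Type} (i : nat) (u : nat -> A) : swap i u i = u (S i).
Proof. unfold swap. rewrite Nat.eqb_refl. reflexivity. Qed.

Lemma swap_r {A : Type} (i : nat) (u : nat -> A) : swap i u (S i) = u i.
Proof.
  unfold swap. destruct (Nat.eqb_spec (S i) i); [lia|]. rewrite Nat.eqb_refl. reflexivity.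
Qed.

Lemma swap_other {A : Type} (i j : nat) (u : nat -> A) : j <> i -> j <> S i -> swap i u j = u j.
Proof.
  intros H1 H2. unfold swap. destruct (Nat.eqb_spec j i); [lia|].
  destruct (Nat.eqb_spec j (S i)); [lia|]. reflexivity.
Qed.

Lemma swap_swap {A : Type} (i : nat) (u : nat -> A) : swap i (swap i u) = u.
Proof.
  apply functional_extensionality. intros j.
  destruct (Nat.eq_dec j i) as [->|H1]; [rewrite swap_l, swap_r; auto|].
  destruct (Nat.eq_dec j (S i)) as [->|H2]; [rewrite swap_r, swap_l; auto|].
  rewrite !swap_other; auto.
Qed.

Lemma mono_swap (n : nat) : forall (i : nat) (lam : nat -> Z) (u : nat -> C), (S i < n)%nat ->
  mono n lam (swap i u) = mono n (swap i lam) u.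
Proof.
  induction n as [|n IH]; intros i lam u Hi; [lia|].
  destruct i as [|i].
  - destruct n as [|n]; [lia|]. simpl. unfold swap; simpl. ring.
  - simpl. unfold swap at 1 3; simpl.
    change (fun j => swap (S i) u (S j)) with (swap i (fun j => u (S j))).
    rewrite IH by lia. reflexivity.
Qed.

Lemma mct_swap (n : nat) : forall (i : nat) (lam : nat -> Z), (S i < n)%nat ->
  mct n (swap i lam) = mct n lam.
Proof.
  induction n as [|n IH]; intros i lam Hi; [lia|].
  destruct i as [|i].
  - destruct n as [|n]; [lia|]. simpl. unfold swap; simpl. ring.
  - simpl. unfold swap at 1; simpl.
    change (fun j => swap (S i) lam (S j)) with (swap i (fun j => lam (S j))).
    rewrite IH by lia. reflexivity.
Qed.

Lemma swap_all {A : Type} (P : A -> Prop) (i : nat) (u : nat -> A) :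
  (forall j, P (u j)) -> forall j, P (swap i u j).
Proof. intros H j. unfold swap. destruct (Nat.eqb j i); auto. destruct (Nat.eqb j (S i)); auto. Qed.

Lemma ct_map_swap (n i : nat) : (S i < n)%nat -> ct_map n (swap i).
Proof.
  intros Hi. split; [split|].
  - intros u Hu. exact (swap_all (fun z => z <> RtoC 0) i u Hu).
  - intros Rd HR. exists Rd. split; auto. intros u Hu.
    exact (swap_all (fun z => / Rd <= Cmod z /\ Cmod z <= Rd) i u Hu).
  - intros lam. exists 1, (swap i lam). split.
    + intros u _. rewrite mono_swap by auto. ring.
    + rewrite mct_swap by auto. ring.
Qed.

Definition scale (c : C) (u : nat -> C) (j : nat) : C := c * u j.

Definition scale0 (c : C) (u : nat -> C) (j : nat) : C :=
  match j with O => c * u O | S _ => u j end.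

Definition max_mod (c : C) : R := Rmax 1 (Rmax (Cmod c) (/ Cmod c)).

Lemma rad_spec (c : C) : c <> 0 -> 1 <= max_mod c /\ Cmod c <= max_mod c /\ / max_mod c <= Cmod c.
Proof.
  intros Hc. assert (0 < Cmod c) by (apply Cmod_gt_0; auto).
  assert (H1 : 1 <= max_mod c) by apply Rmax_l.
  assert (H2 : Rmax (Cmod c) (/ Cmod c) <= max_mod c) by apply Rmax_r.
  pose proof (Rmax_l (Cmod c) (/ Cmod c)). pose proof (Rmax_r (Cmod c) (/ Cmod c)).
  split; [auto|split; [lra|]].
  rewrite <- (Rinv_inv (Cmod c)). apply Rinv_le_contravar; [|lra].
  apply Rinv_0_lt_compat; auto.
Qed.

Lemma in_annulus_mult (Rd : R) (c z : C) : c <> 0 -> 1 <= Rd -> / Rd <= Cmod z /\ Cmod z <= Rd ->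
  / (max_mod c * Rd) <= Cmod (c * z) /\ Cmod (c * z) <= max_mod c * Rd.
Proof.
  intros Hc HR [H1 H2]. destruct (rad_spec c Hc) as [R1 [R2 R3]].
  assert (0 < / max_mod c) by (apply Rinv_0_lt_compat; lra).
  assert (0 < / Rd) by (apply Rinv_0_lt_compat; lra).
  rewrite Cmod_mult. split.
  - rewrite Rinv_mult. apply Rmult_le_compat; lra.
  - apply Rmult_le_compat; auto using Cmod_ge_0.
Qed.

Lemma dom_map_scale (c : C) : c <> 0 -> dom_map (scale c).
Proof.
  intros Hc. split.
  - intros u Hu i. apply Cmult_neq_0; auto.
  - intros Rd HR. destruct (rad_spec c Hc) as [R1 _]. exists (max_mod c * Rd)%R. split; [nra|].
    intros u Hu i. apply in_annulus_mult; auto.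
Qed.

Lemma dom_map_scale0 (c : C) : c <> 0 -> dom_map (scale0 c).
Proof.
  intros Hc. split.
  - intros u Hu [|i]; simpl; auto. apply Cmult_neq_0; auto.
  - intros Rd HR. destruct (rad_spec c Hc) as [R1 _]. exists (max_mod c * Rd)%R. split; [nra|].
    intros u Hu [|i]; simpl.
    + apply in_annulus_mult; auto.
    + apply (in_annulus_mono Rd); auto. nra.
Qed.

(** [k] is [c] to the total degree of the monomial. If [mct] is nonzero, all exponents vanish and
    [k = 1]. *)
Lemma mono_scale (n : nat) (c : C) (Hc : c <> 0) : forall lam, exists k,
  (forall u, nonzero_point u -> mono n lam (scale c u) = k * mono n lam u) /\ k * mct n lam = mct n lam.
Proof.
  induction n as [|n IH]; intros lam.
  - exists 1. simpl. split; intros; ring.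
  - destruct (IH (fun i => lam (S i))) as [k [H1 H2]].
    exists (Cpowz c (lam O) * k). simpl. split.
    + intros u Hu. change (fun i => scale c u (S i)) with (scale c (fun i => u (S i))).
      rewrite H1 by (intros i; apply Hu). unfold scale. rewrite Cpowz_mul_l by auto. ring.
    + destruct (Z.eqb_spec (lam O) 0) as [->|Hn].
      * rewrite Cpowz_0. rewrite <- H2 at 2. ring.
      * ring.
Qed.

Lemma ct_map_scale (n : nat) (c : C) : c <> 0 -> ct_map n (scale c).
Proof.
  intros Hc. split; [apply dom_map_scale; auto|]. intros lam.
  destruct (mono_scale n c Hc lam) as [k [H1 H2]]. exists k, lam. auto.
Qed.

Lemma ct_map_scale0 (n : nat) (c : C) : c <> 0 -> ct_map (S n) (scale0 c).
Proof.
  intros Hc. split; [apply dom_map_scale0; auto|]. intros lam.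
  exists (Cpowz c (lam O)), lam. simpl. split.
  - intros u Hu. rewrite Cpowz_mul_l by auto. ring.
  - destruct (Z.eqb_spec (lam O) 0) as [->|Hn]; [rewrite Cpowz_0|]; ring.
Qed.

Definition rot (k : nat) (c : C) (u : nat -> C) (j : nat) : C :=
  match j with O => c * u (k - 1)%nat | S i => if Nat.ltb j k then u i else u j end.

(** The rotation factors into adjacent transpositions, which bring the last variable to the front,
    followed by a rescaling of the first variable. *)
Lemma ct_map_rot (n : nat) (c : C) : c <> 0 -> forall k, (k <= n)%nat -> ct_map (S n) (rot (S k) c).
Proof.
  intros Hc. induction k as [|k IH]; intros Hk.
  - assert (He : rot 1 c = scale0 c).
    { apply functional_extensionality. intros u. apply functional_extensionality.
      intros [|j]; reflexivity. }
    rewrite He. apply ct_map_scale0; auto.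
  - assert (He : rot (S (S k)) c = fun u => rot (S k) c (swap k u)).
    { apply functional_extensionality. intros u. apply functional_extensionality.
      intros [|j]; unfold rot.
      - replace (S (S k) - 1)%nat with (S k) by lia. replace (S k - 1)%nat with k by lia.
        rewrite swap_l. reflexivity.
      - destruct (Nat.ltb_spec (S j) (S (S k))); destruct (Nat.ltb_spec (S j) (S k)); try lia.
        + rewrite swap_other; auto; lia.
        + replace j with k by lia. rewrite swap_r. reflexivity.
        + rewrite swap_other; auto; lia. }
    rewrite He. apply ct_map_comp; [apply IH; lia | apply ct_map_swap; lia].
Qed.

Lemma unif_laurent_scons_one (n : nat) (g : (nat -> C) -> C) :
  unif_laurent (S n) g -> unif_laurent n (fun u => g (scons 1 u)).
Proof.
  apply unif_laurent_comp.
  - split.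
    + intros u Hu [|i]; simpl; auto. apply C1_nz.
    + intros Rd HR. exists Rd. split; auto. intros u Hu [|i]; simpl; auto.
      rewrite Cmod_1. split; auto. rewrite <- Rinv_1. apply Rinv_le_contravar; lra.
  - intros lam. eapply laurent_ext; [apply (laurent_mono n (fun i => lam (S i)))|].
    intros u _. simpl. rewrite Cpowz_1_l.
    rewrite Cmult_1_l. reflexivity.
Qed.

(** For fixed first variable [e^(i th)], rescaling the others by [e^(- i th)] and homogeneity of
    degree zero replace it by 1. The inner integral thus does not depend on [th]. *)
Lemma CT_dehomogenize (n : nat) (g : (nat -> C) -> C) : unif_laurent (S n) g ->
  (forall (c : C) u, c <> 0 -> nonzero_point u -> g (scale c u) = g u) ->
  CT (S n) g = CT n (fun u => g (scons 1 u)).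
Proof.
  intros Hg Hh. apply CT_eq. simpl.
  exists (fun _ => CT n (fun u => g (scons 1 u))). split; [|apply is_circ_const].
  intros th. assert (He : Cexpi th <> 0) by apply Cmod1_nz, Cmod_expi.
  assert (Hi : / Cexpi th <> 0) by (apply nonzero_inv; auto).
  assert (Ha : unif_laurent n (fun u => g (scons 1 u))) by (apply unif_laurent_scons_one; auto).
  rewrite <- (ct_map_CT n (scale (/ Cexpi th)) (fun u => g (scons 1 u))) by (auto using ct_map_scale).
  apply (tint_ext n (fun u => g (scons 1 (scale (/ Cexpi th) u)))).
  - intros u Hu. rewrite <- (Hh (Cexpi th)); auto.
    + f_equal. apply functional_extensionality. intros [|i]; unfold scale; simpl.
      * ring.
      * field. auto.
    + intros [|i]; simpl; [apply C1_nz|]. apply Cmult_neq_0; auto. apply nonzero_point_torus; auto.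
  - apply unif_laurent_tint. apply (ct_map_unif_laurent n _ _ (ct_map_scale n _ Hi) Ha).
Qed.

Lemma unif_laurent_var (n i : nat) : (i < n)%nat -> unif_laurent n (fun u => u i).
Proof. intros H. apply unif_laurent_laurent, laurent_var, H. Qed.

Lemma unif_laurent_inv (n i : nat) : (i < n)%nat -> unif_laurent n (fun u => / u i).
Proof. intros H. apply unif_laurent_laurent, laurent_inv, H. Qed.

Lemma unif_laurent_powz (n i : nat) (k : Z) : (i < n)%nat -> unif_laurent n (fun u => Cpowz (u i) k).
Proof. intros H. apply unif_laurent_laurent, laurent_powz, H. Qed.

Lemma unif_laurent_opp (n : nat) (g : (nat -> C) -> C) : unif_laurent n g -> unif_laurent n (fun u => - g u).
Proof.
  intros H. apply (unif_laurent_ext n (fun u => (- 1) * g u)); [apply unif_laurent_scal; auto|].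
  intros u _. ring.
Qed.

Lemma unif_laurent_minus (n : nat) (g h : (nat -> C) -> C) : unif_laurent n g -> unif_laurent n h ->
    unif_laurent n (fun u => g u - h u).
Proof. intros Hg Hh. apply unif_laurent_plus; auto. apply unif_laurent_opp; auto. Qed.

Lemma unif_laurent_swap (n i : nat) (g : (nat -> C) -> C) : (S i < n)%nat -> unif_laurent n g ->
  unif_laurent n (fun u => g (swap i u)).
Proof. intros Hi. apply ct_map_unif_laurent, ct_map_swap, Hi. Qed.

Ltac al := repeat first
  [ assumption
  | match goal with |- unif_laurent _ (fun _ => ?c) => apply unif_laurent_const end
  | apply unif_laurent_var; lia | apply unif_laurent_inv; lia | apply unif_laurent_powz; lia
  | apply unif_laurent_minus | apply unif_laurent_plus | apply unif_laurent_mult | apply unif_laurent_opp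
  | apply unif_laurent_prodn; intros ].

(** * Products over pairs of variables *)

(** The product over [i < j < n], arranged so that the last variable splits off; [pairprod_head]
    splits off the first. *)
Fixpoint pairprod (f : C -> C -> C) (n : nat) (u : nat -> C) : C :=
  match n with
  | O => 1
  | S k => pairprod f k u * prodn k (fun i => f (u i) (u k))
  end.

Lemma pairprod_ext (f : C -> C -> C) (n : nat) (u v : nat -> C) :
  (forall i, (i < n)%nat -> u i = v i) -> pairprod f n u = pairprod f n v.
Proof.
  induction n as [|n IH]; intros H; simpl; auto.
  rewrite IH by auto. f_equal. apply prodn_ext. intros i Hi. rewrite !H by lia. reflexivity.
Qed.

Lemma prodn_swap (n i : nat) (f : nat -> C) : (S i < n)%nat -> prodn n (swap i f) = prodn n f.
Proof.
  induction n as [|n IH]; intros Hi; [lia|].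
  destruct (Nat.eq_dec n (S i)) as [->|Hne].
  - simpl. rewrite swap_l, swap_r.
    rewrite (prodn_ext i (swap i f) f) by (intros j Hj; apply swap_other; lia). ring.
  - simpl. rewrite IH, swap_other by lia. reflexivity.
Qed.

Lemma swap_map {A B : Type} (F : A -> B) (i j : nat) (u : nat -> A) :
  F (swap i u j) = swap i (fun k => F (u k)) j.
Proof. unfold swap. destruct (Nat.eqb j i); auto. destruct (Nat.eqb j (S i)); auto. Qed.

Lemma prodn_swap_map (n i : nat) (F : C -> C) (u : nat -> C) : (S i < n)%nat ->
  prodn n (fun j => F (swap i u j)) = prodn n (fun j => F (u j)).
Proof.
  intros Hi. rewrite <- (prodn_swap n i (fun j => F (u j)) Hi).
  apply prodn_ext. intros j _. apply swap_map.
Qed.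

(** All pairs other than [(i, i+1)] are permuted among themselves, so the whole product changes by
    the factor of that single pair. *)
Lemma pairprod_swap (f : C -> C -> C) (n i : nat) (u : nat -> C) (k : C) : (S i < n)%nat ->
  f (u (S i)) (u i) = k * f (u i) (u (S i)) -> pairprod f n (swap i u) = k * pairprod f n u.
Proof.
  intros Hi Hf. induction n as [|n IH]; [lia|].
  destruct (Nat.eq_dec n (S i)) as [->|Hne].
  - simpl. rewrite swap_l, swap_r, Hf.
    rewrite (pairprod_ext f i (swap i u) u) by (intros j Hj; apply swap_other; lia).
    rewrite (prodn_ext i (fun j => f (swap i u j) (u (S i))) (fun j => f (u j) (u (S i))))
      by (intros j Hj; rewrite swap_other by lia; reflexivity).
    rewrite (prodn_ext i (fun j => f (swap i u j) (u i)) (fun j => f (u j) (u i)))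
      by (intros j Hj; rewrite swap_other by lia; reflexivity).
    ring.
  - simpl. rewrite IH by lia. rewrite (swap_other i n) by lia.
    rewrite (prodn_swap_map n i (fun z => f z (u n))) by lia. ring.
Qed.

Lemma pairprod_head (f : C -> C -> C) (n : nat) (u : nat -> C) :
  pairprod f (S n) u = prodn n (fun j => f (u O) (u (S j))) * pairprod f n (fun j => u (S j)).
Proof.
  induction n as [|n IH]; [simpl; ring|].
  change (pairprod f (S (S n)) u) with (pairprod f (S n) u * prodn (S n) (fun i => f (u i) (u (S n)))).
  rewrite IH, prodn_head. simpl. ring.
Qed.

Lemma rot_S (n j : nat) (c : C) (u : nat -> C) : (S j < n)%nat -> rot n c u (S j) = u j.
Proof. intros H. unfold rot. destruct (Nat.ltb_spec (S j) n); [auto|lia]. Qed.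

(** The pairs formed with the new first variable [q u_n] correspond to the old pairs [(u_j, u_n)],
    read in the opposite order; the hypothesis on [f] identifies the two. *)
Lemma pairprod_rot (f : C -> C -> C) (q : C) (n : nat) (u : nat -> C) : nonzero_point u ->
  (forall a b : C, a <> 0 -> b <> 0 -> f (q * b) a = f a b) ->
  pairprod f (S n) (rot (S n) q u) = pairprod f (S n) u.
Proof.
  intros Hu Hf. rewrite pairprod_head.
  rewrite (pairprod_ext f n _ u) by (intros j Hj; apply rot_S; lia).
  simpl. rewrite Cmult_comm. f_equal.
  apply prodn_ext. intros j Hj. destruct (Nat.ltb_spec (S j) (S n)); [|lia].
  rewrite Nat.sub_0_r. apply Hf; apply Hu.
Qed.

Lemma pairprod_scale (f : C -> C -> C) (c : C) (n : nat) (u : nat -> C) : nonzero_point u ->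
  (forall a b : C, a <> 0 -> b <> 0 -> f (c * a) (c * b) = f a b) ->
  pairprod f n (scale c u) = pairprod f n u.
Proof.
  intros Hu Hf. induction n as [|n IH]; simpl; auto. rewrite IH. f_equal.
  apply prodn_ext. intros j _. apply Hf; apply Hu.
Qed.

Lemma unif_laurent_pairprod (f : C -> C -> C) (n k : nat) : (k <= n)%nat ->
  (forall i j, (i < j)%nat -> (j < n)%nat -> unif_laurent n (fun u => f (u i) (u j))) -> unif_laurent n
      (pairprod f k).
Proof.
  intros Hk H. induction k as [|k IH]; simpl; [apply unif_laurent_const|].
  apply unif_laurent_mult; [apply IH; lia|]. apply unif_laurent_prodn. intros i Hi. apply H; lia.
Qed.

(** * Brackets against an antisymmetric weight *)

Definition sym (i : nat) (g : (nat -> C) -> C) : Prop :=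
  forall u, nonzero_point u -> g (swap i u) = g u.

Lemma sym_mult (i : nat) (g h : (nat -> C) -> C) : sym i g -> sym i h -> sym i (fun u => g u * h u).
Proof. intros Hg Hh u Hu. rewrite Hg, Hh; auto. Qed.

Lemma sym_var (i j : nat) : j <> i -> j <> S i -> sym i (fun u => u j).
Proof. intros H1 H2 u _. apply swap_other; auto. Qed.

Lemma sym_const (i : nat) (c : C) : sym i (fun _ => c).
Proof. intros u _. reflexivity. Qed.

Lemma sym_prodn_below (i k : nat) (F : C -> C) : (k <= i)%nat ->
  sym i (fun u => prodn k (fun j => F (u j))).
Proof.
  intros Hk u _. apply prodn_ext. intros j Hj. rewrite swap_other; auto; lia.
Qed.

Definition var_run (a l : nat) (u : nat -> C) : C := prodn l (fun i => u (a + i)%nat).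

Lemma var_run_head (a l : nat) (u : nat -> C) : var_run a (S l) u = u a * var_run (S a) l u.
Proof.
  unfold var_run. rewrite prodn_head, Nat.add_0_r. f_equal.
  apply prodn_ext. intros i _. f_equal. lia.
Qed.

Lemma unif_laurent_var_run (n a l : nat) : (a + l <= n)%nat -> unif_laurent n (var_run a l).
Proof. intros H. unfold var_run. apply unif_laurent_prodn. intros i Hi. apply unif_laurent_var. lia. Qed.

(** Only a transposition across one of the two ends of the run can change it. *)
Lemma sym_var_run (i a l : nat) : S i <> a -> S i <> (a + l)%nat -> sym i (var_run a l).
Proof.
  intros H1 H2 u _. unfold var_run. destruct (Nat.ltb_spec i a) as [Hi|Hi].
  - apply prodn_ext. intros j Hj. apply swap_other; lia.
  - destruct (Nat.ltb_spec (S i) (a + l)) as [Hl|Hl].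
    + rewrite <- (prodn_swap l (i - a) (fun j => u (a + j)%nat)) by lia.
      apply prodn_ext. intros j Hj. unfold swap.
      destruct (Nat.eqb_spec (a + j) i); destruct (Nat.eqb_spec j (i - a)); try lia.
      { f_equal. lia. }
      destruct (Nat.eqb_spec (a + j) (S i)); destruct (Nat.eqb_spec j (S (i - a))); try lia.
      { f_equal. lia. }
      reflexivity.
    + apply prodn_ext. intros j Hj. apply swap_other; lia.
Qed.

Lemma self_opp_zero (z : C) : z = - z -> z = 0.
Proof.
  intros H. apply (Cmult_eq_reg_l (1 + 1)).
  - rewrite Cmult_plus_distr_r, Cmult_1_l. rewrite H at 2. ring.
  - rewrite <- RtoC_plus. intros E. apply RtoC_inj in E. lra.
Qed.

(** [kap] is [q^a] for the truncated weight [(z;q)_a (q/z;q)_oo] and [0] for the full theta function. *)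
Definition weight (n : nat) (q kap : C) (Phi : (nat -> C) -> C) : Prop :=
  unif_laurent n Phi /\
  (forall i, (S i < n)%nat -> forall u, nonzero_point u ->
     Phi (swap i u) = - (u (S i) * / u i) * Phi u) /\
  (forall u, nonzero_point u ->
     Phi (rot n q u) = - / u (n - 1)%nat * (1 - kap * u (n - 1)%nat) * Phi u).

Section Bracket.
Variables (n : nat) (q kap : C) (Phi : (nat -> C) -> C).
Hypothesis (Hn : (1 <= n)%nat) (Hq : q <> 0) (HW : weight n q kap Phi).

Definition brk (h : (nat -> C) -> C) : C := CT n (fun u => h u * Phi u).

Lemma unif_laurent_Phi : unif_laurent n Phi.
Proof. apply HW. Qed.

Lemma unif_laurent_hPhi (h : (nat -> C) -> C) : unif_laurent n h -> unif_laurent n (fun u => h u * Phi u).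
Proof. intros H. apply unif_laurent_mult; auto. apply unif_laurent_Phi. Qed.

Lemma brk_ext (g h : (nat -> C) -> C) : unif_laurent n g -> (forall u, nonzero_point u -> g u = h u) ->
    brk g = brk h.
Proof.
  intros Hg He. apply CT_ext; [apply unif_laurent_hPhi; auto|]. intros u Hu. rewrite He; auto.
Qed.

Lemma brk_plus (g h : (nat -> C) -> C) : unif_laurent n g -> unif_laurent n h ->
  brk (fun u => g u + h u) = brk g + brk h.
Proof.
  intros Hg Hh. unfold brk. rewrite <- CT_plus by (apply unif_laurent_hPhi; auto).
  f_equal. apply functional_extensionality. intros u. ring.
Qed.

Lemma brk_scal (c : C) (g : (nat -> C) -> C) : unif_laurent n g -> brk (fun u => c * g u) = c * brk g.
Proof.
  intros Hg. unfold brk. rewrite <- CT_scal by (apply unif_laurent_hPhi; auto).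
  f_equal. apply functional_extensionality. intros u. ring.
Qed.

Lemma brk_minus (g h : (nat -> C) -> C) : unif_laurent n g -> unif_laurent n h ->
  brk (fun u => g u - h u) = brk g - brk h.
Proof.
  intros Hg Hh. unfold Cminus at 2. replace (- brk h) with ((- 1) * brk h) by ring.
  rewrite <- brk_scal by auto. rewrite <- brk_plus; auto using unif_laurent_scal.
  f_equal. apply functional_extensionality. intros u. ring.
Qed.

Lemma brk_sumn (k : nat) (f : nat -> (nat -> C) -> C) : (forall i, (i < k)%nat -> unif_laurent n (f i)) ->
  brk (fun u => sumn k (fun i => f i u)) = sumn k (fun i => brk (f i)).
Proof.
  intros H. unfold brk. rewrite <- CT_sumn by (intros; apply unif_laurent_hPhi; auto).
  f_equal. apply functional_extensionality. intros u.
  rewrite Cmult_comm, <- sumn_scal. apply sumn_ext. intros; ring.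
Qed.

Lemma brk_swap (i : nat) (h : (nat -> C) -> C) : (S i < n)%nat -> unif_laurent n h ->
  brk (fun u => h (swap i u)) = - brk (fun u => h u * (u (S i) * / u i)).
Proof.
  intros Hi Hh. destruct HW as [HA [Hs _]].
  transitivity (CT n (fun u => h u * Phi (swap i u))).
  - rewrite <- (ct_map_CT n (swap i) (fun u => h u * Phi (swap i u))).
    + unfold brk. f_equal. apply functional_extensionality. intros u. rewrite swap_swap. reflexivity.
    + apply ct_map_swap; auto.
    + apply unif_laurent_mult; auto. apply unif_laurent_swap; auto.
  - replace (- brk (fun u => h u * (u (S i) * / u i)))
      with ((- 1) * brk (fun u => h u * (u (S i) * / u i))) by ring.
    rewrite <- brk_scal by al.
    apply CT_ext.
    + apply unif_laurent_mult; auto. apply unif_laurent_swap; auto.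
    + intros u Hu. rewrite Hs by auto. ring.
Qed.

(** [u_(i+1) Phi] is antisymmetric in [u_i, u_(i+1)]: the factor [- u_(i+1)/u_i] of [Phi] turns the
    exchanged variable [u_i] back into [u_(i+1)]. *)
Lemma brk_right_zero (i : nat) (g : (nat -> C) -> C) : (S i < n)%nat -> unif_laurent n g -> sym i g ->
  brk (fun u => u (S i) * g u) = 0.
Proof.
  intros Hi Hg Hs. apply self_opp_zero.
  transitivity (brk (fun u => (fun v => v i * g v) (swap i u))).
  - apply brk_ext; [al|]. intros u Hu. simpl. rewrite swap_l, Hs; auto.
  - rewrite (brk_swap i (fun v => v i * g v)) by (auto; al). f_equal.
    apply brk_ext; [al|]. intros u Hu. field. apply Hu.
Qed.

(** Here it is [Phi / u_i] that is antisymmetric in the two variables. *)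
Lemma brk_inv_left_zero (i : nat) (g : (nat -> C) -> C) : (S i < n)%nat -> unif_laurent n g -> sym i g ->
  brk (fun u => / u i * g u) = 0.
Proof.
  intros Hi Hg Hs. apply self_opp_zero.
  transitivity (brk (fun u => (fun v => / v (S i) * g v) (swap i u))).
  - apply brk_ext; [al|]. intros u Hu. simpl. rewrite swap_r, Hs; auto.
  - rewrite (brk_swap i (fun v => / v (S i) * g v)) by (auto; al). f_equal.
    apply brk_ext; [al|]. intros u Hu. field. split; apply Hu.
Qed.

(** The basic move: the power passes to the left neighbour, loses one unit and leaves [u_(i+1)]
    behind. *)
Lemma brk_pow_left (i : nat) (k : Z) (g : (nat -> C) -> C) : (S i < n)%nat -> unif_laurent n g -> sym i g ->
  brk (fun u => Cpowz (u (S i)) k * g u) = - brk (fun u => Cpowz (u i) (k - 1) * (u (S i) * g u)).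
Proof.
  intros Hi Hg Hs.
  transitivity (brk (fun u => (fun v => Cpowz (v i) k * g v) (swap i u))).
  - apply brk_ext; [al|]. intros u Hu. simpl. rewrite swap_l, Hs; auto.
  - rewrite (brk_swap i (fun v => Cpowz (v i) k * g v)) by (auto; al). f_equal.
    apply brk_ext; [al|]. intros u Hu.
    replace k with (k - 1 + 1)%Z at 1 by ring. rewrite Cpowz_succ by apply Hu. field. apply Hu.
Qed.

Lemma brk_rot (h : (nat -> C) -> C) : unif_laurent n h ->
  brk h = brk (fun u => h (rot n q u) * (- / u (n - 1)%nat * (1 - kap * u (n - 1)%nat))).
Proof.
  intros Hh. destruct HW as [HA [_ Hr]].
  assert (Hc : ct_map n (rot n q)).
  { destruct n as [|m]; [lia|]. apply ct_map_rot; auto. }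
  unfold brk at 1. rewrite <- (ct_map_CT n (rot n q)) by (auto; apply unif_laurent_hPhi; auto).
  apply CT_ext.
  - apply (ct_map_unif_laurent n _ (fun u => h u * Phi u)); auto. apply unif_laurent_hPhi; auto.
  - intros u Hu. rewrite Hr by auto. ring.
Qed.

(** Iterates [brk_pow_left]; the variables left behind accumulate in a run. Symmetry of [g] is
    needed exactly for the transpositions that are crossed. *)
Lemma brk_move (j i : nat) (k : Z) (g : (nat -> C) -> C) : (j < n)%nat -> (i <= j)%nat -> unif_laurent n g ->
  (forall t, (j - i <= t)%nat -> (t < j)%nat -> sym t g) ->
  brk (fun u => Cpowz (u j) k * g u) =
  Cpow (- 1) i * brk (fun u => Cpowz (u (j - i)%nat) (k - Z.of_nat i) * (var_run (S (j - i)) i u * g u)).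
Proof.
  intros Hj. revert g. induction i as [|i IH]; intros g Hi Hg Hs.
  - simpl Cpow. rewrite Cmult_1_l. apply brk_ext; [al|]. intros u Hu.
    rewrite Nat.sub_0_r, Z.sub_0_r. unfold var_run. simpl. ring.
  - rewrite IH by (auto; try lia; intros; apply Hs; lia).
    replace (j - i)%nat with (S (j - S i)) by lia.
    set (t := (j - S i)%nat).
    assert (Ha : unif_laurent n (fun u => var_run (S (S t)) i u * g u)).
    { apply unif_laurent_mult; auto. apply unif_laurent_var_run. unfold t. lia. }
    rewrite (brk_pow_left t (k - Z.of_nat i) (fun u => var_run (S (S t)) i u * g u)).
    + rewrite Cpow_S.
      rewrite (brk_ext (fun u => Cpowz (u t) (k - Z.of_nat i - 1) * (u (S t) * (var_run (S (S t)) i u * g u)))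
        (fun u => Cpowz (u t) (k - Z.of_nat (S i)) * (var_run (S t) (S i) u * g u))).
      * ring.
      * unfold t in *. al.
      * intros u Hu. rewrite var_run_head.
        replace (k - Z.of_nat (S i))%Z with (k - Z.of_nat i - 1)%Z by lia. ring.
    + unfold t. lia.
    + exact Ha.
    (* The run starts at [t + 2], just beyond the two variables that are exchanged. *)
    + apply sym_mult; [apply sym_var_run; lia|]. apply Hs; unfold t; lia.
Qed.

(** After [k - 1] moves the exponent is 1, and as [k <= j] there is still a left neighbour, so
    [brk_right_zero] applies. *)
Lemma brk_pow_zero (j k : nat) (g : (nat -> C) -> C) : (j < n)%nat -> (1 <= k <= j)%nat -> unif_laurent n g ->
  (forall t, (j - k <= t)%nat -> (t < j)%nat -> sym t g) ->
  brk (fun u => Cpowz (u j) (Z.of_nat k) * g u) = 0.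
Proof.
  intros Hj Hk Hg Hs.
  rewrite (brk_move j (k - 1)) by (auto; try lia; intros; apply Hs; lia).
  replace (Z.of_nat k - Z.of_nat (k - 1))%Z with 1%Z by lia.
  set (t := (j - k)%nat). replace (j - (k - 1))%nat with (S t) by (unfold t; lia).
  assert (Ha : unif_laurent n (fun u => var_run (S (S t)) (k - 1) u * g u)).
  { apply unif_laurent_mult; auto. apply unif_laurent_var_run. unfold t. lia. }
  rewrite (brk_ext _ (fun u => u (S t) * (var_run (S (S t)) (k - 1) u * g u))).
  - rewrite brk_right_zero.
    + ring.
    + unfold t. lia.
    + exact Ha.
    + apply sym_mult; [apply sym_var_run; lia|]. apply Hs; unfold t; lia.
  - apply unif_laurent_mult; auto. apply unif_laurent_powz. unfold t. lia.
  - intros u _. rewrite Cpowz_1. reflexivity.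
Qed.

Lemma var_run_rot (l : nat) (u : nat -> C) : (S l <= n)%nat ->
  var_run 0 (S l) (rot n q u) = q * u (n - 1)%nat * var_run 0 l u.
Proof.
  intros Hl. unfold var_run. rewrite prodn_head. simpl plus. f_equal.
  apply prodn_ext. intros i Hi. apply rot_S. lia.
Qed.

(** Rotation turns the run of length [l + 1] into [q u_(n-1)] times the run of length [l], and the
    factor [- 1/u_(n-1)] of the weight cancels [u_(n-1)]. The term with [kap] keeps it. *)
Lemma brk_var_run_step (l : nat) : (S l <= n)%nat ->
  brk (var_run 0 (S l)) = - q * brk (var_run 0 l) + q * kap * brk (fun u => u (n - 1)%nat * var_run 0 l u).
Proof.
  intros Hl. assert (Ha : unif_laurent n (var_run 0 l)) by (apply unif_laurent_var_run; lia).
  rewrite brk_rot by (apply unif_laurent_var_run; lia).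
  rewrite <- !brk_scal by al. rewrite <- brk_plus by al.
  symmetry. apply brk_ext; [al|]. intros u Hu. rewrite var_run_rot by auto. field. apply Hu.
Qed.

(** As long as the run stops before [u_(n-2)], it is symmetric in the last two variables and the
    term with [kap] vanishes. *)
Lemma brk_var_run (l : nat) : (l < n)%nat -> brk (var_run 0 l) = Cpow (- q) l * brk (fun _ => 1).
Proof.
  induction l as [|l IH]; intros Hl.
  - simpl. rewrite Cmult_1_l. reflexivity.
  - rewrite brk_var_run_step, IH by lia.
    replace (n - 1)%nat with (S (n - 2)) by lia.
    rewrite (brk_right_zero (n - 2) (var_run 0 l)).
    + rewrite Cpow_S. ring.
    + lia.
    + apply unif_laurent_var_run. lia.
    + apply sym_var_run; lia.
Qed.

(** At full length the term with [kap] no longer vanishes: it is the full run again. Solving for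
    this run produces the factor [1 - kap * q]. *)
Lemma brk_var_run_full : (1 - kap * q) * brk (var_run 0 n) = Cpow (- q) n * brk (fun _ => 1).
Proof.
  assert (E : S (n - 1) = n) by lia.
  assert (H := brk_var_run_step (n - 1) ltac:(lia)). rewrite E, (brk_var_run (n - 1)) in H by lia.
  rewrite (brk_ext (fun u => u (n - 1)%nat * var_run 0 (n - 1) u) (var_run 0 n)) in H.
  - replace ((1 - kap * q) * brk (var_run 0 n))
      with (brk (var_run 0 n) - q * kap * brk (var_run 0 n)) by ring.
    rewrite H at 1.
    replace (Cpow (- q) n) with (- q * Cpow (- q) (n - 1)) by (rewrite <- Cpow_S, E; reflexivity).
    ring.
  - apply unif_laurent_mult; [apply unif_laurent_var | apply unif_laurent_var_run]; lia.
  - intros u _. transitivity (var_run 0 (S (n - 1)) u); [unfold var_run; simpl; ring | rewrite E;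
      reflexivity].
Qed.

(** For [c = q^a] and [k = n] this is the quotient of the truncated weights for [a + 1] and [a]. *)
Definition lin (c : C) (k : nat) (u : nat -> C) : C := prodn k (fun i => 1 - c * u i).

Lemma unif_laurent_lin (c : C) (k : nat) : (k <= n)%nat -> unif_laurent n (lin c k).
Proof. intros H. unfold lin. al. Qed.

(** Of the factor next to the run, the summand 1 contributes zero, since the first variable of the
    run then meets a function symmetric in it and its left neighbour. The other summand lengthens
    the run by one to the left. *)
Lemma brk_var_run_lin (c : C) (j : nat) : forall l, (1 <= l)%nat -> (j + l <= n)%nat ->
  brk (fun u => var_run j l u * lin c j u) = Cpow (- c) j * brk (var_run 0 (j + l)).
Proof.
  induction j as [|j IH]; intros l Hl Hjl.
  - simpl. rewrite Cmult_1_l. apply brk_ext.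
    + apply unif_laurent_mult; [apply unif_laurent_var_run; lia | apply unif_laurent_lin; lia].
    + intros u _. unfold lin. simpl. ring.
  - assert (A1 : unif_laurent n (var_run (S j) l)) by (apply unif_laurent_var_run; lia).
    assert (A2 : unif_laurent n (lin c j)) by (apply unif_laurent_lin; lia).
    assert (A3 : unif_laurent n (var_run j (S l))) by (apply unif_laurent_var_run; lia).
    assert (A4 : unif_laurent n (var_run (S (S j)) (l - 1))) by (apply unif_laurent_var_run; lia).
    assert (A5 : unif_laurent n (lin c (S j))) by (apply unif_laurent_lin; lia).
    rewrite (brk_ext _ (fun u => var_run (S j) l u * lin c j u - c * (var_run j (S l) u * lin c j u))).
    + rewrite brk_minus, brk_scal by al.
      rewrite IH by lia. replace (j + S l)%nat with (S j + l)%nat by lia.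
      rewrite (brk_ext _ (fun u => u (S j) * (var_run (S (S j)) (l - 1) u * lin c j u))).
      * rewrite brk_right_zero.
        -- rewrite Cpow_S. ring.
        -- lia.
        -- al.
        -- apply sym_mult; [apply sym_var_run; lia|].
           apply (sym_prodn_below j j (fun z => 1 - c * z)). lia.
      * al.
      * intros u _. replace l with (S (l - 1)) at 1 by lia. rewrite var_run_head. ring.
    + al.
    + intros u _. rewrite var_run_head. unfold lin. simpl. ring.
Qed.

Lemma brk_lin (c : C) (k : nat) : (k <= n)%nat ->
  brk (lin c k) = sumn (S k) (fun i => Cpow (- c) i * brk (var_run 0 i)).
Proof.
  induction k as [|k IH]; intros Hk.
  - simpl. rewrite Cmult_1_l, Cplus_0_l. apply brk_ext; [apply unif_laurent_lin; lia|].
    intros u _. reflexivity.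
  - assert (A1 : unif_laurent n (lin c k)) by (apply unif_laurent_lin; lia).
    assert (A2 : unif_laurent n (var_run k 1)) by (apply unif_laurent_var_run; lia).
    rewrite (brk_ext _ (fun u => lin c k u - c * (var_run k 1 u * lin c k u))).
    + rewrite brk_minus, brk_scal by al. rewrite IH, brk_var_run_lin by lia.
      replace (k + 1)%nat with (S k) by lia.
      change (sumn (S (S k)) (fun i => Cpow (- c) i * brk (var_run 0 i)))
        with (sumn (S k) (fun i => Cpow (- c) i * brk (var_run 0 i)) + Cpow (- c) (S k) * brk (var_run 0
            (S k))).
      rewrite Cpow_S. ring.
    + apply unif_laurent_lin; lia.
    + intros u _. unfold lin, var_run. simpl. rewrite Nat.add_0_r. ring.
Qed.

Lemma geom_identity (z : C) (m : nat) :
  (1 - z) * sumn m (Cpow z) + Cpow z m = 1.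
Proof.
  induction m as [|m IH]; simpl; [ring|]. rewrite <- IH at 2. ring.
Qed.

(* Expanding the product, only the terms [u_0 ... u_(k-1)] have a nonzero bracket. *)
Lemma brk_lin_full : (1 - kap * q) * brk (lin kap n) = brk (fun _ => 1).
Proof.
  rewrite brk_lin by lia. simpl.
  rewrite (sumn_ext n _ (fun i => brk (fun _ => 1) * Cpow (kap * q) i)).
  - rewrite sumn_scal.
    replace ((1 - kap * q) * (brk (fun _ => 1) * sumn n (Cpow (kap * q)) + Cpow (- kap) n * brk (var_run
        0 n)))
      with ((1 - kap * q) * sumn n (Cpow (kap * q)) * brk (fun _ => 1)
            + Cpow (- kap) n * ((1 - kap * q) * brk (var_run 0 n))) by ring.
    rewrite brk_var_run_full.
    replace (Cpow (- kap) n * (Cpow (- q) n * brk (fun _ => 1)))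
      with (Cpow (kap * q) n * brk (fun _ => 1)).
    + rewrite <- Cmult_plus_distr_r, geom_identity. ring.
    + rewrite Cmult_assoc, <- Cpow_mult_l. f_equal. f_equal. ring.
  - intros i Hi. rewrite brk_var_run by auto. rewrite Cmult_assoc, <- Cpow_mult_l.
    rewrite Cmult_comm. f_equal. f_equal. ring.
Qed.

(** A Vandermonde factor normalised to degree zero; [(a/b;q)_oo (b/a;q)_oo] is [theta q (a/b)] times
    this. *)
Definition vand_pair (a b : C) : C := 1 - b * / a.

(** Expanding from the last factor, each term with [1/u_k] vanishes by [brk_inv_left_zero]. The
    factor with [i = m - 1] is excluded, because its transposition would also move [u_m]. *)
Lemma brk_vand_drop (m k : nat) (F : (nat -> C) -> C) : (k < m)%nat -> (m < n)%nat -> unif_laurent n F ->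
  (forall i, (i < m)%nat -> sym i F) ->
  brk (fun u => prodn k (fun i => vand_pair (u i) (u m)) * F u) = brk F.
Proof.
  intros Hk Hm HF Hs. unfold vand_pair. induction k as [|k IH].
  - simpl. apply brk_ext; [al|]. intros; ring.
  - rewrite <- IH by lia. simpl.
    rewrite (brk_ext _ (fun u => prodn k (fun i => 1 - u m * / u i) * F u
       - / u k * (prodn k (fun i => 1 - u m * / u i) * (u m * F u)))).
    + rewrite brk_minus by al. rewrite brk_inv_left_zero.
      * ring.
      * lia.
      * al.
      * apply sym_mult; [|apply sym_mult; [apply sym_var; lia | apply Hs; lia]].
        intros u Hu. apply prodn_ext. intros i Hi. rewrite !swap_other by lia. reflexivity.
    + al.
    + intros u _. ring.
Qed.

Lemma brk_vand_col (m : nat) : forall F, (m < n)%nat -> unif_laurent n F ->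
  (forall i, (i < m)%nat -> sym i F) ->
  brk (fun u => prodn m (fun i => vand_pair (u i) (u m)) * F u) = INR (S m) * brk F.
Proof.
  induction m as [|m IH]; intros F Hm HF Hs.
  - simpl. rewrite Cmult_1_l. apply brk_ext; [al|]. intros; ring.
  - pose (T := fun u => prodn m (fun i => vand_pair (u i) (u (S m))) * F u).
    assert (HT : unif_laurent n T) by (unfold T, vand_pair; al).
    rewrite (brk_ext _ (fun u => T u - T u * (u (S m) * / u m))).
    + rewrite brk_minus by al.
      unfold Cminus. rewrite <- (brk_swap m T) by auto.
      unfold T at 1. rewrite brk_vand_drop by (auto; lia).
      rewrite (brk_ext (fun u => T (swap m u)) (fun u => prodn m (fun i => vand_pair (u i) (u m)) * F u)).
      * rewrite IH by (auto; lia). rewrite (S_INR (S m)), RtoC_plus. ring.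
      * apply unif_laurent_swap; auto.
      * intros u Hu. unfold T. rewrite swap_r. f_equal.
        -- apply prodn_ext. intros i Hi. rewrite swap_other by lia. reflexivity.
        -- apply Hs; auto.
    + unfold vand_pair. al.
    + intros u _. unfold T. simpl. unfold vand_pair. ring.
Qed.

(** The last column is symmetric in the earlier variables, so it can be absorbed into [F] while the
    smaller Vandermonde product is evaluated. The columns contribute [1, 2, ..., m]. *)
Lemma brk_vand (m : nat) : forall F, (m <= n)%nat -> unif_laurent n F ->
  (forall i, (S i < m)%nat -> sym i F) ->
  brk (fun u => pairprod vand_pair m u * F u) = INR (fact m) * brk F.
Proof.
  induction m as [|m IH]; intros F Hm HF Hs.
  - simpl. rewrite Cmult_1_l. apply brk_ext; [al|]. intros; ring.
  - assert (Hp : forall k, (k <= n)%nat -> unif_laurent n (pairprod vand_pair k)).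
    { intros k Hk. apply unif_laurent_pairprod; auto. intros i j Hi Hj. unfold vand_pair. al. }
    assert (Hp' := Hp m ltac:(lia)).
    rewrite (brk_ext _ (fun u => pairprod vand_pair m u * (prodn m (fun i => vand_pair (u i) (u m)) * F u))).
    + rewrite IH.
      * rewrite brk_vand_col by (auto; intros; apply Hs; lia).
        rewrite fact_simpl, mult_INR, RtoC_mult. ring.
      * lia.
      * unfold vand_pair. al.
      * intros i Hi. apply sym_mult; [|apply Hs; lia].
        intros u Hu. rewrite (swap_other i m) by lia.
        apply (prodn_swap_map m i (fun z => vand_pair z (u m))). auto.
    + apply unif_laurent_mult; auto.
    + intros u _. simpl. ring.
Qed.

End Bracket.

(** * Weights built from theta functions *)

Definition theta_pair (q a b : C) : C := theta q (a * / b).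

Lemma laurent_inv_scal (n i : nat) (c : C) : (i < n)%nat -> laurent n (fun u => c * / u i).
Proof. intros Hi. apply (laurent_scal n c (fun u => / u i)), laurent_inv, Hi. Qed.

Lemma unif_laurent_theta_pair (n i j : nat) (q : C) : Cmod q < 1 -> (i < n)%nat -> (j < n)%nat ->
  unif_laurent n (fun u => theta_pair q (u i) (u j)).
Proof.
  intros Hq Hi Hj. unfold theta_pair, theta. apply unif_laurent_mult; apply unif_laurent_qpoch; auto.
  - apply laurent_mult; [apply laurent_var | apply laurent_inv]; auto.
  - eapply laurent_ext; [apply (laurent_scal n q), (laurent_mult n (fun u => u j) (fun u => / u i));
      [apply laurent_var | apply laurent_inv]; auto|].
    intros u Hu. simpl. field. split; apply Hu.
Qed.

Lemma unif_laurent_theta (n i : nat) (q c : C) : Cmod q < 1 -> c <> 0 -> (i < n)%nat ->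
  unif_laurent n (fun u => theta q (c * u i)).
Proof.
  intros Hq Hc Hi. unfold theta. apply unif_laurent_mult; apply unif_laurent_qpoch; auto.
  - apply (laurent_scal n c (fun u => u i)), laurent_var; auto.
  - eapply laurent_ext; [apply (laurent_inv_scal n i (q * / c)); auto|].
    intros u Hu. simpl. field. split; auto.
Qed.

Lemma unif_laurent_pairprod_theta_pair (n k : nat) (q : C) : Cmod q < 1 -> (k <= n)%nat -> unif_laurent
    n (pairprod (theta_pair q) k).
Proof. intros Hq Hk. apply unif_laurent_pairprod; auto. intros i j Hi Hj. apply unif_laurent_theta_pair;
    auto. lia. Qed.

Lemma unif_laurent_pairprod_vand_pair (n k : nat) : (k <= n)%nat -> unif_laurent n (pairprod vand_pair k).
Proof. intros Hk. apply unif_laurent_pairprod; auto. intros i j Hi Hj. unfold vand_pair. al. Qed.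

Lemma theta_pair_scale (q c a b : C) : c <> 0 -> a <> 0 -> b <> 0 -> theta_pair q (c * a) (c * b) =
    theta_pair q a b.
Proof. intros Hc Ha Hb. unfold theta_pair. f_equal. field. auto. Qed.

Lemma vand_pair_scale (c a b : C) : c <> 0 -> a <> 0 -> b <> 0 -> vand_pair (c * a) (c * b) = vand_pair a b.
Proof. intros Hc Ha Hb. unfold vand_pair. field. auto. Qed.

Definition theta_weight (q : C) (w : C -> C) (n : nat) (u : nat -> C) : C :=
  pairprod (theta_pair q) n u * prodn n (fun i => w (u i)).

(** The transposition law comes from [theta (1/z) = - theta z / z]. Under rotation
    [theta (q/z) = theta z] keeps the pair product fixed, so only the single factor [w (q u_(n-1))]
    changes. *)
Lemma weight_theta_weight (n : nat) (q kap : C) (w : C -> C) : (1 <= n)%nat -> Cmod q < 1 -> q <> 0 ->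
  (forall i, (i < n)%nat -> unif_laurent n (fun u => w (u i))) ->
  (forall z : C, z <> 0 -> w (q * z) = - / z * (1 - kap * z) * w z) ->
  weight n q kap (theta_weight q w n).
Proof.
  intros Hn Hq Hq0 Hw Hs. unfold theta_weight. split; [|split].
  - apply unif_laurent_mult; [apply unif_laurent_pairprod_theta_pair; auto | apply unif_laurent_prodn; auto].
  - intros i Hi u Hu. rewrite prodn_swap_map by auto.
    rewrite (pairprod_swap _ n i u (- (u (S i) * / u i))); auto; [ring|].
    unfold theta_pair. replace (u (S i) * / u i) with (/ (u i * / u (S i))) by (field; auto).
    apply theta_inv; auto. apply Cmult_neq_0; auto. apply nonzero_inv; auto.
  - intros u Hu. destruct n as [|m]; [lia|].
    rewrite pairprod_rot; auto.
    + rewrite prodn_head.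
      rewrite (prodn_ext m (fun i => w (rot (S m) q u (S i))) (fun i => w (u i)))
        by (intros i Hi; rewrite rot_S by lia; reflexivity).
      simpl prodn. unfold rot. rewrite Hs by auto.
      replace (S m - 1)%nat with m by lia. ring.
    + intros a b Ha Hb. unfold theta_pair.
      replace (q * b * / a) with (q * / (a * / b)) by (field; auto).
      apply theta_q_inv; auto. apply Cmult_neq_0; auto. apply nonzero_inv; auto.
Qed.

Definition trunc_theta (q : C) (a : nat) (z : C) : C := poch a z q * qpoch (q * / z) q.

Lemma trunc_theta_shift (q : C) (a : nat) (z : C) : Cmod q < 1 -> q <> 0 -> z <> 0 ->
  trunc_theta q a (q * z) = - / z * (1 - Cpow q a * z) * trunc_theta q a z.
Proof.
  intros Hq Hq0 Hz. unfold trunc_theta.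
  replace (q * / (q * z)) with (/ z) by (field; auto).
  rewrite (qpoch_step (/ z)) by auto. replace (/ z * q) with (q * / z) by ring.
  assert (H : (1 - z) * poch a (q * z) q = poch a z q * (1 - z * Cpow q a)).
  { rewrite (Cmult_comm q z), <- poch_head. reflexivity. }
  replace (poch a (q * z) q * ((1 - / z) * qpoch (q * / z) q))
    with (- / z * ((1 - z) * poch a (q * z) q) * qpoch (q * / z) q) by (field; auto).
  rewrite H. ring.
Qed.

Lemma unif_laurent_trunc_theta (n i a : nat) (q : C) : Cmod q < 1 -> (i < n)%nat -> unif_laurent n (fun
    u => trunc_theta q a (u i)).
Proof.
  intros Hq Hi. unfold trunc_theta. apply unif_laurent_mult.
  - apply unif_laurent_laurent, laurent_poch, laurent_var; auto.
  - apply unif_laurent_qpoch; auto. apply laurent_inv_scal; auto.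
Qed.

Lemma weight_trunc_theta (n a : nat) (q : C) : (1 <= n)%nat -> Cmod q < 1 -> q <> 0 ->
  weight n q (Cpow q a) (theta_weight q (trunc_theta q a) n).
Proof.
  intros Hn Hq Hq0. apply weight_theta_weight; auto.
  - intros i Hi. apply unif_laurent_trunc_theta; auto.
  - intros z Hz. apply trunc_theta_shift; auto.
Qed.

Lemma unif_laurent_theta_var (n i : nat) (q : C) : Cmod q < 1 -> (i < n)%nat -> unif_laurent n (fun u =>
    theta q (u i)).
Proof.
  intros Hq Hi. apply (unif_laurent_ext n (fun u => theta q (1 * u i))).
  - apply unif_laurent_theta; auto. apply C1_nz.
  - intros u _. rewrite Cmult_1_l. reflexivity.
Qed.

Lemma weight_theta_fun (n : nat) (q : C) : (1 <= n)%nat -> Cmod q < 1 -> q <> 0 ->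
  weight n q 0 (theta_weight q (theta q) n).
Proof.
  intros Hn Hq Hq0. apply weight_theta_weight; auto.
  - intros i Hi. apply unif_laurent_theta_var; auto.
  - intros z Hz. rewrite theta_shift by auto. ring.
Qed.

(** * Uniform convergence on the torus *)

Lemma tint_const (n : nat) (c : C) : is_tint n (fun _ => c) c.
Proof.
  induction n as [|n IH]; simpl; [reflexivity|].
  exists (fun _ => c). split; [intros _; exact IH | apply is_circ_const].
Qed.

Lemma CT_const (n : nat) (c : C) : CT n (fun _ => c) = c.
Proof. apply (CT_eq n (fun _ => c)), tint_const. Qed.

Definition torus_cv (g : nat -> (nat -> C) -> C) (h : (nat -> C) -> C) : Prop :=
  forall eps, 0 < eps -> exists K, forall k u, (K <= k)%nat -> on_torus u ->
    Cmod (g k u - h u) <= eps.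

Lemma torus_cv_const (h : (nat -> C) -> C) : torus_cv (fun _ => h) h.
Proof.
  intros eps Heps. exists O. intros k u _ _. replace (h u - h u) with (RtoC 0) by ring.
  rewrite Cmod_0. lra.
Qed.

Lemma unif_laurent_torus_bound (n : nat) (h : (nat -> C) -> C) : unif_laurent n h ->
  exists B, 0 <= B /\ forall u, on_torus u -> Cmod (h u) <= B.
Proof.
  intros H. destruct (unif_laurent_bound n 1%R h ltac:(lra) H) as [B [HB Hb]].
  exists B. split; auto. intros u Hu. apply Hb, in_annulus_torus; auto. lra.
Qed.

Lemma torus_cv_mult (n : nat) (g g' : nat -> (nat -> C) -> C) (h h' : (nat -> C) -> C) :
  unif_laurent n h -> unif_laurent n h' -> torus_cv g h -> torus_cv g' h' ->
  torus_cv (fun k u => g k u * g' k u) (fun u => h u * h' u).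
Proof.
  intros Hh Hh' Hg Hg' eps Heps.
  destruct (unif_laurent_torus_bound n h Hh) as [B [HB Hb]].
  destruct (unif_laurent_torus_bound n h' Hh') as [B' [HB' Hb']].
  destruct (Hg (eps / (2 * (B' + 1)))%R) as [K HK]; [apply Rdiv_lt_0_compat; lra|].
  (* The minimum with 1 keeps [g'] below [B' + 1], the constant already used in the accuracy for
     [g]. *)
  destruct (Hg' (Rmin 1 (eps / (2 * (B + 1))))%R) as [K' HK'].
  { apply Rmin_pos; [lra|]. apply Rdiv_lt_0_compat; lra. }
  exists (K + K')%nat. intros k u Hk Hu.
  specialize (HK k u ltac:(lia) Hu). specialize (HK' k u ltac:(lia) Hu).
  specialize (Hb u Hu). specialize (Hb' u Hu).
  assert (H1 := Rmin_l 1 (eps / (2 * (B + 1)))). assert (H2 := Rmin_r 1 (eps / (2 * (B + 1)))).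
  assert (Hg1 : Cmod (g' k u) <= B' + 1).
  { replace (g' k u) with ((g' k u - h' u) + h' u) by ring.
    eapply Rle_trans; [apply Cmod_triangle|]. lra. }
  replace (g k u * g' k u - h u * h' u)
    with ((g k u - h u) * g' k u + h u * (g' k u - h' u)) by ring.
  eapply Rle_trans; [apply Cmod_triangle|]. rewrite !Cmod_mult.
  assert (E1 : Cmod (g k u - h u) * Cmod (g' k u) <= eps / (2 * (B' + 1)) * (B' + 1)).
  { apply Rmult_le_compat; auto using Cmod_ge_0. }
  assert (E2 : Cmod (h u) * Cmod (g' k u - h' u) <= (B + 1) * (eps / (2 * (B + 1)))).
  { apply Rmult_le_compat; auto using Cmod_ge_0; lra. }
  replace (eps / (2 * (B' + 1)) * (B' + 1))%R with (eps / 2)%R in E1 by (field; lra).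
  replace ((B + 1) * (eps / (2 * (B + 1))))%R with (eps / 2)%R in E2 by (field; lra). lra.
Qed.

Lemma torus_cv_prodn (n k : nat) (g : nat -> nat -> (nat -> C) -> C) (h : nat -> (nat -> C) -> C) :
  (forall i, (i < k)%nat -> unif_laurent n (h i)) -> (forall i, (i < k)%nat -> torus_cv (g i) (h i)) ->
  torus_cv (fun a u => prodn k (fun i => g i a u)) (fun u => prodn k (fun i => h i u)).
Proof.
  induction k as [|k IH]; intros Hh Hg; simpl; [apply torus_cv_const|].
  apply (torus_cv_mult n (fun a u => prodn k (fun i => g i a u)) (g k) (fun u => prodn k (fun i => h i
      u)) (h k)); auto.
  apply unif_laurent_prodn; auto.
Qed.

Lemma Ccv_mult (u v : nat -> C) (a b : C) : Ccv u a -> Ccv v b -> Ccv (fun n => u n * v n) (a * b).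
Proof.
  intros Hu Hv eps Heps.
  pose proof (Cmod_ge_0 a) as Ha. pose proof (Cmod_ge_0 b) as Hb.
  destruct (Hu (eps / (2 * (Cmod b + 1)))%R) as [K HK]; [apply Rdiv_lt_0_compat; lra|].
  destruct (Hv (Rmin 1 (eps / (2 * (Cmod a + 1))))%R) as [K' HK'].
  { apply Rmin_pos; [lra|]. apply Rdiv_lt_0_compat; lra. }
  exists (K + K')%nat. intros k Hk.
  specialize (HK k ltac:(lia)). specialize (HK' k ltac:(lia)).
  assert (H1 := Rmin_l 1 (eps / (2 * (Cmod a + 1)))). assert (H2 := Rmin_r 1 (eps / (2 * (Cmod a + 1)))).
  assert (Hg1 : Cmod (v k) <= Cmod b + 1).
  { replace (v k) with ((v k - b) + b) by ring.
    eapply Rle_trans; [apply Cmod_triangle|]. lra. }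
  replace (u k * v k - a * b) with ((u k - a) * v k + a * (v k - b)) by ring.
  eapply Rle_lt_trans; [apply Cmod_triangle|]. rewrite !Cmod_mult.
  assert (E1 : Cmod (u k - a) * Cmod (v k) <= Cmod (u k - a) * (Cmod b + 1)).
  { apply Rmult_le_compat_l; auto using Cmod_ge_0. }
  assert (E1' : Cmod (u k - a) * (Cmod b + 1) < eps / (2 * (Cmod b + 1)) * (Cmod b + 1)).
  { apply Rmult_lt_compat_r; lra. }
  assert (E2 : Cmod a * Cmod (v k - b) <= (Cmod a + 1) * (eps / (2 * (Cmod a + 1)))).
  { apply Rmult_le_compat; auto using Cmod_ge_0; lra. }
  replace (eps / (2 * (Cmod b + 1)) * (Cmod b + 1))%R with (eps / 2)%R in E1' by (field; lra).
  replace ((Cmod a + 1) * (eps / (2 * (Cmod a + 1))))%R with (eps / 2)%R in E2 by (field; lra). lra.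
Qed.

Lemma Ccv_const (c : C) : Ccv (fun _ => c) c.
Proof.
  intros eps Heps. exists O. intros k _. replace (c - c) with (RtoC 0) by ring.
  rewrite Cmod_0. auto.
Qed.

(** * The normalization and the power sums *)

Section Normalization.
Variables (q : C).
Hypothesis (Hq : Cmod q < 1) (Hq0 : q <> 0).

Definition pair_ct (n : nat) : C := CT n (pairprod (theta_pair q) n).
Definition trunc_ct (n a : nat) : C := CT n (theta_weight q (trunc_theta q a) n).

Lemma trunc_ct_step (n a : nat) : (1 <= n)%nat -> (1 - Cpow q (S a)) * trunc_ct n (S a) = trunc_ct n a.
Proof.
  intros Hn. assert (HW := weight_trunc_theta n a q Hn Hq Hq0).
  assert (H := brk_lin_full n q (Cpow q a) _ Hn Hq0 HW).
  replace (1 - Cpow q a * q) with (1 - Cpow q (S a)) in H by (simpl; ring).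
  unfold brk in H.
  replace (trunc_ct n (S a)) with (CT n (fun u => lin (Cpow q a) n u * theta_weight q (trunc_theta q a) n u)).
  - rewrite H. unfold trunc_ct. f_equal. apply functional_extensionality. intros u. ring.
  - unfold trunc_ct. f_equal. apply functional_extensionality. intros u. unfold lin, theta_weight.
    rewrite Cmult_comm, <- Cmult_assoc, <- prodn_mult. f_equal.
    apply prodn_ext. intros i _. unfold trunc_theta. simpl. ring.
Qed.

Lemma trunc_ct_poch (n a : nat) : (1 <= n)%nat -> trunc_ct n a * poch a q q = trunc_ct n 0.
Proof.
  intros Hn. induction a as [|a IH]; [simpl; ring|].
  rewrite <- IH, <- (trunc_ct_step n a Hn). simpl. ring.
Qed.

(* Rescaling [u] by [q^(-M)] leaves the constant term unchanged, while [(q/u_i;q)_oo] becomes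
   [(q^(M+1)/u_i;q)_oo], which tends to 1. *)
Lemma trunc_ct_zero (n : nat) : trunc_ct n 0 = pair_ct n.
Proof.
  pose (g := fun M u => theta_weight q (trunc_theta q 0) n (scale (/ Cpow q M) u)).
  assert (Hc : forall M, / Cpow q M <> 0) by (intros; apply nonzero_inv, Cpow_nz; auto).
  assert (HA : unif_laurent n (theta_weight q (trunc_theta q 0) n)).
  { unfold theta_weight. apply unif_laurent_mult; [apply unif_laurent_pairprod_theta_pair; auto|].
    apply unif_laurent_prodn. intros i Hi. apply unif_laurent_trunc_theta; auto. }
  apply (Ccv_unique (fun _ => trunc_ct n 0)); [apply Ccv_const|].
  apply (Ccv_ext (fun M => CT n (g M))).
  { intros M. unfold g. apply (ct_map_CT n (scale (/ Cpow q M))); auto.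
    apply ct_map_scale; auto. }
  apply CT_lim.
  { intros M. apply (ct_map_unif_laurent n _ _ (ct_map_scale n _ (Hc M)) HA). }
  change (torus_cv g (pairprod (theta_pair q) n)).
  assert (Hu : torus_cv (fun M u => pairprod (theta_pair q) n u * prodn n (fun i => qpoch (Cpow q (S M)
      * / u i) q))
                 (fun u => pairprod (theta_pair q) n u * prodn n (fun _ => 1))).
  { apply (torus_cv_mult n (fun _ => pairprod (theta_pair q) n)
      (fun M u => prodn n (fun i => qpoch (Cpow q (S M) * / u i) q))).
    - apply unif_laurent_pairprod_theta_pair; auto.
    - al.
    - apply torus_cv_const.
    - apply (torus_cv_prodn n n (fun i M u => qpoch (Cpow q (S M) * / u i) q) (fun _ _ => 1)).
      + intros; apply unif_laurent_const.
      + intros i Hi eps Heps.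
        assert (Hrho : 0 <= Cmod q < 1) by (split; auto using Cmod_ge_0).
        assert (0 < / (1 - Cmod q)) by (apply Rinv_0_lt_compat; lra).
        assert (0 < pbound 1 (Cmod q)) by apply exp_pos.
        destruct (pow_small (Cmod q) (pbound 1 (Cmod q) / (1 - Cmod q)) eps) as [K HK]; auto.
        { apply Rmult_le_pos; lra. }
        exists K. intros M u HM Hu'.
        assert (Hm : Cmod (Cpow q (S M) * / u i) = (Cmod q ^ S M)%R).
        { rewrite Cmod_mult, Cmod_pow, Cmod_inv, Hu' by (apply nonzero_point_torus; auto). field. }
        assert (Hle : Cmod q ^ S M <= 1).
        { rewrite <- (pow1 (S M)). apply pow_incr. lra. }
        assert (Hge : 0 <= Cmod q ^ S M) by (apply pow_le; lra).
        assert (Ht := Cmod_qpoch_tail (Cpow q (S M) * / u i) q (Cmod q ^ S M) ltac:(lra) Hq 0).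
        simpl poch in Ht. rewrite pow_O, Rmult_1_r in Ht.
        eapply Rle_trans; [exact Ht|].
        apply Rle_trans with (pbound 1 (Cmod q) / (1 - Cmod q) * Cmod q ^ S M)%R.
        * unfold Rdiv. replace (pbound 1 (Cmod q) * / (1 - Cmod q) * Cmod q ^ S M)%R
            with (pbound 1 (Cmod q) * Cmod q ^ S M * / (1 - Cmod q))%R by ring.
          apply Rmult_le_compat_r; [lra|]. apply Rmult_le_compat_r; auto.
          unfold pbound.
          assert (Hd : Cmod q ^ S M / (1 - Cmod q) <= 1 / (1 - Cmod q)).
          { apply Rmult_le_compat_r; lra. }
          destruct Hd as [Hd|Hd]; [left; apply exp_increasing; auto | rewrite Hd; lra].
        * left. apply HK. lia. }
  intros eps Heps. destruct (Hu eps Heps) as [K HK]. exists K. intros M u HM Hu'.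
  specialize (HK M u HM Hu'). rewrite prodn_const, Cpow_1_l, Cmult_1_r in HK.
  unfold g, theta_weight. rewrite pairprod_scale; [|apply nonzero_point_torus; auto|].
  - rewrite (prodn_ext n _ (fun i => qpoch (Cpow q (S M) * / u i) q)); [exact HK|].
    intros i Hi. unfold trunc_theta, scale. simpl poch. rewrite Cmult_1_l. f_equal.
    rewrite Cpow_S. field. split; [apply nonzero_point_torus; auto | apply Cpow_nz; auto].
  - intros a b Ha Hb. apply theta_pair_scale; auto.
Qed.

(** The product [trunc_ct n a * poch a q q] does not depend on [a]; its values at [a = 0] and in the
    limit are compared. *)
Lemma theta_pair_ct (n : nat) : (1 <= n)%nat -> CT n (theta_weight q (theta q) n) * qpoch q q = pair_ct n.
Proof.
  intros Hn. rewrite <- trunc_ct_zero. symmetry.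
  apply (Ccv_unique (fun a => trunc_ct n a * poch a q q)).
  { apply (Ccv_ext (fun _ => trunc_ct n 0)); [|apply Ccv_const]. intros a. rewrite trunc_ct_poch; auto. }
  apply Ccv_mult; [|apply qpoch_cv; auto].
  unfold trunc_ct. apply (CT_lim n (fun a => theta_weight q (trunc_theta q a) n)).
  { intros a. apply (weight_trunc_theta n a q Hn Hq Hq0). }
  change (torus_cv (fun a => theta_weight q (trunc_theta q a) n) (theta_weight q (theta q) n)). unfold
      theta_weight.
  apply (torus_cv_mult n (fun _ => pairprod (theta_pair q) n) (fun a u => prodn n (fun i => trunc_theta
      q a (u i)))
    (pairprod (theta_pair q) n) (fun u => prodn n (fun i => theta q (u i)))).
  - apply unif_laurent_pairprod_theta_pair; auto.
  - apply unif_laurent_prodn. intros i Hi. apply unif_laurent_theta_var; auto.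
  - apply torus_cv_const.
  - apply (torus_cv_prodn n n (fun i a u => trunc_theta q a (u i)) (fun i u => theta q (u i))).
    { intros i Hi. apply unif_laurent_theta_var; auto. }
    intros i Hi. unfold trunc_theta, theta.
    apply (torus_cv_mult n (fun a u => poch a (u i) q) (fun _ u => qpoch (q * / u i) q)
      (fun u => qpoch (u i) q)).
    + apply unif_laurent_qpoch; auto. apply laurent_var; auto.
    + apply unif_laurent_qpoch; auto. apply laurent_inv_scal; auto.
    + intros eps Heps.
      destruct (pow_small (Cmod q) (pbound 1 (Cmod q) * 1 / (1 - Cmod q)) eps) as [K HK]; auto.
      { split; auto using Cmod_ge_0. }
      { apply Rmult_le_pos.
        - rewrite Rmult_1_r. left. apply exp_pos.
        - left. apply Rinv_0_lt_compat. lra. }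
      exists K. intros a u Ha Hu.
      replace (poch a (u i) q - qpoch (u i) q) with (- (qpoch (u i) q - poch a (u i) q)) by ring.
      rewrite Cmod_opp. eapply Rle_trans; [apply (Cmod_qpoch_tail (u i) q 1); auto|].
      * rewrite Hu. lra.
      * left. apply HK; auto.
    + apply torus_cv_const.
Qed.

(** The pair product has degree zero, so its first variable may be set to 1. Its pairs then give
    [theta (1/u_j)], and the rescaling by [1/q] makes this [theta (q/u_j) = theta (u_j)]. *)
Lemma pair_ct_S (n : nat) : pair_ct (S n) = CT n (theta_weight q (theta q) n).
Proof.
  unfold pair_ct. rewrite CT_dehomogenize.
  - assert (Hi : / q <> 0) by (apply nonzero_inv; auto).
    assert (HA : unif_laurent n (fun u => pairprod (theta_pair q) (S n) (scons 1 u))).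
    { apply unif_laurent_scons_one, unif_laurent_pairprod_theta_pair; auto. }
    rewrite <- (ct_map_CT n (scale (/ q)) _ (ct_map_scale n _ Hi) HA).
    apply CT_ext.
    + apply (ct_map_unif_laurent n _ _ (ct_map_scale n _ Hi) HA).
    + intros u Hu. rewrite pairprod_head. unfold theta_weight. simpl scons.
      change (pairprod (theta_pair q) n (fun j => scons 1 (scale (/ q) u) (S j)))
        with (pairprod (theta_pair q) n (scale (/ q) u)).
      rewrite pairprod_scale; auto.
      * rewrite Cmult_comm. f_equal. apply prodn_ext. intros i Hi'.
        unfold theta_pair, scale. replace (1 * / (/ q * u i)) with (q * / u i) by (field; auto).
        apply theta_q_inv; auto.
      * intros a b Ha Hb. apply theta_pair_scale; auto.
  - apply unif_laurent_pairprod_theta_pair; auto.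
  - intros c u Hc Hu. apply pairprod_scale; auto. intros a b Ha Hb. apply theta_pair_scale; auto.
Qed.

(** [pair_ct_S] and [theta_pair_ct] alternate down to the empty pair product in one variable. The
    form without division also yields that [(q;q)_oo] is nonzero. *)
Lemma theta_CT (n : nat) : (1 <= n)%nat ->
  CT n (theta_weight q (theta q) n) * Cpow (qpoch q q) n = 1.
Proof.
  intros Hn. destruct n as [|n]; [lia|]. clear Hn.
  assert (HK : pair_ct (S n) * Cpow (qpoch q q) n = 1).
  { induction n as [|n IH].
    - unfold pair_ct. simpl. rewrite Cmult_1_r.
      transitivity (CT 1 (fun _ => 1)); [|apply CT_const]. f_equal.
      apply functional_extensionality. intros u. ring.
    - rewrite pair_ct_S, Cpow_S, Cmult_assoc, theta_pair_ct by lia. exact IH. }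
  rewrite Cpow_S, Cmult_assoc, theta_pair_ct by lia. exact HK.
Qed.

End Normalization.

(** * Brackets of powers of a single variable *)

Section Powers.
Variables (n : nat) (q : C).
Hypothesis (Hn : (1 <= n)%nat) (Hq : Cmod q < 1) (Hq0 : q <> 0).
Let Phi := theta_weight q (theta q) n.
Let HW : weight n q 0 Phi := weight_theta_fun n q Hn Hq Hq0.
Let B := brk n Phi.

Definition power_ct (j : nat) (m : Z) : C := brk n (theta_weight q (theta q) n) (fun u => Cpowz (u j) m).

Lemma brk_theta_var_run (l : nat) : (l <= n)%nat -> B (var_run 0 l) = Cpow (- q) l * B (fun _ => 1).
Proof.
  intros Hl. destruct (Nat.eq_dec l n) as [->|Hne].
  - unfold B. rewrite <- (brk_var_run_full n q 0 Phi Hn Hq0 HW). ring.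
  - apply (brk_var_run n q 0 Phi Hn Hq0 HW). lia.
Qed.

Lemma power_ct_move0 (j : nat) (m : Z) : (j < n)%nat ->
  power_ct j m = Cpow (- 1) j * B (fun u => Cpowz (u O) (m - Z.of_nat j) * var_run 1 j u).
Proof.
  intros Hj. unfold power_ct. fold Phi.
  rewrite (brk_ext n q 0 Phi HW _ (fun u => Cpowz (u j) m * 1)); [|al|intros; ring].
  rewrite (brk_move n q 0 Phi Hn HW j j m (fun _ => 1)); auto using unif_laurent_const, sym_const.
  f_equal. replace (j - j)%nat with O by lia.
  apply (brk_ext n q 0 Phi HW).
  - apply unif_laurent_mult; [al|]. apply unif_laurent_mult; [apply unif_laurent_var_run; lia | apply
      unif_laurent_const].
  - intros u _. ring.
Qed.

(** With the power in first position, rotation carries it to the last variable and the run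
    [u_1 ... u_j] to [u_0 ... u_(j-1)]; the factor [- 1/u_(n-1)] takes one more unit of exponent. *)
Lemma power_ct_rot (j : nat) (m : Z) : (j < n)%nat ->
  power_ct j m = Cpow (- 1) (S j) * Cpowz q (m - Z.of_nat j)
    * B (fun u => Cpowz (u (n - 1)%nat) (m - Z.of_nat j - 1) * var_run 0 j u).
Proof.
  intros Hj. rewrite power_ct_move0 by auto. unfold B.
  assert (A1 : unif_laurent n (var_run 1 j)) by (apply unif_laurent_var_run; lia).
  assert (A0 : unif_laurent n (var_run 0 j)) by (apply unif_laurent_var_run; lia).
  rewrite (brk_rot n q 0 Phi Hn Hq0 HW) by al.
  rewrite (brk_ext n q 0 Phi HW _ (fun u => - Cpowz q (m - Z.of_nat j) *
    (Cpowz (u (n - 1)%nat) (m - Z.of_nat j - 1) * var_run 0 j u))).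
  - rewrite (brk_scal n q 0 Phi HW) by al. rewrite Cpow_S. ring.
  - apply unif_laurent_mult; [|al].
    apply (ct_map_unif_laurent n (rot n q) (fun u => Cpowz (u O) (m - Z.of_nat j) * var_run 1 j u)); [|al].
    assert (Hr := ct_map_rot (n - 1) q Hq0 (n - 1) (le_n _)).
    replace (S (n - 1)) with n in Hr by lia. exact Hr.
  - intros u Hu.
    replace (var_run 1 j (rot n q u)) with (var_run 0 j u).
    + unfold rot. rewrite Cpowz_mul_l by auto.
      replace (m - Z.of_nat j)%Z with (m - Z.of_nat j - 1 + 1)%Z at 2 by ring.
      rewrite (Cpowz_succ (u (n - 1)%nat)) by auto. field. auto.
    + unfold var_run. apply prodn_ext. intros i Hi. symmetry. apply rot_S. lia.
Qed.

(** For [k = j + 1] the power reaches the first position with exponent 1 and completes a run. For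
    smaller [k] it reaches exponent 1 earlier, which gives zero; for larger [k] this happens after
    the rotation. *)
Lemma power_ct_one (j k : nat) : (j < n)%nat -> (1 <= k <= n)%nat ->
  power_ct j (Z.of_nat k) = if Nat.eqb k (S j) then - Cpow q k * B (fun _ => 1) else 0.
Proof.
  intros Hj Hk. destruct (Nat.eqb_spec k (S j)) as [->|Hne].
  - rewrite power_ct_move0 by auto. unfold B.
    rewrite (brk_ext n q 0 Phi HW _ (var_run 0 (S j))).
    + fold B. rewrite brk_theta_var_run by lia.
      rewrite Cmult_assoc.
      replace (Cpow (- q) (S j)) with (Cpow (- 1) (S j) * Cpow q (S j))
        by (rewrite <- Cpow_mult_l; f_equal; ring).
      assert (H1 : Cpow (- 1) j * Cpow (- 1) (S j) = - 1).
      { rewrite Cpow_S. replace (Cpow (- 1) j * (- 1 * Cpow (- 1) j))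
          with (- 1 * Cpow (- 1 * - 1) j) by (rewrite Cpow_mult_l; ring).
        replace (- 1 * - 1) with (RtoC 1) by ring. rewrite Cpow_1_l. ring. }
      rewrite Cmult_assoc, H1. ring.
    + apply unif_laurent_mult; [al | apply unif_laurent_var_run; lia].
    + intros u _. rewrite var_run_head. f_equal.
      replace (Z.of_nat (S j) - Z.of_nat j)%Z with 1%Z by lia. apply Cpowz_1.
  - destruct (le_lt_dec k j) as [Hkj|Hkj].
    + unfold power_ct. fold Phi.
      rewrite (brk_ext n q 0 Phi HW _ (fun u => Cpowz (u j) (Z.of_nat k) * 1)); [|al|intros; ring].
      apply (brk_pow_zero n q 0 Phi Hn HW); auto using unif_laurent_const, sym_const. lia.
    (* The remaining exponent [k - j - 1] is positive, and [k <= n] ensures that it reaches 1 before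
       the moves from the right touch the run [u_0 ... u_(j-1)]. *)
    + rewrite power_ct_rot by auto. unfold B.
      replace (Z.of_nat k - Z.of_nat j - 1)%Z with (Z.of_nat (k - j - 1)) by lia.
      rewrite (brk_pow_zero n q 0 Phi Hn HW).
      * ring.
      * lia.
      * lia.
      * apply unif_laurent_var_run. lia.
      * intros t Ht1 Ht2. apply sym_var_run; lia.
Qed.

Lemma Phi_scale (u : nat -> C) : nonzero_point u ->
  Phi (scale q u) = Cpow (- 1) n * / var_run 0 n u * Phi u.
Proof.
  intros Hu. unfold Phi, theta_weight. rewrite pairprod_scale; auto.
  - rewrite (prodn_ext n _ (fun i => (- 1 * / u i) * theta q (u i))).
    + rewrite prodn_mult, prodn_mult, prodn_const.
      rewrite (prodn_inv n u) by (intros; apply Hu).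
      change (var_run 0 n u) with (prodn n u). ring.
    + intros i _. unfold scale. rewrite theta_shift by auto. ring.
  - intros a b Ha Hb. apply theta_pair_scale; auto.
Qed.

(** The power travels from [j] to 0, by rotation to [n - 1], and back down to [j]. The variables
    left behind, with one factor taken from the power, form the product of all variables. *)
Lemma power_ct_period (j : nat) (m : Z) : (j < n)%nat ->
  power_ct j m = Cpowz q (2 * m - Z.of_nat j - 1) * power_ct j (m - Z.of_nat n - 1).
Proof.
  intros Hj. rewrite power_ct_rot by auto. unfold B.
  assert (A0 : unif_laurent n (var_run 0 j)) by (apply unif_laurent_var_run; lia).
  assert (A2 : unif_laurent n (var_run 0 n)) by (apply unif_laurent_var_run; lia).
  rewrite (brk_move n q 0 Phi Hn HW (n - 1) (n - 1 - j)) by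
    (auto; try lia; intros; apply sym_var_run; lia).
  replace (n - 1 - (n - 1 - j))%nat with j by lia.
  assert (A1 : unif_laurent n (var_run (S j) (n - 1 - j))) by (apply unif_laurent_var_run; lia).
  set (m' := (m - Z.of_nat n - 1)%Z).
  replace (m - Z.of_nat j - 1 - Z.of_nat (n - 1 - j))%Z with (m' + 1)%Z by lia.
  rewrite (brk_ext n q 0 Phi HW _ (fun u => Cpowz (u j) m' * var_run 0 n u)); [|al|].
  (* Under [u -> q u] the factor [1 / (u_0 ... u_(n-1))] of [Phi] cancels the full product. *)
  - assert (Hs : brk n Phi (fun u => Cpowz (u j) m' * var_run 0 n u)
      = Cpowz q m' * Cpow q n * Cpow (- 1) n * power_ct j m').
    { unfold power_ct. fold Phi. rewrite <- (brk_scal n q 0 Phi HW) by al.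
      unfold brk at 1. assert (HP : unif_laurent n Phi) by apply HW.
      rewrite <- (ct_map_CT n (scale q)) by (try apply ct_map_scale; auto; al).
      apply CT_ext.
      - apply (ct_map_unif_laurent n (scale q) (fun u => Cpowz (u j) m' * var_run 0 n u * Phi u)).
        + apply ct_map_scale; auto.
        + al.
      - intros u Hu. rewrite Phi_scale by auto.
        assert (Hup : var_run 0 n u <> 0) by (apply prodn_nz; intros; apply Hu).
        replace (var_run 0 n (scale q u)) with (Cpow q n * var_run 0 n u).
        + unfold scale. rewrite Cpowz_mul_l by auto. field. auto.
        + unfold var_run, scale. rewrite prodn_mult, prodn_const. reflexivity. }
    rewrite Hs.
    replace (2 * m - Z.of_nat j - 1)%Z with ((m - Z.of_nat j) + (m' + Z.of_nat n))%Z by (unfold m'; ring).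
    rewrite !(Cpowz_add q), Cpowz_nat by auto.
    assert (H1 : Cpow (- 1) (S j) * Cpow (- 1) (n - 1 - j) * Cpow (- 1) n = 1).
    { rewrite <- Cpow_add_r. replace (S j + (n - 1 - j))%nat with n by lia.
      rewrite <- Cpow_mult_l. replace (- 1 * - 1) with (RtoC 1) by ring. apply Cpow_1_l. }
    transitivity ((Cpow (- 1) (S j) * Cpow (- 1) (n - 1 - j) * Cpow (- 1) n) *
      (Cpowz q (m - Z.of_nat j) * (Cpowz q m' * Cpow q n) * power_ct j m')); [ring|].
    rewrite H1. ring.
  - intros u Hu. rewrite Cpowz_succ by auto.
    assert (Hsp : var_run 0 n u = var_run 0 j u * (u j * var_run (S j) (n - 1 - j) u)).
    { rewrite <- var_run_head. replace (S (n - 1 - j)) with (n - j)%nat by lia.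
      assert (Hgen : forall l, var_run 0 (j + l) u = var_run 0 j u * var_run j l u).
      { induction l as [|l IH]; [rewrite Nat.add_0_r; unfold var_run; simpl; ring|].
        rewrite Nat.add_succ_r. unfold var_run in *. simpl in *. rewrite IH. ring. }
      rewrite <- Hgen. f_equal. lia. }
    rewrite Hsp. ring.
Qed.

(** For [t >= 0] the exponent is the sum of [2 m - j - 1] over [m = m0 + (n+1) s] with
    [1 <= s <= t]; as a polynomial in [t] it is also correct for negative [t]. *)
Lemma power_ct_shift (j : nat) (m0 t : Z) : (j < n)%nat ->
  power_ct j (m0 + (Z.of_nat n + 1) * t) =
  Cpowz q (t * (2 * m0 + (Z.of_nat n + 1) * (t + 1) - Z.of_nat j - 1)) * power_ct j m0.
Proof.
  intros Hj. revert t. apply Zind_succ.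
  - rewrite Z.mul_0_r, Z.mul_0_l, Z.add_0_r, Cpowz_0. ring.
  - intros t. rewrite (power_ct_period j (m0 + (Z.of_nat n + 1) * (t + 1))) by auto.
    replace (m0 + (Z.of_nat n + 1) * (t + 1) - Z.of_nat n - 1)%Z
      with (m0 + (Z.of_nat n + 1) * t)%Z by ring.
    replace ((t + 1) * (2 * m0 + (Z.of_nat n + 1) * (t + 1 + 1) - Z.of_nat j - 1))%Z
      with ((2 * (m0 + (Z.of_nat n + 1) * (t + 1)) - Z.of_nat j - 1) +
            t * (2 * m0 + (Z.of_nat n + 1) * (t + 1) - Z.of_nat j - 1))%Z by ring.
    rewrite Cpowz_add by auto. split; intros H.
    + rewrite H. ring.
    + apply (Cmult_eq_reg_l (Cpowz q (2 * (m0 + (Z.of_nat n + 1) * (t + 1)) - Z.of_nat j - 1))).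
      * rewrite H. ring.
      * apply Cpowz_nz; auto.
Qed.

End Powers.

(** * From SU(N) to U(N) *)

Definition sym_sum (f : Z -> C) (M : nat) : C :=
  sumn (2 * M + 1) (fun j => f (Z.of_nat j - Z.of_nat M)%Z).

Lemma sumn_head (n : nat) (f : nat -> C) : sumn (S n) f = f O + sumn n (fun i => f (S i)).
Proof.
  induction n as [|n IH]; [simpl; ring|].
  change (sumn (S (S n)) f) with (sumn (S n) f + f (S n)). rewrite IH. simpl. ring.
Qed.

Lemma sym_sum_S (f : Z -> C) (M : nat) :
  sym_sum f (S M) = f (- Z.of_nat (S M))%Z + sym_sum f M + f (Z.of_nat (S M)).
Proof.
  unfold sym_sum. replace (2 * S M + 1)%nat with (S (S (2 * M + 1))) by lia.
  change (sumn (S (S (2 * M + 1))) (fun j => f (Z.of_nat j - Z.of_nat (S M))%Z))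
    with (sumn (S (2 * M + 1)) (fun j => f (Z.of_nat j - Z.of_nat (S M))%Z)
          + f (Z.of_nat (S (2 * M + 1)) - Z.of_nat (S M))%Z).
  rewrite sumn_head. f_equal; [f_equal|].
  - apply sumn_ext. intros i _. f_equal. lia.
  - f_equal. lia.
Qed.

(** [3 - 2 (/2)^M] is the sum of [(/2)^|k|] over [|k| <= M]. *)
Lemma sym_sum_bound (f : Z -> C) (E : R) (M : nat) :
  (forall k, Cmod (f k) <= E * (/ 2) ^ Z.abs_nat k) ->
  Cmod (sym_sum f M) <= E * (3 - 2 * (/ 2) ^ M).
Proof.
  intros H. induction M as [|M IH].
  - unfold sym_sum. simpl. rewrite Cplus_0_l. specialize (H 0%Z). simpl in H. lra.
  - rewrite sym_sum_S.
    assert (H1 := H (- Z.of_nat (S M))%Z). assert (H2 := H (Z.of_nat (S M))).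
    replace (Z.abs_nat (- Z.of_nat (S M))) with (S M) in H1 by lia.
    replace (Z.abs_nat (Z.of_nat (S M))) with (S M) in H2 by lia.
    eapply Rle_trans; [apply Cmod_triangle|].
    assert (H3 := Cmod_triangle (f (- Z.of_nat (S M))%Z) (sym_sum f M)).
    simpl pow in *. lra.
Qed.

Lemma sym_sum_scal (c : C) (f : Z -> C) (M : nat) : sym_sum (fun k => c * f k) M = c * sym_sum f M.
Proof. apply sumn_scal. Qed.

Lemma sym_sum_plus (f g : Z -> C) (M : nat) : sym_sum (fun k => f k + g k) M = sym_sum f M + sym_sum g M.
Proof. apply sumn_plus. Qed.

Lemma sym_sum_ext (f g : Z -> C) (M : nat) : (forall k, f k = g k) -> sym_sum f M = sym_sum g M.
Proof. intros H. apply sumn_ext. intros; apply H. Qed.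

Lemma sym_sum_single (f : Z -> C) (c : Z) (M : nat) : (Z.abs_nat c <= M)%nat ->
  (forall k, k <> c -> f k = 0) -> sym_sum f M = f c.
Proof.
  intros Hc H. unfold sym_sum. rewrite (sumn_single _ (Z.to_nat (c + Z.of_nat M))).
  - f_equal. lia.
  - lia.
  - intros i Hi Hne. apply H. lia.
Qed.

Lemma mct_one (n : nat) : forall lam, (forall i, (i < n)%nat -> lam i = 0%Z) -> mct n lam = 1.
Proof.
  induction n as [|n IH]; intros lam H; simpl; auto.
  rewrite H by lia. rewrite IH; [simpl; ring|]. intros i Hi. apply H. lia.
Qed.

Lemma mct_zero (n : nat) : forall lam i, (i < n)%nat -> lam i <> 0%Z -> mct n lam = 0.
Proof.
  induction n as [|n IH]; intros lam i Hi H; [lia|]. simpl. destruct i as [|i].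
  - destruct (Z.eqb_spec (lam O) 0); [lia|]. ring.
  - rewrite (IH (fun i => lam (S i)) i); auto; [ring|lia].
Qed.

Lemma mct_cases (n : nat) (lam : nat -> Z) :
  (forall i, (i < n)%nat -> lam i = 0%Z) \/ mct n lam = 0.
Proof.
  revert lam. induction n as [|n IH]; intros lam; [left; intros; lia|].
  destruct (Z.eq_dec (lam n) 0) as [H0|H0].
  - destruct (IH lam) as [H|H].
    + left. intros i Hi. destruct (Nat.eq_dec i n) as [->|]; auto. apply H. lia.
    + right. clear -H. revert lam H. induction n as [|n IH]; intros lam H.
      * simpl in H. exfalso. apply C1_nz. exact H.
      * simpl in H |- *. destruct (Z.eqb (lam O) 0).
        -- rewrite !Cmult_1_l in *. apply (IH (fun i => lam (S i))). exact H.
        -- ring.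
  - right. apply (mct_zero (S n) lam n); auto.
Qed.

(** The point [x s] of the torus of SU(N), [N = S n], with [s_N] determined by the other
    entries; the values at indices above [n] are junk. *)
Definition emb (n : nat) (x : C) (u : nat -> C) (i : nat) : C :=
  x * (if Nat.ltb i n then u i else / prodn n u).

(** The coefficient of [(u_0 ... u_(n-1))^c]. *)
Definition coef (n : nat) (G : (nat -> C) -> C) (c : Z) : C :=
  CT n (fun u => G u * mono n (fun _ => - c)%Z u).

Lemma emb_l (n i : nat) (x : C) (u : nat -> C) : (i < n)%nat -> emb n x u i = x * u i.
Proof. intros H. unfold emb. destruct (Nat.ltb_spec i n); [auto|lia]. Qed.

Lemma emb_r (n : nat) (x : C) (u : nat -> C) : emb n x u n = x * / prodn n u.
Proof. unfold emb. rewrite Nat.ltb_irrefl. reflexivity. Qed.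

Lemma emb_nonzero_point (n : nat) (x : C) (u : nat -> C) : x <> 0 -> nonzero_point u -> nonzero_point
    (emb n x u).
Proof.
  intros Hx Hu i. unfold emb. apply Cmult_neq_0; auto.
  destruct (Nat.ltb i n); auto. apply nonzero_inv, prodn_nz; auto.
Qed.

Lemma Cmod_prodn_torus (n : nat) (u : nat -> C) : on_torus u -> Cmod (prodn n u) = 1%R.
Proof.
  intros Hu. induction n as [|n IH]; simpl; [apply Cmod_1|]. rewrite Cmod_mult, IH, Hu. ring.
Qed.

Lemma emb_mod (n i : nat) (x : C) (u : nat -> C) : on_torus u -> Cmod (emb n x u i) = Cmod x.
Proof.
  intros Hu. unfold emb. rewrite Cmod_mult. destruct (Nat.ltb i n).
  - rewrite Hu. ring.
  - rewrite Cmod_inv, Cmod_prodn_torus; auto; [field|].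
    apply prodn_nz. intros. apply nonzero_point_torus; auto.
Qed.

Lemma prodn_powz (n : nat) (k : Z) (f : nat -> C) : (forall i, f i <> 0) ->
  prodn n (fun i => Cpowz (f i) k) = Cpowz (prodn n f) k.
Proof.
  intros Hf. induction n as [|n IH]; simpl; [rewrite Cpowz_1_l; auto|].
  rewrite IH, <- Cpowz_mul_l; auto. apply prodn_nz; auto.
Qed.

(** Eliminating the last variable subtracts its exponent from all others, so a constant term
    survives only if all exponents coincide. *)
Lemma mono_emb (n : nat) (x : C) (lam : nat -> Z) (u : nat -> C) : x <> 0 -> nonzero_point u ->
  mono (S n) lam (emb n x u) =
  prodn (S n) (fun i => Cpowz x (lam i)) * mono n (fun i => lam i - lam n)%Z u.
Proof.
  intros Hx Hu. rewrite !mono_prodn. simpl prodn. rewrite emb_r.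
  assert (Hp : prodn n u <> 0) by (apply prodn_nz; auto).
  rewrite (prodn_ext n (fun i => Cpowz (emb n x u i) (lam i))
             (fun i => Cpowz x (lam i) * Cpowz (u i) (lam i)))
    by (intros i Hi; rewrite emb_l, Cpowz_mul_l by auto; reflexivity).
  rewrite (prodn_ext n (fun i => Cpowz (u i) (lam i - lam n))
             (fun i => Cpowz (u i) (lam i) * / Cpowz (u i) (lam n)))
    by (intros i Hi; unfold Z.sub; rewrite Cpowz_add, Cpowz_opp by auto; reflexivity).
  rewrite Cpowz_mul_l, Cpowz_inv by (auto using nonzero_inv).
  rewrite !prodn_mult, (prodn_inv n (fun i => Cpowz (u i) (lam n))) by (intros; apply Cpowz_nz; auto).
  rewrite prodn_powz by auto. ring.
Qed.

Lemma laurent_emb (n : nat) (x : C) (p : (nat -> C) -> C) : x <> 0 -> laurent (S n) p ->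
  laurent n (fun u => p (emb n x u)).
Proof.
  intros Hx. apply laurent_comp.
  - intros u Hu. apply emb_nonzero_point; auto.
  - intros lam. eapply laurent_ext; [apply (laurent_scal n (prodn (S n) (fun i => Cpowz x (lam i)))),
      laurent_mono|].
    intros u Hu. symmetry. apply mono_emb; auto.
Qed.

Lemma in_annulus_emb (n : nat) (Rd : R) (x : C) (u : nat -> C) : x <> 0 -> max_mod x <= Rd -> on_torus u ->
  in_annulus Rd (emb n x u).
Proof.
  intros Hx HR Hu i. rewrite emb_mod by auto. destruct (rad_spec x Hx) as [H1 [H2 H3]].
  split; [|lra]. eapply Rle_trans; [|exact H3]. apply Rinv_le_contravar; lra.
Qed.

Lemma torus_laurent_emb (n : nat) (x : C) (G : (nat -> C) -> C) : x <> 0 -> unif_laurent (S n) G ->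
  torus_laurent n (fun u => G (emb n x u)).
Proof.
  intros Hx HG eps Heps. destruct (rad_spec x Hx) as [H1 _].
  destruct (HG (max_mod x) eps H1 Heps) as [p [Hp Hpg]].
  exists (fun u => p (emb n x u)). split; [apply laurent_emb; auto|].
  intros u Hu. apply Hpg, in_annulus_emb; auto. lra.
Qed.

Lemma unif_laurent_mono (n : nat) (lam : nat -> Z) : unif_laurent n (mono n lam).
Proof. apply unif_laurent_laurent, laurent_mono. Qed.

Lemma CT_mono (n : nat) (lam : nat -> Z) : CT n (mono n lam) = mct n lam.
Proof. apply CT_eq, tint_mono. Qed.

Lemma coef_mono (n : nat) (lam : nat -> Z) (c : Z) :
  coef n (mono n lam) c = mct n (fun i => lam i - c)%Z.
Proof.
  unfold coef. rewrite <- CT_mono. symmetry. apply CT_ext; [apply unif_laurent_mono|].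
  intros u Hu. apply (mono_add n lam (fun _ => - c)%Z u Hu).
Qed.

Lemma coef_plus (n : nat) (G H : (nat -> C) -> C) (c : Z) : unif_laurent n G -> unif_laurent n H ->
  coef n (fun u => G u + H u) c = coef n G c + coef n H c.
Proof.
  intros HG HH. unfold coef. rewrite <- CT_plus by (apply unif_laurent_mult; auto; apply unif_laurent_mono).
  f_equal. apply functional_extensionality. intros u. ring.
Qed.

Lemma coef_scal (n : nat) (k : C) (G : (nat -> C) -> C) (c : Z) : unif_laurent n G ->
  coef n (fun u => k * G u) c = k * coef n G c.
Proof.
  intros HG. unfold coef. rewrite <- CT_scal by (apply unif_laurent_mult; auto; apply unif_laurent_mono).
  f_equal. apply functional_extensionality. intros u. ring.
Qed.

Lemma coef_ext (n : nat) (G H : (nat -> C) -> C) (c : Z) : unif_laurent n G ->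
  (forall u, nonzero_point u -> G u = H u) -> coef n G c = coef n H c.
Proof.
  intros HG He. apply CT_ext; [apply unif_laurent_mult; auto; apply unif_laurent_mono|].
  intros u Hu. rewrite He; auto.
Qed.

(** Only the exponents [(c, ..., c)] survive the integration over SU(N). *)
Lemma SU_series_laurent (n : nat) (x : C) (p : (nat -> C) -> C) : x <> 0 -> laurent (S n) p ->
  exists M0, forall M, (M0 <= M)%nat ->
    sym_sum (fun c => coef (S n) p c * Cpow (Cpowz x c) (S n)) M = CT n (fun u => p (emb n x u)).
Proof.
  intros Hx H.
  induction H as [lam|f g Hf [M1 H1] Hg [M2 H2]|k f Hf [M1 H1]|f g Hf [M1 H1] He].
  - exists (Z.abs_nat (lam n)). intros M HM.
    rewrite (sym_sum_single _ (lam n)) by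
      (auto; intros c Hc; rewrite coef_mono, (mct_zero _ _ n) by lia; ring).
    rewrite coef_mono.
    rewrite <- (CT_ext n (fun u => prodn (S n) (fun i => Cpowz x (lam i))
                                   * mono n (fun i => lam i - lam n)%Z u)).
    + rewrite CT_scal, CT_mono by apply unif_laurent_mono.
      destruct (mct_cases n (fun i => lam i - lam n)%Z) as [Hz|Hz].
      * rewrite !mct_one by (intros i Hi; destruct (Nat.eq_dec i n) as [->|];
          [lia | apply Hz; lia]).
        rewrite (prodn_ext (S n) _ (fun _ => Cpowz x (lam n))).
        -- rewrite prodn_const. ring.
        -- intros i Hi. destruct (Nat.eq_dec i n) as [->|]; auto. f_equal.
           specialize (Hz i ltac:(lia)). lia.
      * rewrite Hz. destruct (mct_cases (S n) (fun i => lam i - lam n)%Z) as [Hz'|Hz'].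
        -- rewrite mct_one in Hz by (intros i Hi; apply Hz'; lia).
           exfalso. apply C1_nz. exact Hz.
        -- rewrite Hz'. ring.
    + apply unif_laurent_scal, unif_laurent_mono.
    + intros u Hu. symmetry. apply mono_emb; auto.
  - exists (M1 + M2)%nat. intros M HM.
    rewrite (CT_plus n (fun u => f (emb n x u)) (fun u => g (emb n x u)))
      by (apply unif_laurent_laurent, laurent_emb; auto).
    rewrite <- (H1 M), <- (H2 M), <- sym_sum_plus by lia. apply sym_sum_ext. intros c.
    rewrite coef_plus by (apply unif_laurent_laurent; auto). ring.
  - exists M1. intros M HM.
    rewrite (CT_scal n k (fun u => f (emb n x u))) by (apply unif_laurent_laurent, laurent_emb; auto).
    rewrite <- (H1 M), <- sym_sum_scal by lia. apply sym_sum_ext. intros c.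
    rewrite coef_scal by (apply unif_laurent_laurent; auto). ring.
  - exists M1. intros M HM.
    rewrite <- (CT_ext n (fun u => f (emb n x u))).
    + rewrite <- (H1 M) by lia. apply sym_sum_ext. intros c.
      rewrite <- (coef_ext (S n) f g) by auto using unif_laurent_laurent. reflexivity.
    + apply unif_laurent_laurent, laurent_emb; auto.
    + intros u Hu. apply He, emb_nonzero_point; auto.
Qed.

Lemma Cmod_mono_scale (n : nat) (rho : C) (c : Z) (u : nat -> C) : rho <> 0 -> on_torus u ->
  Cmod (mono n (fun _ => c) (scale rho u)) = (Cmod (Cpowz rho c) ^ n)%R.
Proof.
  intros Hr Hu. rewrite mono_prodn. induction n as [|n IH]; simpl; [apply Cmod_1|].
  rewrite Cmod_mult, IH. unfold scale.
  rewrite Cpowz_mul_l, Cmod_mult, (Cmod_powz_1 (u n)) by (auto; apply nonzero_point_torus; auto). ring.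
Qed.

(** Cauchy's estimate on the circle of radius [|rho|]. *)
Lemma coef_diff_bound (n : nat) (Rd eps : R) (G p : (nat -> C) -> C) (c : Z) (rho : C) :
  rho <> 0 -> (/ Rd <= Cmod rho /\ Cmod rho <= Rd) -> unif_laurent n G -> laurent n p ->
  (forall u, in_annulus Rd u -> Cmod (G u - p u) <= eps) ->
  Cmod (coef n G c - coef n p c) <= eps * Cmod (Cpowz rho (- c)) ^ n.
Proof.
  intros Hr Hrho HG Hp Hgp.
  assert (HGm : unif_laurent n (fun u => G u * mono n (fun _ => - c)%Z u)) by (apply unif_laurent_mult;
      auto; apply unif_laurent_mono).
  assert (Hpm : unif_laurent n (fun u => p u * mono n (fun _ => - c)%Z u))
    by (apply unif_laurent_mult; [apply unif_laurent_laurent; auto | apply unif_laurent_mono]).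
  assert (Hs := ct_map_scale n rho Hr).
  unfold coef. rewrite <- (ct_map_CT n _ _ Hs HGm), <- (ct_map_CT n _ _ Hs Hpm).
  apply CT_diff_bound.
  - apply unif_laurent_torus_laurent, (ct_map_unif_laurent n _ _ Hs HGm).
  - apply unif_laurent_torus_laurent, (ct_map_unif_laurent n _ _ Hs Hpm).
  - intros u Hu.
    set (v := scale rho u).
    replace (G v * mono n (fun _ => - c)%Z v - p v * mono n (fun _ => - c)%Z v)
      with ((G v - p v) * mono n (fun _ => - c)%Z v) by ring.
    rewrite Cmod_mult. unfold v at 3. rewrite Cmod_mono_scale by auto.
    apply Rmult_le_compat_r; [apply pow_le, Cmod_ge_0|].
    apply Hgp. intros i. unfold v, scale. rewrite Cmod_mult, Hu, Rmult_1_r. auto.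
Qed.

Lemma Cmod_powz_le_half (z : C) (k : nat) : Cmod z <= / 2 -> Cmod (Cpowz z (Z.of_nat k)) <= (/ 2) ^ k.
Proof.
  intros H. rewrite Cpowz_nat, Cmod_pow. apply pow_incr. split; auto using Cmod_ge_0.
Qed.

(** For an approximating Laurent polynomial the partial sums are eventually exact. The coefficient
    errors must be summable uniformly in [M], which is obtained by applying [coef_diff_bound] on a
    circle chosen according to the sign of [c]. *)
Lemma SU_series (n : nat) (x : C) (G : (nat -> C) -> C) : x <> 0 -> unif_laurent (S n) G ->
  Ccv (sym_sum (fun c => coef (S n) G c * Cpow (Cpowz x c) (S n))) (CT n (fun u => G (emb n x u))).
Proof.
  intros Hx HG eps Heps. destruct (rad_spec x Hx) as [H1 [H2 H3]].
  (* The factor 2 is the margin that yields [(/2)^|c|]: radius [Rd] is used for [c >= 0] and [/ Rd]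
     for [c < 0]. The coefficient errors then add up to at most [3 eps / 8], and the integral itself
     contributes [eps / 8]. *)
  set (Rd := (2 * max_mod x)%R). assert (HRd : 1 <= Rd) by (unfold Rd; lra).
  assert (Hx0 : 0 < Cmod x) by (apply Cmod_gt_0; auto).
  destruct (HG Rd (eps / 8)%R HRd ltac:(lra)) as [p [Hp Hgp]].
  destruct (SU_series_laurent n x p Hx Hp) as [M0 HM0].
  exists M0. intros M HM. specialize (HM0 M HM).
  set (D := fun c => (coef (S n) G c - coef (S n) p c) * Cpow (Cpowz x c) (S n)).
  assert (HD : forall c, Cmod (D c) <= eps / 8 * (/ 2) ^ Z.abs_nat c).
  { intros c. unfold D. rewrite Cmod_mult, Cmod_pow.
    assert (Hw : exists rho : C, rho <> 0 /\ (/ Rd <= Cmod rho /\ Cmod rho <= Rd) /\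
      Cmod (Cpowz rho (- c) * Cpowz x c) <= (/ 2) ^ Z.abs_nat c).
    { assert (HRz : RtoC Rd <> 0) by (intros E; apply RtoC_inj in E; lra).
      assert (HRm : Cmod (RtoC Rd) = Rd) by (rewrite Cmod_R, Rabs_pos_eq; lra).
      assert (HRi : / Rd <= 1) by (rewrite <- Rinv_1; apply Rinv_le_contravar; lra).
      destruct (Z_le_gt_dec 0 c) as [Hc|Hc].
      - exists (RtoC Rd). split; [auto|]. split; [rewrite HRm; lra|].
        rewrite Cpowz_opp, <- Cpowz_inv, <- Cpowz_mul_l by (auto using nonzero_inv).
        rewrite <- (Z2Nat.id c) at 1 by auto. replace (Z.abs_nat c) with (Z.to_nat c) by lia.
        apply Cmod_powz_le_half. rewrite Cmod_mult, Cmod_inv, HRm by auto.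
        apply Rmult_le_reg_l with Rd; [lra|].
        replace (Rd * (/ Rd * Cmod x))%R with (Cmod x) by (field; lra). unfold Rd. lra.
      - exists (/ RtoC Rd). split; [apply nonzero_inv; auto|].
        split; [rewrite Cmod_inv, HRm by auto; lra|].
        rewrite Cpowz_inv, Cpowz_opp by auto.
        replace (Cpowz x c) with (/ Cpowz x (- c)).
        + replace (/ / Cpowz Rd c) with (/ Cpowz Rd (- c)) by (rewrite Cpowz_opp; auto).
          rewrite <- !Cpowz_inv, <- Cpowz_mul_l by (auto using nonzero_inv).
          replace (- c)%Z with (Z.of_nat (Z.abs_nat c)) by lia.
          apply Cmod_powz_le_half. rewrite Cmod_mult, !Cmod_inv, HRm by auto.
          assert (Hxr : 1 <= max_mod x * Cmod x).
          { apply Rmult_le_reg_l with (/ max_mod x)%R; [apply Rinv_0_lt_compat; lra|].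
            rewrite Rmult_1_r, <- Rmult_assoc, Rinv_l, Rmult_1_l by lra. exact H3. }
          rewrite <- Rinv_mult. apply Rinv_le_contravar; [lra|]. unfold Rd. nra.
        + rewrite Cpowz_opp by auto. field. apply Cpowz_nz; auto. }
    destruct Hw as [rho [Hr0 [Hr Hw]]].
    assert (Hb := coef_diff_bound (S n) Rd (eps / 8) G p c rho Hr0 Hr HG Hp Hgp).
    assert (Hpx : 0 <= Cmod (Cpowz x c) ^ S n) by (apply pow_le, Cmod_ge_0).
    apply Rle_trans with (eps / 8 * (Cmod (Cpowz rho (- c)) ^ S n * Cmod (Cpowz x c) ^ S n))%R.
    { rewrite <- Rmult_assoc. apply Rmult_le_compat_r; auto. }
    apply Rmult_le_compat_l; [lra|].
    rewrite <- Rpow_mult_distr, <- Cmod_mult.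
    (* As [y <= 1], one of the [n + 1] factors already gives the decay. *)
    set (y := Cmod (Cpowz rho (- c) * Cpowz x c)) in *.
    assert (Hy0 : 0 <= y) by apply Cmod_ge_0.
    assert (Hh : (/ 2) ^ Z.abs_nat c <= 1).
    { rewrite <- (pow1 (Z.abs_nat c)). apply pow_incr. lra. }
    assert (Hyn : y ^ n <= 1) by (rewrite <- (pow1 n); apply pow_incr; lra).
    assert (0 <= y ^ n) by (apply pow_le; auto).
    simpl. nra. }
  assert (HE : sym_sum (fun c => coef (S n) G c * Cpow (Cpowz x c) (S n)) M
    = sym_sum D M + CT n (fun u => p (emb n x u))).
  { rewrite <- HM0, <- sym_sum_plus. apply sym_sum_ext. intros c. unfold D. ring. }
  rewrite HE.
  replace (sym_sum D M + CT n (fun u => p (emb n x u)) - CT n (fun u => G (emb n x u)))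
    with (sym_sum D M + - (CT n (fun u => G (emb n x u)) - CT n (fun u => p (emb n x u)))) by ring.
  eapply Rle_lt_trans; [apply Cmod_triangle|]. rewrite Cmod_opp.
  assert (HB1 := sym_sum_bound D (eps / 8) M HD).
  assert (HB2 : Cmod (CT n (fun u => G (emb n x u)) - CT n (fun u => p (emb n x u))) <= eps / 8).
  { apply CT_diff_bound.
    - apply torus_laurent_emb; auto.
    - apply unif_laurent_torus_laurent, unif_laurent_laurent, laurent_emb; auto.
    - intros u Hu. apply Hgp, in_annulus_emb; auto. unfold Rd. lra. }
  assert (0 < (/ 2) ^ M) by (apply pow_lt; lra). nra.
Qed.

Lemma sumn_swap (n i : nat) (f : nat -> C) : (S i < n)%nat -> sumn n (swap i f) = sumn n f.
Proof.
  induction n as [|n IH]; intros Hi; [lia|].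
  destruct (Nat.eq_dec n (S i)) as [->|Hne].
  - simpl. rewrite swap_l, swap_r.
    rewrite (sumn_ext i (swap i f) f) by (intros j Hj; apply swap_other; lia). ring.
  - simpl. rewrite IH, swap_other by lia. reflexivity.
Qed.

Definition power_sum (n : nat) (m : Z) (u : nat -> C) : C := sumn n (fun i => Cpowz (u i) m).

Lemma unif_laurent_power_sum (n : nat) (m : Z) : unif_laurent n (power_sum n m).
Proof. apply unif_laurent_sumn. intros i Hi. apply unif_laurent_powz; auto. Qed.

Lemma sym_power_sum (n i : nat) (m : Z) : (S i < n)%nat -> sym i (power_sum n m).
Proof.
  intros Hi u _. unfold power_sum. rewrite <- (sumn_swap n i (fun j => Cpowz (u j) m) Hi).
  apply sumn_ext. intros j _. apply (swap_map (fun z => Cpowz z m)).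
Qed.

Lemma power_sum_scale (n : nat) (m : Z) (c : C) (u : nat -> C) : c <> 0 -> nonzero_point u ->
  power_sum n m (scale c u) = Cpowz c m * power_sum n m u.
Proof.
  intros Hc Hu. unfold power_sum. rewrite <- sumn_scal. apply sumn_ext. intros i _.
  unfold scale. apply Cpowz_mul_l; auto.
Qed.

(** * The coefficients of the Wilson loop *)

(** The integrand in the variables [u = x s], freed from the constant [x^(-m)]; [r] stands for
    [q^(1/2)]. *)
Definition wilson_fun (r : C) (m : Z) (n : nat) (u : nat -> C) : C :=
  pairprod vand_pair n u * power_sum n m u * theta_weight (r * r) (fun z => theta (r * r) (r * z)) n u.

Section Coefs.
Variables (n : nat) (m : Z) (r : C).
Let q := r * r.
Hypothesis (Hn : (1 <= n)%nat) (Hq : Cmod q < 1) (Hr : r <> 0).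

Lemma q_nz : q <> 0.
Proof. apply Cmult_neq_0; auto. Qed.

Lemma unif_laurent_wilson_fun : unif_laurent n (wilson_fun r m n).
Proof.
  unfold wilson_fun. apply unif_laurent_mult; [apply unif_laurent_mult; [apply
      unif_laurent_pairprod_vand_pair; auto | apply unif_laurent_power_sum]|].
  unfold theta_weight. apply unif_laurent_mult; [apply unif_laurent_pairprod_theta_pair; auto|].
  apply unif_laurent_prodn. intros i Hi. apply unif_laurent_theta; auto.
Qed.

Lemma wilson_fun_scale (u : nat -> C) : nonzero_point u ->
  wilson_fun r m n (scale q u) = Cpowz q m * Cpow (- / r) n * mono n (fun _ => - 1)%Z u * wilson_fun r m n u.
Proof.
  intros Hu. pose proof q_nz as Hq0. unfold wilson_fun, theta_weight. fold q.
  rewrite power_sum_scale, !pairprod_scale; auto; [|intros; apply theta_pair_scale; auto|intros; apply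
      vand_pair_scale; auto].
  rewrite (prodn_ext n (fun i => theta q (r * scale q u i))
    (fun i => - / r * Cpowz (u i) (-1) * theta q (r * u i))).
  - rewrite !prodn_mult, prodn_const, mono_prodn. ring.
  - intros i _. unfold scale. replace (r * (q * u i)) with (q * (r * u i)) by ring.
    rewrite theta_shift by (auto using Cmult_neq_0).
    change (Cpowz (u i) (-1)) with (/ Cpow (u i) 1). rewrite Cpow_1_r. field. auto.
Qed.

Lemma coef_step (c : Z) :
  coef n (wilson_fun r m n) c = Cpowz q m * Cpow (- / r) n * Cpow (Cpowz q (- c)) n
                          * coef n (wilson_fun r m n) (c + 1).
Proof.
  pose proof q_nz as Hq0. pose proof unif_laurent_wilson_fun as HG.
  assert (Hm : unif_laurent n (fun u => wilson_fun r m n u * mono n (fun _ => - c)%Z u))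
    by (apply unif_laurent_mult; auto; apply unif_laurent_mono).
  unfold coef. rewrite <- (ct_map_CT n _ _ (ct_map_scale n q Hq0) Hm).
  rewrite <- CT_scal by (apply unif_laurent_mult; auto; apply unif_laurent_mono).
  apply CT_ext; [apply (ct_map_unif_laurent n _ _ (ct_map_scale n q Hq0) Hm)|].
  intros u Hu. rewrite wilson_fun_scale by auto.
  assert (H1 : mono n (fun _ => - c)%Z (scale q u) = Cpow (Cpowz q (- c)) n * mono n (fun _ => - c)%Z u).
  { rewrite !mono_prodn, <- prodn_const, <- prodn_mult. apply prodn_ext. intros i _.
    unfold scale. apply Cpowz_mul_l; auto. }
  assert (H2 : mono n (fun _ => - (c + 1))%Z u = mono n (fun _ => - c)%Z u * mono n (fun _ => - 1)%Z u).
  { rewrite <- (mono_add n (fun _ => - c)%Z (fun _ => - 1)%Z u Hu).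
    apply mono_ext; auto. intros; lia. }
  rewrite H1, H2. ring.
Qed.

Lemma m1_nz : RtoC (-1) <> 0.
Proof. intros H. apply RtoC_inj in H. lra. Qed.

(** [coef_step] amounts to [g_(c+1) = (-1)^N r^(N (2c+1) - 2m) g_c], and [N c^2 - 2 m c] has exactly
    these increments. *)
Lemma coef_closed (c : Z) :
  coef n (wilson_fun r m n) c =
  Cpowz (RtoC (-1)) (Z.of_nat n * c) * Cpowz r (Z.of_nat n * c * c - 2 * m * c) * coef n (wilson_fun r m n) 0.
Proof.
  pose proof m1_nz as Hm1.
  revert c. apply Zind_succ.
  - rewrite Z.mul_0_r, !Z.mul_0_r. simpl Z.sub. rewrite !Cpowz_0. ring.
  - intros c. rewrite (coef_step c).
    set (N := Z.of_nat n). set (g := coef n (wilson_fun r m n) (c + 1)). set (g0 := coef n (wilson_fun r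
        m n) 0).
    assert (Hpre : Cpowz q m * Cpow (- / r) n * Cpow (Cpowz q (- c)) n
        = Cpowz (RtoC (-1)) N * Cpowz r (2 * m - N - 2 * N * c)).
    { rewrite <- !Cpowz_nat. fold N.
      replace (- / r) with (RtoC (-1) * / r) by ring.
      rewrite Cpowz_mul_l, Cpowz_inv, <- Cpowz_opp by (auto using nonzero_inv).
      unfold q. rewrite <- Cpowz_mul_r by (apply q_nz).
      rewrite !Cpowz_mul_l, <- !Cpowz_add by auto.
      transitivity (Cpowz (RtoC (-1)) N * (Cpowz r (m + m) * Cpowz r (- N) * Cpowz r (- c * N + - c *
          N))); [ring|].
      rewrite <- !Cpowz_add by auto. f_equal. f_equal. ring. }
    rewrite Hpre.
    assert (Hsq : Cpowz (RtoC (-1)) N * Cpowz (RtoC (-1)) N = 1).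
    { rewrite <- Cpowz_mul_l by auto. replace (RtoC (-1) * RtoC (-1)) with (RtoC 1) by ring.
      apply Cpowz_1_l. }
    replace (N * (c + 1))%Z with (N + N * c)%Z by ring.
    rewrite (Cpowz_add (RtoC (-1))) by auto.
    replace (N * c * c - 2 * m * c)%Z
      with ((2 * m - N - 2 * N * c) + (N + N * c) * (c + 1) - 2 * m * (c + 1))%Z by ring.
    replace ((2 * m - N - 2 * N * c) + (N + N * c) * (c + 1) - 2 * m * (c + 1))%Z
      with ((2 * m - N - 2 * N * c) + ((N + N * c) * (c + 1) - 2 * m * (c + 1)))%Z by ring.
    rewrite (Cpowz_add r (2 * m - N - 2 * N * c)) by auto.
    set (A := Cpowz r (2 * m - N - 2 * N * c)).
    set (D := Cpowz r ((N + N * c) * (c + 1) - 2 * m * (c + 1))).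
    set (s := Cpowz (RtoC (-1)) N) in *. set (s' := Cpowz (RtoC (-1)) (N * c)).
    assert (HA : A <> 0) by (apply Cpowz_nz; auto).
    assert (Hs : s <> 0) by (apply Cpowz_nz; auto).
    split; intros H.
    + apply (Cmult_eq_reg_l (s * A)); [|apply Cmult_neq_0; auto]. rewrite H.
      transitivity (s' * A * D * g0 * 1); [ring|]. rewrite <- Hsq. ring.
    + rewrite H. transitivity (s * s * (A * s' * D * g0)); [ring|]. rewrite Hsq. ring.
Qed.

(** Rescaling by [1/r] turns [theta (r u_i)] into [theta (u_i)] and costs [r^(-m)] through the power
    sum. The Vandermonde factor then becomes [n!], as the power sum is symmetric. *)
Lemma coef_zero : coef n (wilson_fun r m n) 0 =
  Cpowz r (- m) * (INR (fact n) * sumn n (fun j => power_ct n q j m)).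
Proof.
  pose proof q_nz as Hq0. pose proof unif_laurent_wilson_fun as HG.
  assert (HW := weight_theta_fun n q Hn Hq Hq0).
  assert (Hi : / r <> 0) by (apply nonzero_inv; auto).
  transitivity (CT n (wilson_fun r m n)).
  { symmetry. apply CT_ext; auto. intros u _.
    rewrite mono_prodn, (prodn_ext n _ (fun _ => 1)) by reflexivity.
    rewrite prodn_const, Cpow_1_l. ring. }
  rewrite <- (ct_map_CT n _ _ (ct_map_scale n (/ r) Hi) HG).
  unfold power_ct. rewrite <- (brk_sumn n q 0 _ HW) by (intros; apply unif_laurent_powz; auto).
  change (fun u : nat -> C => sumn n (fun i => Cpowz (u i) m)) with (power_sum n m).
  rewrite <- (brk_vand n q 0 _ Hn HW n) by (auto using unif_laurent_power_sum, sym_power_sum).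
  assert (HAv : unif_laurent n (fun u => pairprod vand_pair n u * power_sum n m u))
    by (apply unif_laurent_mult; [apply unif_laurent_pairprod_vand_pair; auto | apply
        unif_laurent_power_sum]).
  rewrite <- (brk_scal n q 0 _ HW) by exact HAv.
  apply CT_ext; [apply (ct_map_unif_laurent n _ _ (ct_map_scale n (/ r) Hi) HG)|].
  intros u Hu. unfold wilson_fun, theta_weight. fold q.
  rewrite power_sum_scale, !pairprod_scale; auto; [|intros; apply theta_pair_scale; auto|intros; apply
      vand_pair_scale; auto].
  rewrite (prodn_ext n (fun i => theta q (r * scale (/ r) u i)) (fun i => theta q (u i))).
  - rewrite Cpowz_inv, Cpowz_opp by auto. ring.
  - intros i _. unfold scale. f_equal. field. auto.
Qed.

Lemma geom_desc (a : C) (K : Z) (k : nat) : a <> 0 ->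
  (1 - a) * sumn k (fun j => Cpowz a (K - Z.of_nat j)) = Cpowz a (K - Z.of_nat k + 1) - Cpowz a (K + 1).
Proof.
  intros Ha. induction k as [|k IH].
  - simpl. rewrite Z.sub_0_r. ring.
  - simpl sumn. rewrite Cmult_plus_distr_l, IH.
    replace (K - Z.of_nat (S k) + 1)%Z with (K - Z.of_nat k)%Z by lia.
    rewrite (Cpowz_succ a (K - Z.of_nat k)) by auto. ring.
Qed.

Lemma Cpowz_lt1_neq1 (a : C) (k : Z) : a <> 0 -> Cmod a < 1 -> k <> 0%Z -> 1 - Cpowz a k <> 0.
Proof.
  intros Ha Ha1 Hk H.
  assert (H1 : Cpowz a k = 1).
  { transitivity (1 - (1 - Cpowz a k)); [ring|]. rewrite H. ring. }
  assert (Hp : forall p, (0 < p)%nat -> Cpow a p <> 1).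
  { intros p Hp E. apply (f_equal Cmod) in E. rewrite Cmod_pow, Cmod_1 in E.
    assert (Cmod a ^ p < 1).
    { apply pow_lt_1_compat; [|lia]. split; auto using Cmod_ge_0. }
    lra. }
  destruct k as [|p|p]; [lia| |]; simpl in H1.
  - apply (Hp (Pos.to_nat p)); auto. lia.
  - apply (Hp (Pos.to_nat p)); [lia|].
    transitivity (/ / Cpow a (Pos.to_nat p)); [|rewrite H1; field; apply C1_nz].
    field. apply Cpow_nz; auto.
Qed.

Let b1 := CT n (theta_weight q (theta q) n).

Lemma brk_one_CT : brk n (theta_weight q (theta q) n) (fun _ => 1) = b1.
Proof. unfold brk, b1. f_equal. apply functional_extensionality. intros u. ring. Qed.

Lemma power_ct_0 (j : nat) : power_ct n q j 0 = b1.
Proof. unfold power_ct. exact brk_one_CT. Qed.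

Definition quot (t : Z) : C :=
  if Z.eqb t 0 then RtoC (INR n)
  else Cdiv (1 - Cpowz q (Z.of_nat n * t)) (1 - Cpowz q t).

Lemma quot_nz (t : Z) : quot t <> 0.
Proof.
  pose proof q_nz as Hq0. unfold quot. destruct (Z.eqb_spec t 0) as [->|Ht].
  - intros H. apply RtoC_inj in H. apply (INR_eq n 0) in H. lia.
  - apply Cmult_neq_0; [|apply nonzero_inv]; apply Cpowz_lt1_neq1; auto. lia.
Qed.

(** All variables contribute here: the [j]-th bracket is [q^(t (m + n - j))] times the common
    constant, and the quotient is the value of this geometric sum. *)
Lemma sum_power_ct_0 (t : Z) : m = ((Z.of_nat n + 1) * t)%Z ->
  sumn n (fun j => power_ct n q j m) = b1 * (Cpowz q (t * (m + 1)) * quot t).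
Proof.
  intros Hm. pose proof q_nz as Hq0.
  rewrite (sumn_ext n _ (fun j => b1 * Cpowz (Cpowz q t) (m + Z.of_nat n - Z.of_nat j))).
  - rewrite sumn_scal. f_equal. unfold quot. destruct (Z.eqb_spec t 0) as [->|Ht].
    + rewrite Z.mul_0_l, !Cpowz_0, (sumn_ext n _ (fun _ => 1)) by (intros; apply Cpowz_1_l).
      rewrite sumn_const. ring.
    + assert (H1 : 1 - Cpowz q t <> 0) by (apply Cpowz_lt1_neq1; auto).
      apply (Cmult_eq_reg_l (1 - Cpowz q t)); auto.
      rewrite geom_desc by (apply Cpowz_nz; auto).
      rewrite <- !Cpowz_mul_r by auto.
      replace (t * (m + Z.of_nat n - Z.of_nat n + 1))%Z with (t * (m + 1))%Z by ring.
      replace (t * (m + Z.of_nat n + 1))%Z with (t * (m + 1) + Z.of_nat n * t)%Z by ring.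
      rewrite Cpowz_add by auto. field. auto.
  - intros j Hj.
    rewrite <- Cpowz_mul_r by auto.
    replace m with (0 + (Z.of_nat n + 1) * t)%Z at 1 by lia.
    rewrite (power_ct_shift n q Hn Hq Hq0 j 0 t Hj), power_ct_0, Cmult_comm. f_equal. f_equal.
    rewrite Hm. ring.
Qed.

(** Only [j = m0 - 1] contributes, with exponent [t (m + n + 1) + m0]; this equals [m t + m] because
    [m = m0 + (n+1) t]. *)
Lemma sum_power_ct_pos (t m0 : Z) : m = (m0 + (Z.of_nat n + 1) * t)%Z -> (1 <= m0 <= Z.of_nat n)%Z ->
  sumn n (fun j => power_ct n q j m) = b1 * - Cpowz q (m * t + m).
Proof.
  intros Hm Hm0. pose proof q_nz as Hq0.
  assert (Hone : forall j, (j < n)%nat -> power_ct n q j m =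
    Cpowz q (t * (2 * m0 + (Z.of_nat n + 1) * (t + 1) - Z.of_nat j - 1)) *
    (if Nat.eqb (Z.to_nat m0) (S j) then - Cpow q (Z.to_nat m0) * b1 else 0)).
  { intros j Hj. rewrite Hm, (power_ct_shift n q Hn Hq Hq0 j m0 t Hj). f_equal.
    rewrite <- (Z2Nat.id m0) at 1 by lia.
    rewrite (power_ct_one n q Hn Hq Hq0 j (Z.to_nat m0)) by (auto; lia).
    rewrite brk_one_CT. reflexivity. }
  rewrite (sumn_single n (Z.to_nat (m0 - 1))).
  - rewrite Hone by lia.
    destruct (Nat.eqb_spec (Z.to_nat m0) (S (Z.to_nat (m0 - 1)))); [|lia].
    rewrite <- Cpowz_nat, (Z2Nat.id m0) by lia.
    replace (m * t + m)%Z
      with (t * (2 * m0 + (Z.of_nat n + 1) * (t + 1) - Z.of_nat (Z.to_nat (m0 - 1)) - 1) + m0)%Z.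
    + rewrite Cpowz_add by auto. ring.
    + rewrite Z2Nat.id by lia. rewrite Hm. ring.
  - lia.
  - intros j Hj Hne. rewrite Hone by auto.
    destruct (Nat.eqb_spec (Z.to_nat m0) (S j)); [lia|]. ring.
Qed.

End Coefs.

(** * The Wilson loop integral and its evaluation *)

Lemma torus_int_ext (n : nat) : forall g h : list C -> C,
  (forall l, length l = n -> (forall i, Cmod (list_point l i) = 1%R) -> g l = h l) ->
  torus_int n g = torus_int n h.
Proof.
  induction n as [|n IH]; intros g h H; simpl.
  - apply H; [reflexivity|]. intros [|i]; apply Cmod_1.
  - f_equal. f_equal. apply functional_extensionality. intros th. apply IH.
    intros l Hl Hm. apply H; [simpl; auto|]. intros [|i]; [apply Cmod_expi | apply Hm].
Qed.

Lemma pairprod_double (h : C -> C -> C) (n : nat) (v : nat -> C) :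
  prodn n (fun i => prodn n (fun j => if Nat.eqb i j then 1 else h (v i) (v j))) =
  pairprod (fun a b => h a b * h b a) n v.
Proof.
  induction n as [|n IH]; [reflexivity|].
  cbn [prodn pairprod]. rewrite Nat.eqb_refl, <- IH.
  rewrite (prodn_ext n (fun i => prodn n (fun j => if Nat.eqb i j then 1 else h (v i) (v j)) *
      (if Nat.eqb i n then 1 else h (v i) (v n)))
    (fun i => prodn n (fun j => if Nat.eqb i j then 1 else h (v i) (v j)) * h (v i) (v n))).
  - rewrite (prodn_ext n (fun j => if Nat.eqb n j then 1 else h (v n) (v j)) (fun j => h (v n) (v j))).
    + rewrite !prodn_mult. ring.
    + intros j Hj. destruct (Nat.eqb_spec n j); [lia|reflexivity].
  - intros i Hi. destruct (Nat.eqb_spec i n); [lia|reflexivity].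
Qed.

Lemma pairprod_mult (f g : C -> C -> C) (n : nat) (u : nat -> C) :
  pairprod (fun a b => f a b * g a b) n u = pairprod f n u * pairprod g n u.
Proof.
  induction n as [|n IH]; simpl; [ring|]. rewrite IH, prodn_mult. ring.
Qed.

Lemma pairprod_ext_fun (f g : C -> C -> C) (n : nat) (u : nat -> C) : nonzero_point u ->
  (forall a b : C, a <> 0 -> b <> 0 -> f a b = g a b) -> pairprod f n u = pairprod g n u.
Proof.
  intros Hu H. induction n as [|n IH]; simpl; [auto|]. rewrite IH. f_equal.
  apply prodn_ext. intros i _. apply H; auto.
Qed.

Lemma fold_prodn (l : list C) : fold_right Cmult 1 l = prodn (length l) (list_point l).
Proof.
  induction l as [|z l IH]; [reflexivity|].
  cbn [length]. rewrite prodn_head. simpl fold_right. rewrite IH. reflexivity.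
Qed.

(** With [s_i = v_i / x] all ratios are unchanged, and only the power sum produces [x^(-m)]. Each
    unordered pair contributes [theta_pair] times [vand_pair]. *)
Lemma integrand_wilson_fun (n : nat) (m : Z) (x r : C) (l : list C) :
  x <> 0 -> r <> 0 -> Cmod (r * r) < 1 -> length l = n -> on_torus (list_point l) ->
  integrand (S n) m x r l = Cpowz x (- m) * wilson_fun r m (S n) (emb n x (list_point l)).
Proof.
  intros Hx Hr Hq Hl Ht.
  set (v := emb n x (list_point l)).
  assert (Hv : nonzero_point v) by (apply emb_nonzero_point; auto; apply nonzero_point_torus; auto).
  assert (HS : forall i, (i < S n)%nat -> sfull (S n) l i = / x * v i).
  { intros i Hi. unfold v, emb, sfull. replace (S n - 1)%nat with n by lia.
    destruct (Nat.ltb_spec i n) as [Hin|Hin].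
    (* The two list accesses have different defaults, 0 and 1, which agree here because [i] is below
       the length. *)
    - replace (nth i l 0) with (list_point l i) by (apply nth_indep; lia). field. auto.
    - rewrite fold_prodn, Hl. field. split; auto.
      apply prodn_nz. intros. apply nonzero_point_torus; auto. }
  unfold integrand. set (q := r * r). cbv zeta.
  rewrite !cprod_seq, csum_seq.
  rewrite (prodn_ext (S n) _ (fun i => prodn (S n) (fun j =>
     if Nat.eqb i j then 1 else (fun a b => qpoch (a * / b) q) (v i) (v j)))).
  2:{ intros i Hi. rewrite cprod_seq. apply prodn_ext. intros j Hj.
      destruct (Nat.eqb i j); auto. rewrite !HS by auto. f_equal. field. auto. }
  rewrite (pairprod_double (fun a b => qpoch (a * / b) q)).
  rewrite (pairprod_ext_fun _ (fun a b => theta_pair q a b * vand_pair a b)) by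
    (auto; intros a b Ha Hb; unfold theta_pair, vand_pair, theta;
     rewrite (qpoch_step (b * / a)) by auto;
     replace (q * / (a * / b)) with (b * / a * q) by (field; auto); ring).
  rewrite pairprod_mult.
  rewrite (prodn_ext (S n) _ (fun i => theta q (r * v i))).
  2:{ intros i Hi. rewrite HS by auto. unfold theta. f_equal; f_equal.
      - field. auto.
      - unfold q. field. auto. }
  rewrite (sumn_ext (S n) _ (fun i => Cpowz x (- m) * Cpowz (v i) m)).
  2:{ intros i Hi. rewrite HS by auto. rewrite Cpowz_mul_l, Cpowz_inv, <- Cpowz_opp; auto.
      apply nonzero_inv; auto. }
  rewrite sumn_scal. unfold wilson_fun, theta_weight, power_sum. fold q. ring.
Qed.

(** Common to both cases of the theorem, which differ only in [E]. The hypothesis [E <> 0] makes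
    [g_0] invertible, and this is how the limit defining [theta_sum] is shown to exist. *)
Lemma Wilson_sum (n : nat) (m : Z) (x r : C) (E : C) :
  x <> 0 -> r <> 0 -> Cmod (r * r) < 1 -> E <> 0 ->
  sumn (S n) (fun j => power_ct (S n) (r * r) j m)
    = CT (S n) (theta_weight (r * r) (theta (r * r)) (S n)) * E ->
  Wilson (S n) m x r =
  / qpoch (r * r) (r * r) * (Cpowz x (- m) * (Cpowz r (- m) * E * theta_sum (S n) m x r)).
Proof.
  intros Hx Hr Hq HE Hsum. set (q := r * r) in *.
  assert (Hq0 : q <> 0) by (apply Cmult_neq_0; auto).
  assert (HG := unif_laurent_wilson_fun (S n) m r Hq Hr).
  assert (Hb := theta_CT q Hq Hq0 (S n) ltac:(lia)).
  set (b1 := CT (S n) (theta_weight q (theta q) (S n))) in *.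
  set (qp := qpoch q q) in *.
  (* Both nonvanishing facts are read off from the product formula of [theta_CT]. *)
  assert (Hqp : qp <> 0).
  { intros H0. apply C1_nz. rewrite <- Hb, H0, Cpow_S. ring. }
  assert (Hb0 : b1 <> 0).
  { intros H0. apply C1_nz. rewrite <- Hb, H0. ring. }
  assert (Hf : RtoC (INR (fact (S n))) <> 0).
  { intros H0. apply RtoC_inj in H0. apply (INR_fact_neq_0 (S n)). exact H0. }
  set (L := CT n (fun u => wilson_fun r m (S n) (emb n x u))).
  assert (HI : torus_int n (integrand (S n) m x r) = Cpowz x (- m) * L).
  { transitivity (CT n (fun u => Cpowz x (- m) * wilson_fun r m (S n) (emb n x u))).
    - apply torus_int_ext. intros l Hl Ht. apply integrand_wilson_fun; auto.
    - apply CT_eq, tint_scal, torus_laurent_tint, torus_laurent_emb; auto. }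
  set (g0 := coef (S n) (wilson_fun r m (S n)) 0).
  assert (Hg0 : g0 = Cpowz r (- m) * (INR (fact (S n)) * (b1 * E))).
  { unfold g0. rewrite coef_zero by (auto; lia). fold q. rewrite Hsum. reflexivity. }
  assert (Hg0n : g0 <> 0).
  { rewrite Hg0. repeat apply Cmult_neq_0; auto. apply Cpowz_nz; auto. }
  assert (HL : L = g0 * theta_sum (S n) m x r).
  { assert (Hth : theta_sum (S n) m x r = / g0 * L).
    { unfold theta_sum, zsum. apply Clim_eq.
      assert (Hs := SU_series n x (wilson_fun r m (S n)) Hx HG).
      apply (Ccv_scal (/ g0)) in Hs. revert Hs. apply Ccv_ext. intros M.
      rewrite csum_seq, <- sym_sum_scal.
      apply (sym_sum_ext _ (fun k => Cpowz (RtoC (-1)) (Z.of_nat (S n) * k) *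
        (Cpowz x (Z.of_nat (S n) * k) *
         Cpowz r (Z.of_nat (S n) * k * k - 2 * m * k)))).
      intros k.
      rewrite (coef_closed (S n) m r ltac:(lia) Hq Hr k). fold g0.
      rewrite <- Cpowz_nat, <- Cpowz_mul_r by auto.
      rewrite (Z.mul_comm k). field. auto. }
    rewrite Hth. field. auto. }
  unfold Wilson. fold q. fold qp. replace (S n - 1)%nat with n by lia.
  rewrite HI, HL, Hg0.
  rewrite Cpow_S in Hb.
  assert (Hb' : Cpow qp n * b1 = / qp).
  { apply (Cmult_eq_reg_l qp); auto. rewrite Cinv_r, <- Hb by auto. ring. }
  rewrite <- Hb'. field. auto.
Qed.

Local Close Scope C_scope.

(* r plays the role of q^{1/2}; q = r^2. t = floor(m/(N+1)) = Z.div m (N+1). *)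
Theorem theorem1p7 (N : nat) (m : Z) (x q r : C) :
  (2 <= N)%nat -> x <> 0%C -> q <> 0%C -> Cmod q < 1 -> Cmult r r = q ->
  let n := Z.of_nat N in
  let t := Z.div m (n + 1) in
  Wilson N m x r =
  if Z.eqb (Z.modulo m (n + 1)) 0 then
    Cmult (Cinv (qpoch q q))
      (Cmult (Cpowz x (- m))
        (Cmult (Cpowz r (2 * (m - n) * t + m))
          (Cmult (if Z.eqb t 0 then RtoC (INR N)
                  else Cdiv (Cminus 1%C (Cpowz q (n * t))) (Cminus 1%C (Cpowz q t)))
                 (theta_sum N m x r))))
  else
    Copp (Cmult (Cinv (qpoch q q))
      (Cmult (Cpowz x (- m))
        (Cmult (Cpowz r (2 * m * t + m)) (theta_sum N m x r)))).
Proof.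
  intros HN Hx Hq0 Hq Hrq n t. subst q.
  assert (Hr : r <> 0%C).
  { intros E. apply Hq0. rewrite E. ring. }
  assert (Hmod := Z.div_mod m (n + 1) ltac:(lia)). fold t in Hmod.
  assert (Hb := Z.mod_pos_bound m (n + 1) ltac:(lia)).
  destruct N as [|k]; [lia|].
  assert (Hqr : forall j, Cpowz (r * r)%C j = Cpowz r (2 * j)).
  { intros j. rewrite Cpowz_mul_l, <- Cpowz_add by auto. f_equal. ring. }
  destruct (Z.eqb_spec (m mod (n + 1)) 0) as [H0|H0].
  - assert (Hm : m = ((n + 1) * t)%Z) by lia.
    rewrite (Wilson_sum k m x r (Cpowz (r * r)%C (t * (m + 1)) * quot (S k) r t)%C); auto.
    + f_equal. f_equal. rewrite Cmult_assoc, Hqr, <- Cpowz_add by auto.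
      (* The exponents agree only because [m = (n + 1) t] in this case. *)
      replace (- m + 2 * (t * (m + 1)))%Z with (2 * (m - n) * t + m)%Z by lia.
      rewrite <- !Cmult_assoc. reflexivity.
    + apply Cmult_neq_0; [apply Cpowz_nz; auto|]. apply quot_nz; auto. lia.
    + apply sum_power_ct_0; auto. lia.
  - rewrite (Wilson_sum k m x r (- Cpowz (r * r) (m * t + m))%C); auto.
    + rewrite Hqr. replace (2 * m * t + m)%Z with (- m + 2 * (m * t + m))%Z by ring.
      rewrite (Cpowz_add r (- m)) by auto. ring.
    + intros E. apply (Cpowz_nz (r * r)%C (m * t + m)); auto.
      transitivity (- - Cpowz (r * r) (m * t + m))%C; [ring|]. rewrite E. ring.
    + apply (sum_power_ct_pos (S k) m r ltac:(lia) Hq Hr t (m mod (n + 1))); lia.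
Qed.
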